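(* For every $d\in\mathbb{N}$ consider the random walk $S_k^{(d)}:=X_1^{(d)}+\dots+X_k^{(d)}$ in $\mathbb{R}^d$ with increments $X_i^{(d)}:=R_iV_i^{(d)}$, $i\in\mathbb{N}$, where $(R_i)_{i=1}^\infty$ are independent copies of a real random variable $R$ (whose distribution does not depend on $d$) with $\mathbb{E}R=0$ and $\mathbb{E}R^2=1$; $(V_i^{(d)})_{i=1}^\infty$ are i.i.d. random vectors with $\mathbb{P}[V_i^{(d)}=e_j]=1/d$ for $j\in\{1,\dots,d\}$, where $e_1,\dots,e_d$ is the standard orthonormal basis of $\mathbb{R}^d$; and $(R_i)_{i=1}^\infty$ and $(V_i^{(d)})_{i=1}^\infty$ are independent. Suppose that for some $\alpha\in(1,2)$ $$\frac{R_1^2+\dots+R_m^2-m}{m^{1/\alpha}L(m)}\ \overset{w}{\longrightarrow}\ \zeta_\alpha\qquad(m\to\infty)$$ for some slowly varying function $L$ and a zero-mean random variable $\zeta_\alpha$ having a spectrally positive $\alpha$-stable distribution. Let $n=n(d)$ be a sequence of positive integers with $n(d)\to\infty$ as $d\to\infty$. (a) If $n>d^{\frac{\alpha}{2\alpha-2}+\delta}$ for some $\delta>0$ and all sufficiently large $d$, then, as $d\to\infty$, $$\frac{\|S_n^{(d)}\|^2-n}{\sqrt{2n^2/d}}\ \overset{w}{\longrightarrow}\ \mathrm{N}(0,1).$$ (b) If $n<d^{\frac{\alpha}{2\alpha-2}-\delta}$ for some $\delta>0$ and all sufficiently large $d$, then, as $d\to\infty$, $$\frac{\|S_n^{(d)}\|^2-n}{n^{1/\alpha}L(n)}\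 \overset{w}{\longrightarrow}\ \zeta_\alpha.$$
   Context: $\|\cdot\|$ is the Euclidean norm, $\overset{w}{\longrightarrow}$ denotes convergence in distribution, and $\mathrm{N}(0,1)$ is the standard normal distribution. Slowly varying means (positive and) slowly varying at infinity in Karamata's sense: $L(cx)/L(x)\to1$ as $x\to\infty$ for every $c>0$. Spectrally positive means that the (non-degenerate) stable law has no negative jumps, i.e. its Lévy measure is concentrated on $(0,\infty)$. *)

(* Defs.v *)
From HB Require Import structures.
From mathcomp Require Import all_boot all_order all_algebra.
From mathcomp Require Import finmap.
From mathcomp Require Import all_classical all_reals all_analysis.

Set Implicit Arguments.
Unset Strict Implicit.
Unset Printing Implicit Defensive.

Import Order.TTheory GRing.Theory Num.Theory.
Import numFieldNormedType.Exports.

Local Open Scope classical_set_scope.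
Local Open Scope ring_scope.

(* R^d, as the space of row vectors, with its Borel sigma-algebra. *)
Notation borel_rV R d := (g_sigma_algebraType (@open 'rV[R]_d)).

Definition euclid_norm (R : realType) (d : nat) (v : 'rV[R]_d) : R :=
  Num.sqrt (\sum_(j < d) v 0 j ^+ 2).

(* S_k = X_1 + ... + X_k with X_i = R_i V_i; the indices are shifted by one,
   the increments being numbered from 0. *)
Definition walk (R : realType) (T : Type) (d : nat) (r : nat -> T -> R)
    (v : nat -> T -> 'rV[R]_d) (k : nat) (w : T) : 'rV[R]_d :=
  \sum_(i < k) r i w *: v i w.

Section independence.
Context {dT : measure_display} {T : measurableType dT} {R : realType}.
Variable P : probability T R.

Definition mutually_independent (I : choiceType) (F : I -> set_system T) :=
  forall (J : {fset I}) (A : I -> set T), (forall i, i \in J -> F i (A i)) ->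
    P (\bigcap_(i in [set` J]) A i) = (\prod_(i <- J) P (A i))%E.

Definition independent (F G : set_system T) :=
  forall A B : set T, F A -> G B -> P (A `&` B) = (P A * P B)%E.

End independence.

(* sigma(X) *)
Definition sigma_rv {dT dU : measure_display} {T : measurableType dT}
    {U : measurableType dU} (X : T -> U) : set_system T :=
  preimage_set_system setT X measurable.

(* sigma(X_0, X_1, ...) *)
Definition sigma_seq {dT dU : measure_display} {T : measurableType dT}
    {U : measurableType dU} (X : nat -> T -> U) : set_system T :=
  <<s \bigcup_i sigma_rv (X i) >>.

Definition same_law {dT dU : measure_display} {T : measurableType dT}
    {U : measurableType dU} {R : realType} (P : probability T R)
    (Q : probability U R) (X : {RV P >-> R}) (Y : {RV Q >-> R}) :=
  forall A : set R, measurable A -> distribution P X A = distribution Q Y A.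

(* Convergence in distribution of the real random variables X_n under P to the
   random variable Y under Q, tested against bounded continuous functions. *)
Definition cvg_in_law {dT dU : measure_display} {T : measurableType dT}
    {U : measurableType dU} {R : realType} (P : probability T R)
    (X : nat -> T -> R) (Q : probability U R) (Y : U -> R) :=
  forall f : R -> R, continuous f -> bounded_fun f ->
    ('E_P[f \o X n] @[n --> \oo] --> 'E_Q[f \o Y])%E.

Definition slowly_varying (R : realType) (L : R -> R) :=
  (forall x : R, 0 < x -> 0 < L x) /\
  (forall c : R, 0 < c -> L (c * x) / L x @[x --> +oo] --> (1 : R)).

Section stable_laws.
Context {R : realType}.
Implicit Type mu : probability R R.

Definition nondegenerate_law mu := forall c : R, mu [set c] != 1%E.

(* For X, Y independent of law mu and all a, b > 0, the variable a X + b Y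
   has the law of (a^alpha + b^alpha)^(1/alpha) X + c for some c. *)
Definition stable (alpha : R) mu :=
  forall a b : R, 0 < a -> 0 < b -> exists c : R,
    forall A : set R, measurable A ->
      (mu \x mu)%E [set z | A (a * z.1 + b * z.2)] =
      mu [set x | A ((a `^ alpha + b `^ alpha) `^ alpha^-1 * x + c)].

(* Real and imaginary parts of the Levy-Khintchine exponent
     i b t - s t^2 / 2 + \int (e^(i t x) - 1 - i t x 1_(|x| <= 1)) nu(dx). *)
Definition levy_exponent_Re (s : R) (nu : {measure set R -> \bar R}) (t : R) :=
  - (s * t ^+ 2 / 2) + \int[nu]_x (cos (t * x) - 1).

Definition levy_exponent_Im (b : R) (nu : {measure set R -> \bar R}) (t : R) :=
  b * t + \int[nu]_x (sin (t * x) - t * x * \1_`[-1, 1] x).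

(* mu is infinitely divisible with drift b, Gaussian variance s and Levy
   measure nu: its characteristic function is the exponential of the
   Levy-Khintchine exponent (split into real and imaginary parts). *)
Definition levy_triplet mu (b s : R) (nu : {measure set R -> \bar R}) :=
  [/\ 0 <= s,
      nu [set 0] = 0%E,
      (\int[nu]_x (Num.min 1 (x ^+ 2))%:E < +oo)%E &
      forall t : R,
        \int[mu]_x cos (t * x) =
          expR (levy_exponent_Re s nu t) * cos (levy_exponent_Im b nu t) /\
        \int[mu]_x sin (t * x) =
          expR (levy_exponent_Re s nu t) * sin (levy_exponent_Im b nu t)].

(* The Levy measure is unique, so it does not matter which triplet is used. *)
Definition no_negative_jumps mu :=
  exists (b s : R) (nu : {measure set R -> \bar R}),
    levy_triplet mu b s nu /\ nu [set x | x <= 0] = 0%E.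

Definition spectrally_positive_stable (alpha : R) mu :=
  [/\ nondegenerate_law mu, stable alpha mu & no_negative_jumps mu].

End stable_laws.

(* Main.v *)
(* With A_n := R_1^2 + ... + R_n^2 - n and a_n := n^(1/alpha) L(n), almost surely
   |S_n|^2 - n = A_n + Q_n, where Q_n = sum_(i < j) 2 R_i R_j 1{V_i = V_j} has
   mean 0 and second moment 2n(n-1)/d. Up to factors n^(+-e), a_n is n^(1/alpha):
   L(2x)/L(x) -> 1 controls a_(2n)/a_n, and a_m cannot be much smaller than a_M
   for M <= m, because the modulus of the characteristic function of A_m
   decreases in m and the limit law is not degenerate. So d a_n^2 / n^2 tends to
   infinity in case (b), where Q_n / a_n -> 0 in L^2, and to 0 in case (a), where
   A_n is negligible with respect to sqrt(2n^2/d).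

   In case (a) the R_i in Q_n can be replaced by bounded centred variables g(R_i),
   at a cost in L^2 that is small uniformly in n and d. The martingale Q_n(g) is
   then compared step by step with a Gaussian flow: its k-th increment is
   replaced by a normal variable of variance (2k+1)/n^2 (relative to 2n^2/d), the
   smoothed test function absorbing the remaining variance 1 - (k+1)^2/n^2. The
   squared norm of the walk with steps g(R_i) V_i, which governs the conditional
   variances, is concentrated as soon as n^2/d -> infinity. *)

Require Import Defs.
From HB Require Import structures.
From mathcomp Require Import all_boot all_order all_algebra.
From mathcomp Require Import finmap.
From mathcomp Require Import all_classical all_reals all_analysis.
From mathcomp Require Import measurable_realfun ring lra.

Set Implicit Arguments.
Unset Strict Implicit.
Unset Printing Implicit Defensive.

Import Order.TTheory GRing.Theory Num.Theory.
Import numFieldNormedType.Exports.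

Local Open Scope classical_set_scope.
Local Open Scope ring_scope.


(** * Means *)

(** Since R^2 is attracted to a stable law of index alpha < 2, R has no fourth moment, and neither
    the conditional variances of Q_n nor its Taylor remainders can be estimated directly. This is
    why g is bounded: passing from R to g(R) costs only second moments, which are exact for Q_n, and
    every fourth moment is taken afterwards. The constants are accordingly chosen in a fixed order:
    the bound B of g, then the weight k of Young's inequality, then d and n. Nothing has to be
    uniform in B. The growth of a_n needs an argument of its own because L is not assumed
    measurable: the uniform convergence theorem and Potter's bounds are out of reach, and L(2x)/L(x)
    -> 1 alone says nothing about a_m between two consecutive powers of 2. The limit theorem for A_m
    itself supplies the missing comparison. *)

Section mean_theory.
Context d (T : measurableType d) (R : realType) (P : probability T R).
Implicit Types (X Y : T -> R).

Definition integ X : Prop := P.-integrable [set: T] (EFin \o X).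
Definition mean X : R := \int[P]_w X w.

Lemma integ_measurable X : integ X -> measurable_fun [set: T] X.
Proof. by move/measurable_int/measurable_EFinP. Qed.

Lemma integ_cst c : integ (fun=> c).
Proof. exact: finite_measure_integrable_cst. Qed.

Lemma integD X Y : integ X -> integ Y -> integ (fun w => X w + Y w).
Proof. by move=> iX iY; exact: (@integrableD _ _ _ _ _ measurableT _ _ iX iY). Qed.

Lemma integZ c X : integ X -> integ (fun w => c * X w).
Proof. by move=> iX; exact: (@integrableZl _ _ _ _ _ measurableT c _ iX). Qed.

Lemma integN X : integ X -> integ (fun w => - X w).
Proof.
by move=> /(integZ (-1)); apply: eq_integrable => // w _ /=; rewrite mulN1r.
Qed.

Lemma integB X Y : integ X -> integ Y -> integ (fun w => X w - Y w).
Proof. by move=> iX /integN; exact: integD. Qed.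

Lemma integ_sum (I : Type) (s : seq I) (F : I -> T -> R) :
  (forall i, integ (F i)) -> integ (fun w => \sum_(i <- s) F i w).
Proof.
move=> iF; elim: s => [|i s IH].
  by under eq_fun do rewrite big_nil; exact: integ_cst.
by under eq_fun do rewrite big_cons; exact: integD.
Qed.

Lemma integ_le X Y : measurable_fun [set: T] X -> (forall w, `|X w| <= Y w) ->
  integ Y -> integ X.
Proof.
move=> mX XY iY; apply: (le_integrable measurableT _ _ iY).
  exact/measurable_EFinP.
move=> w _ /=; rewrite lee_fin.
by rewrite (le_trans (XY w)) // ler_norm.
Qed.

Lemma integ_bounded c X : measurable_fun [set: T] X -> (forall w, `|X w| <= c) ->
  integ X.
Proof. by move=> mX /integ_le; apply => //; exact: integ_cst. Qed.

Lemma integ_norm X : integ X -> integ (fun w => `|X w|).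
Proof.
move=> iX; apply: (@integ_le _ (fun w => `|X w|)).
- by apply: measurableT_comp; [exact: normr_measurable|exact: integ_measurable].
- by move=> w; rewrite normr_id.
- exact: (@integrable_norm _ _ _ _ _ _ iX).
Qed.

Lemma eq_mean X Y : X =1 Y -> mean X = mean Y.
Proof. by move=> /funext ->. Qed.

Lemma fine_expectation X : fine ('E_P[X])%E = mean X.
Proof. by rewrite unlock. Qed.

Lemma mean_cst c : mean (fun=> c) = c.
Proof. by rewrite -fine_expectation expectation_cst. Qed.

Lemma meanD X Y : integ X -> integ Y -> mean (fun w => X w + Y w) = mean X + mean Y.
Proof. by move=> iX iY; exact: RintegralD. Qed.

Lemma meanZ c X : integ X -> mean (fun w => c * X w) = c * mean X.
Proof. by move=> iX; exact: RintegralZl. Qed.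

Lemma meanN X : integ X -> mean (fun w => - X w) = - mean X.
Proof.
move=> iX; rewrite -mulN1r -meanZ//; apply: eq_mean => w.
by rewrite mulN1r.
Qed.

Lemma meanB X Y : integ X -> integ Y -> mean (fun w => X w - Y w) = mean X - mean Y.
Proof. by move=> iX iY; rewrite meanD ?meanN//; exact: integN. Qed.

Lemma mean_sum (I : Type) (s : seq I) (F : I -> T -> R) :
  (forall i, integ (F i)) ->
  mean (fun w => \sum_(i <- s) F i w) = \sum_(i <- s) mean (F i).
Proof.
move=> iF; elim: s => [|i s IH].
  by under eq_fun do rewrite big_nil; rewrite mean_cst big_nil.
under eq_fun do rewrite big_cons.
by rewrite meanD// ?IH ?big_cons//; exact: integ_sum.
Qed.

Lemma mean_le X Y : integ X -> integ Y -> (forall w, X w <= Y w) -> mean X <= mean Y.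
Proof. by move=> iX iY XY; apply: le_Rintegral. Qed.

Lemma mean_ge0 X : (forall w, 0 <= X w) -> 0 <= mean X.
Proof. by move=> X0; apply: Rintegral_ge0. Qed.

Lemma mean_norm_le X : integ X -> `|mean X| <= mean (fun w => `|X w|).
Proof. by move=> iX; apply: le_normr_Rintegral. Qed.

Lemma mean_le_cst c X : integ X -> (forall w, X w <= c) -> mean X <= c.
Proof.
by move=> iX Xc; rewrite -[leRHS]mean_cst; apply: mean_le => //; exact: integ_cst.
Qed.

Lemma mean_norm_le_cst c X : integ X -> (forall w, `|X w| <= c) -> `|mean X| <= c.
Proof.
move=> iX Xc; rewrite (le_trans (mean_norm_le iX))// mean_le_cst//.
exact: integ_norm.
Qed.

Lemma ae_eq_mean X Y : measurable_fun [set: T] X -> measurable_fun [set: T] Y ->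
  (\forall w \ae P, X w = Y w) -> mean X = mean Y.
Proof.
move=> mX mY XY; rewrite /mean /Rintegral; congr fine.
apply: ae_eq_integral => //; [exact/measurable_EFinP|exact/measurable_EFinP|].
by apply: filterS XY => w /= -> _.
Qed.

Lemma expectation_mean X : integ X -> ('E_P[X])%E = (mean X)%:E.
Proof.
move=> iX; rewrite unlock /mean /Rintegral fineK//.
exact: integrable_fin_num.
Qed.

Definition sqint X := measurable_fun [set: T] X /\ integ (fun w => X w ^+ 2).

Lemma sqint_mul X Y : sqint X -> sqint Y -> integ (fun w => X w * Y w).
Proof.
move=> [mX X2] [mY Y2]; apply: integ_le (integD X2 Y2).
  exact: measurable_funM.
move=> w; rewrite ler_norml; set x := X w; set y := Y w.
have := sqr_ge0 (x + y); have := sqr_ge0 (x - y).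
rewrite sqrrB sqrrD => h1 h2.
have := sqr_ge0 x; have := sqr_ge0 y => h3 h4.
by apply/andP; split; lra.
Qed.

Lemma sqint_cst c : sqint (fun=> c).
Proof. by split => //; exact: integ_cst. Qed.

Lemma sqint_integ X : sqint X -> integ X.
Proof.
by move=> sX; have := sqint_mul sX (sqint_cst 1); under eq_fun do rewrite mulr1.
Qed.

Lemma sqintD X Y : sqint X -> sqint Y -> sqint (fun w => X w + Y w).
Proof.
move=> sX sY; split; first by apply: measurable_funD; [case: sX|case: sY].
under eq_fun do rewrite sqrrD.
apply: integD; last by case: sY.
by apply: integD; [case: sX|have := integZ 2 (sqint_mul sX sY); under eq_fun do rewrite mulr_natl].
Qed.

Lemma sqintZ c X : sqint X -> sqint (fun w => c * X w).
Proof.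
move=> [mX X2]; split; first exact: measurable_funM.
by under eq_fun do rewrite exprMn; exact: integZ.
Qed.

Lemma sqintB X Y : sqint X -> sqint Y -> sqint (fun w => X w - Y w).
Proof.
move=> sX /(sqintZ (-1)) sY; have := sqintD sX sY.
by under eq_fun do rewrite mulN1r.
Qed.

Lemma sqint_sum (I : Type) (s : seq I) (F : I -> T -> R) :
  (forall i, sqint (F i)) -> sqint (fun w => \sum_(i <- s) F i w).
Proof.
move=> iF; elim: s => [|i s IH].
  by under eq_fun do rewrite big_nil; exact: sqint_cst.
by under eq_fun do rewrite big_cons; exact: sqintD.
Qed.

Lemma sqint_bounded c X : measurable_fun [set: T] X -> (forall w, `|X w| <= c) ->
  sqint X.
Proof.
move=> mX Xc; split => //; apply: (@integ_bounded (c ^+ 2)).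
  exact: measurable_funX.
by move=> w; rewrite normrX lerXn2r ?nnegrE// (le_trans _ (Xc w)).
Qed.

(** Expands (k - |X|)^2 >= 0. The free parameter [k] replaces the square root of Cauchy-Schwarz and
    is tuned at each use. *)
Lemma mean_norm_le_sqr (k : R) X : 0 < k -> sqint X ->
  mean (fun w => `|X w|) <= (k + mean (fun w => X w ^+ 2) / k) / 2.
Proof.
move=> k0 sX; have [mX iX2] := sX; have iX := sqint_integ sX.
have -> : (k + mean (fun w => X w ^+ 2) / k) / 2 =
    mean (fun w => k / 2 + (2 * k)^-1 * X w ^+ 2).
  rewrite meanD; [|exact: integ_cst|exact: integZ]; rewrite mean_cst meanZ//.
  by rewrite invfM; field; rewrite gt_eqF.
apply: mean_le; [exact: integ_norm|apply: integD; [exact: integ_cst|exact: integZ]|].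
move=> w; rewrite -subr_ge0.
have -> : k / 2 + (2 * k)^-1 * X w ^+ 2 - `|X w| = (k - `|X w|) ^+ 2 / (2 * k).
  by rewrite -[X w ^+ 2]real_normK ?num_real//; field; rewrite gt_eqF.
by rewrite divr_ge0 ?sqr_ge0// mulr_ge0// ltW.
Qed.

End mean_theory.

(** * Independence *)

Section independence_theory.
Context d (T : measurableType d) (R : realType) (P : probability T R).

(** The joint law is the product law, since the two agree on rectangles; Tonelli then gives
    integrability of the product and Fubini its value. *)
Lemma indep_rv_mean_mul (X Y : {RV P >-> R}) :
  integ P X -> integ P Y -> independent P (sigma_rv X) (sigma_rv Y) ->
  integ P (fun w => X w * Y w) /\
  mean P (fun w => X w * Y w) = mean P X * mean P Y.
Proof.
move=> iX iY XY.
have mZ : measurable_fun [set: T] (fun w => (X w, Y w)).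
  by apply: measurable_fun_pair; exact: measurable_funPT.
pose Z : {RV P >-> (R * R)%type} := mfun_Sub (mem_set mZ).
pose DX := distribution P X; pose DY := distribution P Y.
have DZ (f : R * R -> \bar R) :
    (\int[distribution P Z]_z f z = \int[(DX \x DY)%E]_z f z)%E.
  apply: eq_measure_integral => A mA _; symmetry.
  apply: (product_measure_unique (m' := distribution P Z)) => // A1 A2 mA1 mA2.
  rewrite /DX /DY /distribution /pushforward /= -XY //.
    by exists A1 => //; rewrite setTI.
  by exists A2 => //; rewrite setTI.
have mf : measurable_fun [set: R * R] (fun z : R * R => (z.1 * z.2)%:E).
  apply/measurable_EFinP; apply: measurable_funM.
    exact: measurable_fst.
  exact: measurable_snd.
have iXY : integ P (fun w => X w * Y w).
  apply/integrableP; split.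
    by apply/measurable_EFinP; apply: measurable_funM; exact: measurable_funPT.
  have mf' : measurable_fun [set: R * R] (fun z : R * R => `|(z.1 * z.2)%:E|%E).
    exact: measurableT_comp.
  rewrite -(ge0_integral_distribution Z mf') ?DZ//.
  rewrite fubini_tonelli1//= /fubini_F/=.
  under eq_integral => x _.
    under eq_integral => y _ do rewrite normrM EFinM.
    rewrite ge0_integralZl//=; last first.
      by apply/measurable_EFinP; exact: normr_measurable.
    over.
  rewrite ge0_integralZr//=; last first.
      by apply: integral_ge0.
    by apply/measurable_EFinP; exact: normr_measurable.
  rewrite ge0_integral_distribution//; last first.
    by apply/measurable_EFinP; exact: normr_measurable.
  rewrite ge0_integral_distribution//; last first.
    by apply/measurable_EFinP; exact: normr_measurable.
  apply: lte_mul_pinfty; first by apply: integral_ge0 => w _ /=; rewrite lee_fin.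
    exact: (integrable_fin_num measurableT (integ_norm iX)).
  by case/integrableP: iY.
split=> //.
have iXYd : (DX \x DY)%E.-integrable [set: R * R] (fun z : R * R => (z.1 * z.2)%:E).
  apply/integrableP; split => //.
  rewrite -DZ ge0_integral_distribution//; first by case/integrableP: iXY.
  exact: measurableT_comp.
apply: EFin_inj; rewrite EFinM -!expectation_mean// unlock.
rewrite -(integral_distribution (X := Z) mf)// DZ -integral12_prod_meas1// /fubini_F/=.
have iDY : DY.-integrable [set: R] EFin.
  apply/integrableP; split; first exact: EFin_measurable.
  rewrite ge0_integral_distribution//; first by case/integrableP: iY.
  by apply: measurableT_comp => //; exact: EFin_measurable.
have iDX : DX.-integrable [set: R] EFin.
  apply/integrableP; split; first exact: EFin_measurable.
  rewrite ge0_integral_distribution//; first by case/integrableP: iX.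
  by apply: measurableT_comp => //; exact: EFin_measurable.
under eq_integral => x _.
  under eq_integral => y _ do rewrite EFinM.
  rewrite integralZl//=.
  over.
have fY : (\int[DY]_y y%:E)%E = (\int[P]_w (Y w)%:E)%E.
  by rewrite integral_distribution//; exact: EFin_measurable.
have fX : (\int[DX]_y y%:E)%E = (\int[P]_w (X w)%:E)%E.
  by rewrite integral_distribution//; exact: EFin_measurable.
have /fineK <- := integrable_fin_num measurableT iDY.
by rewrite integralZr//= fineK ?fY ?fX//; exact: integrable_fin_num.
Qed.

Lemma indep_mean_mul (X Y : T -> R) :
  integ P X -> integ P Y -> independent P (sigma_rv X) (sigma_rv Y) ->
  integ P (fun w => X w * Y w) /\
  mean P (fun w => X w * Y w) = mean P X * mean P Y.
Proof.
move=> iX iY XY.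
pose X' : {RV P >-> R} := mfun_Sub (mem_set (integ_measurable iX)).
pose Y' : {RV P >-> R} := mfun_Sub (mem_set (integ_measurable iY)).
exact: (@indep_rv_mean_mul X' Y').
Qed.

Lemma independentC (F G : set_system T) : independent P F G -> independent P G F.
Proof. by move=> FG A B GA FB; rewrite setIC FG// muleC. Qed.

(** For fixed [B] in [G], the probability of the intersection of A and B and the product P(A) P(B)
    are finite measures in A that agree on the pi-system [F]. *)
Lemma independent_sigma_left (F G : set_system T) :
  F `<=` measurable -> G `<=` measurable -> setI_closed F -> F [set: T] ->
  independent P F G -> independent P <<s F >> G.
Proof.
move=> mF mG FI FT FG A B sA GB.
have mB := mG _ GB.
pose b : {nonneg R} := NngNum (fine_ge0 (measure_ge0 P B)).
have bE : (b%:num)%:E = P B by rewrite /= fineK// fin_num_measure.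
rewrite [RHS]muleC -bE.
rewrite -[LHS]/(mrestr P mB A) -[RHS]/(mscale b P A).
apply: (@g_sigma_algebra_measure_unique _ _ _ F mF (fun=> [set: T])) => //.
- by rewrite bigcup_const//; exists 0%N.
- move=> C FC; rewrite -[LHS]/(P (C `&` B)) -[RHS]/((b%:num)%:E * P C)%E.
  by rewrite bE muleC FG.
- move=> _ ; rewrite -[X in (X < _)%E]/(P ([set: T] `&` B)) setTI.
  by rewrite (le_lt_trans (probability_le1 _ mB))// ltry.
Qed.

Lemma independent_sigma (F G : set_system T) :
  F `<=` measurable -> G `<=` measurable -> setI_closed F -> setI_closed G ->
  F [set: T] -> G [set: T] ->
  independent P F G -> independent P <<s F >> <<s G >>.
Proof.
move=> mF mG FI GI FT GT FG.
apply: independentC; apply: independent_sigma_left => //.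
  by apply: smallest_sub => //; exact: sigma_algebra_measurable.
by apply: independentC; apply: independent_sigma_left.
Qed.

Definition measurable_wrt (G : set_system T) (X : T -> R) :=
  measurable_fun [set: g_sigma_algebraType G] X.

Lemma measurable_wrt_sigma_rv G X : measurable_wrt G X -> sigma_rv X `<=` <<s G >>.
Proof. by move=> mX _ [B mB <-]; exact: (mX measurableT). Qed.

Lemma measurable_wrt_measurable G X : G `<=` measurable -> measurable_wrt G X ->
  measurable_fun [set: T] X.
Proof.
move=> mG mX _ B mB.
have sG : <<s G >> `<=` measurable.
  by apply: smallest_sub => //; exact: sigma_algebra_measurable.
by apply: sG; exact: (mX measurableT).
Qed.

Lemma independent_mean_mul F G X Y : independent P <<s F >> <<s G >> ->
  measurable_wrt F X -> measurable_wrt G Y -> integ P X -> integ P Y ->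
  integ P (fun w => X w * Y w) /\
  mean P (fun w => X w * Y w) = mean P X * mean P Y.
Proof.
move=> FG mX mY iX iY; apply: indep_mean_mul => // A B XA YB.
by apply: FG; [exact: (measurable_wrt_sigma_rv mX)|exact: (measurable_wrt_sigma_rv mY)].
Qed.

End independence_theory.

(** * Cylinder events over disjoint sets of indices *)

Section blocks.
Context d (T : measurableType d) (R : realType) (P : probability T R).
Context (F : nat -> set_system T).
Context (mF : forall i, F i `<=` measurable).
Context (FI : forall i, setI_closed (F i)).
Context (FT : forall i, F i [set: T]).
Context (Find : mutually_independent P F).
Implicit Types (N : nat) (J : pred nat).

(** A pi-system of cylinders. Coordinates outside [J] carry the whole space and all products run
    over i < N, so for disjoint [J] and [J'] two such products merge factor by factor. *)
Definition block N J : set_system T :=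
  [set A | exists B : nat -> set T, [/\ forall i, F i (B i),
    forall i, ~~ J i -> B i = [set: T] & A = \bigcap_(i < N) B i]].

Lemma block_measurable N J : block N J `<=` measurable.
Proof.
move=> _ [B [FB _ ->]]; apply: bigcap_measurableType => i _.
exact: (mF (FB i)).
Qed.

Lemma block_setI N J : setI_closed (block N J).
Proof.
move=> _ _ [A [FA JA ->]] [B [FB JB ->]]; exists (fun i => A i `&` B i); split.
- by move=> i; exact: FI.
- by move=> i Ji; rewrite JA// JB// setTI.
- by rewrite bigcapI.
Qed.

Lemma block_setT N J : block N J [set: T].
Proof.
exists (fun=> [set: T]); split => //.
by rewrite bigcapT.
Qed.

Lemma mem_block N J i A : (i < N)%N -> J i -> F i A -> block N J A.
Proof.
move=> iN Ji FA; exists (fun j => if j == i then A else [set: T]); split.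
- by move=> j; case: eqP => [->|].
- by move=> j; case: eqP => [->|//]; rewrite Ji.
- apply/seteqP; split => [w Aw j _|w /(_ i iN)] /=; last by rewrite eqxx.
  by case: eqP.
Qed.

Lemma prob_bigcap N (B : nat -> set T) : (forall i, F i (B i)) ->
  P (\bigcap_(i < N) B i) = (\prod_(i < N) P (B i))%E.
Proof.
move=> FB.
pose J := [fset i in iota 0 N]%fset.
have -> : \bigcap_(i < N) B i = \bigcap_(i in [set` J]) B i.
  by congr bigcap; apply/seteqP; split => i /=; rewrite /J in_fset /= mem_iota.
rewrite Find//.
rewrite (perm_big (iota 0 N)) /=; last first.
  apply: uniq_perm; [exact: fset_uniq|exact: iota_uniq|].
  by move=> i; rewrite /J in_fset.
by rewrite -[in RHS](big_mkord xpredT (fun i => P (B i))) /index_iota subn0.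
Qed.

Lemma block_independent N J J' : (forall i, J i -> ~~ J' i) ->
  independent P <<s block N J >> <<s block N J' >>.
Proof.
move=> JJ'; apply: independent_sigma; try exact: block_measurable;
  try exact: block_setI; try exact: block_setT.
move=> _ _ [A [FA JA ->]] [B [FB JB ->]].
rewrite -bigcapI !prob_bigcap// -?big_split/=; last by move=> i; exact: FI.
apply: eq_bigr => i _; have [Ji|Ji] := boolP (J i).
  by rewrite (JB i) ?JJ'// setIT probability_setT mule1.
by rewrite (JA i)// setTI probability_setT mul1e.
Qed.

Lemma block_measurable_wrt N J i (X : T -> R) : (i < N)%N -> J i ->
  sigma_rv X `<=` F i -> measurable_wrt (block N J) X.
Proof.
move=> iN Ji XF _ B mB; apply: sub_sigma_algebra.
by apply: (mem_block iN Ji); apply: XF; exists B.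
Qed.

End blocks.

(** * Smooth test functions and convergence in law *)

Section antiderivative.
Context (R : realType).
Local Notation leb := (@lebesgue_measure R).

Lemma continuous_itv_integrable (f : R -> R) (a b : R) : continuous f ->
  leb.-integrable `[a, b] (EFin \o f).
Proof.
move=> cf; apply: continuous_compact_integrable; first exact: segment_compact.
by apply: continuous_subspaceT => x; exact: cf.
Qed.

Lemma antiderivative (f : R -> R) : continuous f ->
  exists F : R -> R, forall x : R, is_derive x 1 F (f x).
Proof.
move=> cf.
pose F (x : R) := if 0 <= x then \int[leb]_(t in `]0, x]) f t
  else - \int[leb]_(t in `]x, 0]) f t.
have FE (a x : R) : a < 0 -> a < x ->
    F x = \int[leb]_(t in `[a, x]) f t - \int[leb]_(t in `[a, 0]) f t.
  move=> a0 ax; rewrite /F; case: ifPn => [x0|].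
    by rewrite Rintegral_itvB// ?bnd_simp ?(ltW a0)//; exact: continuous_itv_integrable.
  rewrite -ltNge => x0; rewrite -opprB; congr (- _).
  by rewrite Rintegral_itvB// ?bnd_simp ?(ltW a0) ?(ltW ax) ?(ltW x0)//; exact: continuous_itv_integrable.
exists F => x.
(* The fundamental theorem is applied from a base point to the left of both x and 0; by [FE] the
   resulting integral differs from [F] by a constant near x. *)
pose a := Num.min x 0 - 1.
have ax : a < x by rewrite /a; case: (leP x 0) => ?; lra.
have a0 : a < 0 by rewrite /a; case: (leP x 0) => ?; lra.
apply: (@near_eq_is_derive _ _ _
    (fun y => \int[leb]_(t in `[a, y]) f t - \int[leb]_(t in `[a, 0]) f t)).
  near=> y; rewrite -FE//; near: y.
  exact: lt_nbhsr.
have xx1 : x < x + 1 by rewrite ltrDl.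
have [dF FEx] := continuous_FTC1_closed xx1
  (@continuous_itv_integrable f a (x + 1) cf) ax (cf x).
have dI : is_derive x 1 (fun y => \int[leb]_(t in `[a, y]) f t) (f x).
  by split; [exact: dF|rewrite -derive1E].
have dc := @is_derive_cst _ _ _ (\int[leb]_(t in `[a, 0]) f t) x 1.
by move: (is_deriveB dI dc); rewrite subr0.
Unshelve. all: by end_near. Qed.

(** Only [x] is confined to the compact interval: [y] will be a point produced by smoothing, which
    may fall outside. *)
Lemma compact_uniform_continuity (f : R -> R) (K e : R) : continuous f -> 0 < e ->
  exists2 dlt : R, 0 < dlt &
    forall x y, `|x| <= K -> `|x - y| <= dlt -> `|f x - f y| <= e.
Proof.
move=> cf e0.
have /compact_near_coveringP cK := @segment_compact R (- K) K.
have := cK R (0 : R)^'+ (fun (dlt x : R) => forall y, `|x - y| <= dlt -> `|f x - f y| <= e) _.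
case.
  move=> x _.
  have /cvgrPdist_le /(_ (e / 2)) := cf x.
  rewrite divr_gt0// => /(_ isT) [dl /= dl0 Hd].
  exists (ball x (dl / 2), [set t | t < dl / 2]) => /=.
    split; first by exists (dl / 2) => //=; rewrite divr_gt0.
    by apply: nbhs_right_lt; rewrite divr_gt0.
  move=> [z t] /= [xz tdl] y zy.
  have h1 : `|f x - f z| <= e / 2 by apply: Hd => /=; rewrite (lt_le_trans xz)// ler_pdivrMr// ler_peMr ?ler1n// ltW.
  have h2 : `|f x - f y| <= e / 2.
    apply: Hd => /=; rewrite -(subrKA z).
    by rewrite (le_lt_trans (ler_normD _ _))// (splitr dl) ltr_leD// ?(le_trans zy)// ltW.
  rewrite -(subrKA (f x)) (le_trans (ler_normD _ _))// (splitr e) lerD//.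
  by rewrite distrC.
move=> dl /= dl0 Hd.
exists (dl / 2); first by rewrite divr_gt0.
move=> x y xK; apply: Hd => /=.
- by rewrite sub0r normrN gtr0_norm ?divr_gt0// ltr_pdivrMr// ltr_pMr// ltr1n.
- by rewrite divr_gt0.
- by rewrite in_itv/= -ler_norml.
Qed.
End antiderivative.

Section smoothing.
Context (R : realType).
Implicit Types (f g h p : R -> R) (C : R).

(** [p1] and [p2] act as the first two derivatives of [p], but only estimates are recorded: they
    pass to Gaussian averages with the same [C], without differentiation under the integral. *)
Record taylor3 C p p1 p2 : Prop := Taylor3 {
  t3_bnd : forall x, `|p x| <= C;
  t3_bnd1 : forall x, `|p1 x| <= C;
  t3_bnd2 : forall x, `|p2 x| <= C;
  t3_lip : forall x y, `|p x - p y| <= C * `|x - y|;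
  t3_lip1 : forall x y, `|p1 x - p1 y| <= C * `|x - y|;
  t3_lip2 : forall x y, `|p2 x - p2 y| <= C * `|x - y|;
  t3_taylor : forall x y,
    `|p (x + y) - p x - p1 x * y - p2 x * (y ^+ 2 / 2)| <= C * `|y| ^+ 3 }.

Lemma lipschitz_continuous_fun C f : (forall x y, `|f x - f y| <= C * `|x - y|) ->
  continuous f.
Proof.
move=> fC x; apply/cvgrPdist_le => /= e e0.
have C0 : 0 <= C by have := fC 1 0; rewrite subr0 normr1 mulr1; apply: le_trans.
exists (e / (C + 1)) => /=; first by rewrite divr_gt0// ltr_wpDl.
move=> y /= xy; rewrite (le_trans (fC _ _))//.
rewrite (@le_trans _ _ ((C + 1) * (e / (C + 1))))//.
  by apply: ler_pM => //; [rewrite lerDl|exact: ltW].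
by rewrite mulrCA divff ?mulr1// gt_eqF// ltr_wpDl.
Qed.

Lemma is_derive_continuous f df : (forall x : R, is_derive x 1 f (df x)) -> continuous f.
Proof.
move=> fd x; have [dv _] := fd x.
by apply: differentiable_continuous; apply/derivable1_diffP.
Qed.

Lemma derive_bound f df a b c : (forall x : R, is_derive x 1 f (df x)) ->
  (forall t, `|t - a| <= `|b - a| -> `|df t| <= c) -> `|f b - f a| <= c * `|b - a|.
Proof.
move=> fd dfc; have cf := is_derive_continuous fd.
have [ab|ba] := leP a b.
  have [|t + ->] := MVT_segment ab (fun x _ => fd x).
    by apply: continuous_subspaceT => x; exact: cf.
  rewrite in_itv/= => /andP[a_t tb]; rewrite normrM ler_wpM2r//; apply: dfc.
  by rewrite !ger0_norm ?subr_ge0// lerB.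
have [|t + fE] := MVT_segment (ltW ba) (fun x _ => fd x).
  by apply: continuous_subspaceT => x; exact: cf.
rewrite in_itv/= => /andP[bt ta].
rewrite distrC fE normrM (distrC b) ler_wpM2r//; apply: dfc.
by rewrite distrC (distrC b) !ger0_norm ?subr_ge0// ?(ltW ba)// lerB.
Qed.

Lemma is_derive_shift f (x t c : R) : is_derive (x + t) 1 f c ->
  is_derive t 1 (fun s => f (x + s)) c.
Proof.
move=> fd; have sd : is_derive t 1 (fun s : R => x + s) 1.
  by apply: is_derive_eq; rewrite add0r mulr1.
by have := is_derive1_comp fd sd; rewrite mulr1.
Qed.

(** The mean value inequality twice: for [h1] minus its linearization at [x], then for the remainder
    of [h]. Only the oscillation of [h2] enters, so a Lipschitz [h2] yields a cubic remainder. *)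
Lemma taylor_local h h1 h2 (x y L : R) :
  (forall x : R, is_derive x 1 h (h1 x)) -> (forall x : R, is_derive x 1 h1 (h2 x)) ->
  (forall t, `|t| <= `|y| -> `|h2 (x + t) - h2 x| <= L) ->
  `|h (x + y) - h x - h1 x * y - h2 x * (y ^+ 2 / 2)| <= L * `|y| ^+ 2.
Proof.
move=> dh dh1 Lh.
have L0 : 0 <= L by apply: le_trans (Lh 0 _); rewrite ?normr0.
have step1 s : `|s| <= `|y| -> `|h1 (x + s) - h1 x - h2 x * s| <= L * `|y|.
  move=> sy.
  have gd (t : R) : is_derive t 1 (fun t => h1 (x + t) - h2 x * t) (h2 (x + t) - h2 x).
    have := is_derive_shift (dh1 (x + t)) => ?.
    by apply: is_derive_eq; rewrite /GRing.scale/= mulr1.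
  have := @derive_bound _ _ 0 s L gd.
  rewrite addr0 mulr0 !subr0 => gb.
  have -> : h1 (x + s) - h1 x - h2 x * s = h1 (x + s) - h2 x * s - h1 x by ring.
  rewrite (le_trans (gb _))//.
    by move=> t; rewrite subr0 => ts; apply: Lh; rewrite (le_trans ts).
  by rewrite ler_wpM2l.
have gd (t : R) : is_derive t 1 (fun t => h (x + t) - h1 x * t - h2 x * (t ^+ 2 / 2))
    (h1 (x + t) - h1 x - h2 x * t).
  have := is_derive_shift (dh (x + t)) => ?.
  apply: is_derive_eq; rewrite /GRing.scale/=.
  by field.
have := @derive_bound _ _ 0 y (L * `|y|) gd.
rewrite addr0 mulr0 expr0n/= mul0r mulr0 !subr0 => gb.
have -> : h (x + y) - h x - h1 x * y - h2 x * (y ^+ 2 / 2) =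
  h (x + y) - h1 x * y - h2 x * (y ^+ 2 / 2) - h x by ring.
by rewrite (le_trans (gb _)) -?mulrA -?expr2// => t; rewrite subr0; exact: step1.
Qed.

(** [g] averages [f] over [x, x + dlt]. As a difference quotient of an antiderivative it gains one
    derivative, and the mean value theorem makes it a value of [f] at a point within [dlt]. *)
Lemma mollify f B dlt : continuous f -> (forall x, `|f x| <= B) -> 0 < dlt ->
  exists g, [/\ forall x : R, is_derive x 1 g ((f (x + dlt) - f x) / dlt),
    forall x, exists2 c, `|x - c| <= dlt & g x = f c,
    forall x, `|g x| <= B & forall x y, `|g x - g y| <= 2 * B / dlt * `|x - y|].
Proof.
move=> cf fB d0; have [F dF] := antiderivative cf.
have gd (x : R) : is_derive x 1 (fun x => (F (x + dlt) - F x) / dlt) ((f (x + dlt) - f x) / dlt).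
  have : is_derive x 1 (fun y => F (dlt + y)) (f (dlt + x)) by exact: is_derive_shift.
  under eq_fun do rewrite addrC.
  move=> ?; have ? := dF x.
  apply: is_derive_eq.
  by rewrite scaler0 add0r /GRing.scale/= mulrC (addrC dlt).
have gc x : exists2 c, `|x - c| <= dlt & (F (x + dlt) - F x) / dlt = f c.
  have xd : x <= x + dlt by rewrite lerDl ltW.
  have [|c + ->] := MVT_segment xd (fun x _ => dF x).
    by apply: continuous_subspaceT => y; exact: (is_derive_continuous dF).
  rewrite in_itv/= => /andP[xc cx]; exists c.
    by rewrite distrC ger0_norm ?subr_ge0// lerBlDl.
  by rewrite addrAC subrr add0r mulfK// gt_eqF.
exists (fun x => (F (x + dlt) - F x) / dlt); split=> //.
  by move=> x; have [c _ ->] := gc x.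
have dV : 0 <= dlt^-1 by rewrite invr_ge0 ltW.
move=> x y; apply: (derive_bound gd) => t _.
rewrite normrM (ger0_norm dV) ler_pM2r ?invr_gt0//.
by rewrite (le_trans (ler_normB _ _))// mulr_natl mulr2n lerD.
Qed.

(** Three averages, each over a third of [dlt]: the second derivative of the last one is a second
    difference quotient of the first one, which is Lipschitz. *)
Lemma smooth_approximation f B dlt : continuous f -> (forall x, `|f x| <= B) -> 0 < dlt ->
  exists C p p1 p2, taylor3 C p p1 p2 /\
    forall x, exists2 c, `|x - c| <= dlt & p x = f c.
Proof.
move=> cf fB d0; pose e := dlt / 3; have e0 : 0 < e by rewrite divr_gt0.
have B0 : 0 <= B by rewrite (le_trans _ (fB 0)).
have [g1 [d1 c1 b1 l1]] := mollify cf fB e0.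
have [g2 [d2 c2 b2 l2]] := mollify (is_derive_continuous d1) b1 e0.
have [g3 [d3 c3 b3 l3]] := mollify (is_derive_continuous d2) b2 e0.
pose h1 x := (g2 (x + e) - g2 x) / e.
pose h2 x := ((g1 (x + e + e) - g1 (x + e)) / e - (g1 (x + e) - g1 x) / e) / e.
have dh1 (x : R) : is_derive x 1 h1 (h2 x).
  have : is_derive x 1 (fun y => g2 (e + y)) ((g1 (x + e + e) - g1 (x + e)) / e).
    by have := is_derive_shift (d2 (e + x)); rewrite (addrC e x).
  under eq_fun do rewrite addrC.
  move=> ?; have ? := d2 x.
  apply: is_derive_eq.
  by rewrite scaler0 add0r /GRing.scale/= mulrC.
(* The four summands bound [g3], [h1], [h2] and the Lipschitz constant of [h2]. *)
pose C := B + 2 * B / e + 4 * B / e ^+ 2 + 8 * B / e ^+ 3.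
have t1 : 0 <= 2 * B / e by apply: divr_ge0; [exact: mulr_ge0|exact: ltW].
have t2 : 0 <= 4 * B / e ^+ 2 by apply: divr_ge0; [exact: mulr_ge0|exact/exprn_ge0/ltW].
have t3 : 0 <= 8 * B / e ^+ 3 by apply: divr_ge0; [exact: mulr_ge0|exact/exprn_ge0/ltW].
have eV : 0 <= e^-1 by rewrite invr_ge0 ltW.
have eV2 : 0 <= (e ^+ 2)^-1 by rewrite invr_ge0; exact/exprn_ge0/ltW.
have h1b x : `|h1 x| <= 2 * B / e.
  rewrite normrM (ger0_norm eV) ler_pM2r ?invr_gt0//.
  by rewrite (le_trans (ler_normB _ _))// mulr_natl mulr2n lerD.
have h2b x : `|h2 x| <= 4 * B / e ^+ 2.
  have -> : h2 x = (g1 (x + e + e) - g1 (x + e) - (g1 (x + e) - g1 x)) / e ^+ 2.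
    by rewrite /h2 expr2; field; rewrite gt_eqF.
  rewrite normrM (ger0_norm eV2).
  rewrite ler_pM2r ?invr_gt0 ?exprn_gt0//.
  have := b1 (x + e + e); have := b1 (x + e); have := b1 x.
  rewrite !ler_norml => /andP[? ?] /andP[? ?] /andP[? ?]; apply/andP; split; lra.
have h2l x y : `|h2 x - h2 y| <= 8 * B / e ^+ 3 * `|x - y|.
  have -> : h2 x - h2 y = ((g1 (x + e + e) - g1 (y + e + e)) -
     2 * (g1 (x + e) - g1 (y + e)) + (g1 x - g1 y)) / e ^+ 2.
    by rewrite /h2 expr2; field; rewrite gt_eqF.
  rewrite normrM (ger0_norm eV2).
  rewrite ler_pdivrMr ?exprn_gt0//.
  have -> : 8 * B / e ^+ 3 * `|x - y| * e ^+ 2 = 4 * (2 * B / e * `|x - y|).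
    by field; rewrite gt_eqF.
  have := l1 (x + e + e) (y + e + e); have := l1 (x + e) (y + e); have := l1 x y.
  rewrite (_ : x + e + e - (y + e + e) = x - y); last by ring.
  rewrite (_ : x + e - (y + e) = x - y); last by ring.
  rewrite !ler_norml => /andP[? ?] /andP[? ?] /andP[? ?]; apply/andP; split; lra.
exists C, g3, h1, h2; split.
  split.
  - by move=> x; rewrite (le_trans (b3 x))// /C; lra.
  - by move=> x; rewrite (le_trans (h1b x))// /C; lra.
  - by move=> x; rewrite (le_trans (h2b x))// /C; lra.
  - by move=> x y; rewrite (le_trans (l3 x y))// ler_wpM2r// /C; lra.
  - move=> x y; rewrite (@le_trans _ _ (4 * B / e ^+ 2 * `|x - y|))//.
      by apply: (derive_bound dh1) => t _.
    by rewrite ler_wpM2r// /C; lra.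
  - by move=> x y; rewrite (le_trans (h2l x y))// ler_wpM2r// /C; lra.
  - move=> x y.
    have := @taylor_local g3 h1 h2 x y (8 * B / e ^+ 3 * `|y|) d3 dh1.
    move=> H; rewrite (le_trans (H _))//.
      move=> t ty; rewrite (le_trans (h2l _ _))// addrAC subrr add0r.
      by rewrite ler_wpM2l.
    have -> : 8 * B / e ^+ 3 * `|y| * `|y| ^+ 2 = 8 * B / e ^+ 3 * `|y| ^+ 3 by ring.
    by rewrite ler_wpM2r ?exprn_ge0// /C; lra.
move=> x; have [y xy ->] := c3 x; have [z yz ->] := c2 y; have [c zc ->] := c1 z.
exists c => //.
rewrite -(subrKA y) (le_trans (ler_normD _ _))//.
rewrite -[y - c](subrKA z) (_ : dlt = e + (e + e)); last by rewrite /e; field.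
by rewrite lerD// (le_trans (ler_normD _ _))// lerD.
Qed.

End smoothing.

(** * Truncated absolute value and tightness *)

Section cap.
Context (R : realType).

(** Bounded and Lipschitz, hence itself a test function for convergence in law: its mean controls
    tails, and a multiple of it dominates the differences of smooth test functions. *)
Definition cap (x : R) : R := Num.min 1 `|x|.

Lemma cap_ge0 x : 0 <= cap x.
Proof. by rewrite /cap le_min ler01 normr_ge0. Qed.

Lemma cap_le1 x : cap x <= 1.
Proof. by rewrite /cap ge_min lexx. Qed.

Lemma cap_le_norm x : cap x <= `|x|.
Proof. by rewrite /cap ge_min lexx orbT. Qed.

Lemma norm_cap_le1 x : `|cap x| <= 1.
Proof. by rewrite ger0_norm ?cap_ge0 ?cap_le1. Qed.

Lemma cap_ge1 x : 1 <= `|x| -> cap x = 1.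
Proof. by rewrite /cap; case: (leP 1 `|x|). Qed.

Lemma le_cap x y : `|x| <= `|y| -> cap x <= cap y.
Proof.
by move=> xy; rewrite /cap le_min ge_min lexx/= ge_min xy orbT.
Qed.

Lemma cap_lipschitz x y : `|cap x - cap y| <= `|x - y|.
Proof.
have := ler_dist_dist x y; rewrite /cap.
move: `|x - y| => z; rewrite !ler_norml => /andP[h1 h2].
by case: (leP 1 `|x|) => ?; case: (leP 1 `|y|) => ?; apply/andP; split; lra.
Qed.

Lemma cap_continuous : continuous cap.
Proof. by apply: (@lipschitz_continuous_fun _ 1) => x y; rewrite mul1r cap_lipschitz. Qed.

End cap.

Section tightness.
Context d (T : measurableType d) (R : realType) (P : probability T R).

Lemma integ_comp (f : R -> R) B (X : T -> R) : continuous f ->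
  (forall x, `|f x| <= B) -> measurable_fun [set: T] X -> integ P (fun w => f (X w)).
Proof.
move=> cf fB mX; apply: (@integ_bounded _ _ _ _ B) => //.
apply: (@measurableT_comp _ _ _ _ _ _ f) => //; exact: continuous_measurable_fun.
Qed.

Lemma integ_cap (X : T -> R) : measurable_fun [set: T] X -> integ P (fun w => cap (X w)).
Proof. by apply: integ_comp; [exact: cap_continuous|exact: norm_cap_le1]. Qed.

(** Tightness expressed through one continuous test function, so that a weak limit hands it over to
    the sequence. It holds by dominated convergence along rho = 1/(n+1). *)
Lemma tight (X : T -> R) (e : R) : measurable_fun [set: T] X -> 0 < e ->
  exists2 rho : R, 0 < rho & mean P (fun w => cap (rho * X w)) <= e.
Proof.
move=> mX e0.
pose F (n : nat) w : \bar R := (cap (n.+1%:R^-1 * X w))%:E.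
have icap (n : nat) : integ P (fun w => cap (n.+1%:R^-1 * X w)).
  by apply: integ_cap; exact: measurable_funM.
have mF n : measurable_fun [set: T] (F n) by exact: (measurable_int P (icap n)).
have F0 : \forall w \ae P, [set: T] w -> F n w @[n --> \oo] --> 0%E.
  apply: aeW => w _ /=; rewrite /F; apply: cvg_EFin => //=.
    by near=> n.
  apply: (@squeeze_cvgr _ _ _ _ (fun=> 0) (fun n : nat => n.+1%:R^-1 * `|X w|)).
  - near=> n; rewrite cap_ge0 (le_trans (cap_le_norm _))//.
    by rewrite normrM (ger0_norm (_ : 0 <= n.+1%:R^-1)) ?invr_ge0.
  - exact: cvg_cst.
  - by rewrite -[X in _ --> X](mul0r `|X w|); apply: cvgMl; exact: cvg_harmonic.
have F1 : \forall w \ae P, forall n, [set: T] w -> (`|F n w| <= 1%:E)%E.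
  by apply: aeW => w n _; rewrite /F /= lee_fin norm_cap_le1.
have [_ _] := @dominated_convergence _ _ _ P [set: T] measurableT F (cst 0%E) (cst 1%:E)
  mF (measurable_cst _) F0 (finite_measure_integrable_cst P 1 measurableT) F1.
rewrite integral0 => /fine_cvgP [_] /cvgrPdist_le /(_ e e0) [N _ /(_ N (leqnn _))] /=.
rewrite sub0r normrN => h; exists N.+1%:R^-1; first by rewrite invr_gt0.
by rewrite (le_trans _ h)// ler_norm.
Unshelve. all: by end_near. Qed.

End tightness.

Section convergence_in_law.
Context dT (T : measurableType dT) dU (U : measurableType dU) (R : realType).
Context (P : probability T R) (Q : probability U R).
Context (X : nat -> T -> R) (Y : U -> R).
Context (mX : forall n, measurable_fun [set: T] (X n)).
Context (mY : measurable_fun [set: U] Y).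

Lemma cvg_in_lawP : cvg_in_law P X Q Y <->
  forall (f : R -> R) B, continuous f -> (forall x, `|f x| <= B) ->
  mean P (fun w => f (X n w)) @[n --> \oo] --> mean Q (fun w => f (Y w)).
Proof.
split=> [XY f B cf fB|XY f cf [B [_ fB]]].
  have bf : bounded_fun f.
    by exists B; split; [exact: num_real|move=> x Bx y _ /=; rewrite (le_trans (fB y))// ltW].
  have := XY f cf bf.
  rewrite (_ : (fun n => 'E_P[f \o X n])%E = EFin \o (fun n => mean P (fun w => f (X n w)))).
    by rewrite expectation_mean; [move/fine_cvg|exact: (integ_comp Q cf fB mY)].
  by apply/funext => n; rewrite expectation_mean//; exact: (integ_comp P cf fB (mX n)).
have {}fB (x : R) : `|f x| <= B + 1 by apply: fB => //; rewrite ltrDl.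
rewrite (_ : (fun n => 'E_P[f \o X n])%E = EFin \o (fun n => mean P (fun w => f (X n w)))); last first.
  by apply/funext => n; rewrite expectation_mean//; exact: (integ_comp P cf fB (mX n)).
rewrite expectation_mean; last exact: (integ_comp Q cf fB mY).
by apply: cvg_EFin; [near=> n|exact: (XY f _ cf fB)].
Unshelve. all: by end_near. Qed.

(** A smooth [p] is close to [f] on |x| <= 1/rho only. Outside, the error is at most 2 B
    [cap (rho * x)], whose mean is small under [Q]; approximating this cap by a smooth [q] carries
    the smallness over to [P], so tightness of [X] is a consequence. *)
Lemma cvg_in_law_smooth :
  (forall C p p1 p2, taylor3 C p p1 p2 ->
    mean P (fun w => p (X n w)) @[n --> \oo] --> mean Q (fun w => p (Y w))) ->
  cvg_in_law P X Q Y.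
Proof.
move=> smooth; apply/cvg_in_lawP => f B cf fB; apply/cvgrPdist_le => /= e0 e00.
have B0 : 0 <= B by rewrite (le_trans _ (fB 0)).
(* Final count: the cap has mean at most e under [Q] and 4 e under [P], so replacing [f] by [p]
   costs e + 2 B e and e + 8 B e. With e for the means of [p] this adds up to 3 e + 10 B e. *)
pose e := e0 / (3 + 10 * B).
have B3 : 0 < 3 + 10 * B by lra.
have e_gt0 : 0 < e by rewrite divr_gt0.
have [rho rho0 Yrho] := tight Q mY e_gt0.
have [dl dl0 fdl] := compact_uniform_continuity rho^-1 cf e_gt0.
have [C [p [p1 [p2 [tp pf]]]]] := smooth_approximation cf fB dl0.
have ccap : continuous (fun x => cap (rho * x)).
  apply: (@lipschitz_continuous_fun _ rho) => x y.
  by rewrite (le_trans (cap_lipschitz _ _))// -mulrBr normrM gtr0_norm.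
have er0 : 0 < e / rho by rewrite divr_gt0.
have [C' [q [q1 [q2 [tq qf]]]]] :=
  smooth_approximation ccap (fun x => norm_cap_le1 (rho * x)) er0.
have fp x : `|f x - p x| <= e + 2 * B * cap (rho * x).
  have [c xc ->] := pf x.
  have [xK|xK] := leP `|x| rho^-1.
    by rewrite (le_trans (fdl _ _ xK xc))// lerDl mulr_ge0 ?mulr_ge0 ?cap_ge0.
  rewrite cap_ge1; last first.
    by rewrite normrM (gtr0_norm rho0) -ler_pdivrMl// mulr1 ltW.
  rewrite mulr1 (le_trans (ler_normB _ _))//.
  by have := fB x; have := fB c; lra.
have qc x : `|q x - cap (rho * x)| <= e.
  have [c xc ->] := qf x; rewrite (le_trans (cap_lipschitz _ _))//.
  by rewrite -mulrBr normrM gtr0_norm// distrC mulrC -ler_pdivlMr.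
have cp := lipschitz_continuous_fun (t3_lip tp).
have cq := lipschitz_continuous_fun (t3_lip tq).
have /cvgrPdist_le /(_ e e_gt0) Hp := smooth _ _ _ _ tp.
have /cvgrPdist_le /(_ e e_gt0) Hq := smooth _ _ _ _ tq.
near=> n.
have mfp d (S : measurableType d) (M : probability S R) (Z : S -> R) :
    measurable_fun [set: S] Z ->
    `|mean M (fun w => f (Z w)) - mean M (fun w => p (Z w))| <=
    e + 2 * B * mean M (fun w => cap (rho * Z w)).
  move=> mZ; have icap : integ M (fun w => cap (rho * Z w)).
    by apply: integ_cap; exact: measurable_funM.
  have if_ := integ_comp M cf fB mZ; have ip := integ_comp M cp (t3_bnd tp) mZ.
  rewrite -meanB// (le_trans (mean_norm_le (integB if_ ip)))//.
  have -> : e + 2 * B * mean M (fun w => cap (rho * Z w)) =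
      mean M (fun w => e + 2 * B * cap (rho * Z w)).
    by rewrite meanD; [rewrite mean_cst meanZ|exact: integ_cst|exact: integZ].
  apply: mean_le => //; first exact/integ_norm/integB.
  by apply: integD; [exact: integ_cst|exact: integZ].
have mqc d (S : measurableType d) (M : probability S R) (Z : S -> R) :
    measurable_fun [set: S] Z ->
    `|mean M (fun w => q (Z w)) - mean M (fun w => cap (rho * Z w))| <= e.
  move=> mZ; have icap : integ M (fun w => cap (rho * Z w)).
    by apply: integ_cap; exact: measurable_funM.
  have iq := integ_comp M cq (t3_bnd tq) mZ.
  by rewrite -meanB//; apply: mean_norm_le_cst => //; exact: integB.
have h1 := mfp _ _ P _ (mX n).
have h2 := mfp _ _ Q _ mY.
have h3 := mqc _ _ P _ (mX n).
have h4 := mqc _ _ Q _ mY.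
have h5 : `|mean Q (fun w => p (Y w)) - mean P (fun w => p (X n w))| <= e.
  by near: n.
have h6 : `|mean Q (fun w => q (Y w)) - mean P (fun w => q (X n w))| <= e.
  by near: n.
have eE : e0 = 3 * e + 10 * (B * e) by rewrite /e; field; rewrite gt_eqF.
move: h1 h2 h3 h4 h5 h6 Yrho.
set a1 := mean P (fun w => f _); set a2 := mean P (fun w => p _).
set a3 := mean P (fun w => cap _); set a4 := mean Q (fun w => f _).
set a5 := mean Q (fun w => p _); set a6 := mean Q (fun w => cap _).
set a7 := mean P (fun w => q _); set a8 := mean Q (fun w => q _).
move=> h1 h2 h3 h4 h5 h6 Yrho.
have a34 : a3 <= 4 * e.
  move: h3 h4 h6; rewrite !ler_norml => /andP[? ?] /andP[? ?] /andP[? ?]; lra.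
have : B * a3 <= B * (4 * e) by rewrite ler_wpM2l.
have : B * a6 <= B * e by rewrite ler_wpM2l.
move: h1 h2 h5; rewrite !ler_norml => /andP[? ?] /andP[? ?] /andP[? ?] ? ?.
rewrite eE; apply/andP; split; lra.
Unshelve. all: by end_near. Qed.

End convergence_in_law.

(** * Gaussian averages *)

Section gaussian.
Import HBNNSimple.
Context (R : realType).
Local Notation leb := (@lebesgue_measure R).
Implicit Types (m s a b x y : R).

Lemma integral_normal_prob_bounded m s (f : R -> R) c :
  measurable_fun [set: R] f -> (forall x, `|f x| <= c) ->
  (\int[normal_prob m s]_x (f x)%:E = \int[leb]_x ((f x)%:E * (normal_pdf m s x)%:E))%E.
Proof.
move=> mf fc.
have fint := integ_bounded (normal_prob m s) mf fc.
rewrite -(Radon_Nikodym_change_of_variables (normal_prob_dominates m s))//=.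
have mef : measurable_fun [set: R] (fun x => (f x)%:E) by exact/measurable_EFinP.
apply: ae_eq_integral => //.
- apply: emeasurable_funM => //; apply: (measurable_int leb).
  by apply: Radon_Nikodym_integrable; exact: normal_prob_dominates.
- apply: emeasurable_funM => //=; apply/measurableT_comp => //=.
  exact: measurable_normal_pdf.
- apply: ae_eqe_mul2l => /=.
  rewrite Radon_NikodymE//=; first exact: normal_prob_dominates.
  move=> abmu; case: cid => /= h [h1 h2 h3].
  apply: integral_ae_eq => //=.
  + by apply/measurable_EFinP; exact: measurable_normal_pdf.
  + by move=> E E01 mE; rewrite -h3//=.
Qed.

(** Bounded integrands are settled by the Radon-Nikodym derivative; simple functions are bounded and
    increase to [f]. *)
Lemma ge0_integral_normal_prob m s (f : R -> \bar R) :
  measurable_fun [set: R] f -> (forall x, 0 <= f x)%E ->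
  (\int[normal_prob m s]_x f x = \int[leb]_x (f x * (normal_pdf m s x)%:E))%E.
Proof.
move=> mf f0.
have mpdf : measurable_fun [set: R] (fun x => (normal_pdf m s x)%:E).
  by apply/measurable_EFinP; exact: measurable_normal_pdf.
have pdf0 x : (0 <= (normal_pdf m s x)%:E)%E by rewrite lee_fin normal_pdf_ge0.
pose f_ := nnsfun_approx measurableT mf.
have mf_ n : measurable_fun [set: R] (fun x => (f_ n x)%:E) by exact/measurable_EFinP.
have nd x : {homo (fun n => (f_ n x)%:E) : n k / (n <= k)%N >-> (n <= k)%E}.
  by move=> n k nk; rewrite lee_fin; exact/lefP/nd_nnsfun_approx.
have cf x : (f_ n x)%:E @[n --> \oo] --> f x by exact: cvg_nnsfun_approx.
transitivity (lim (\int[normal_prob m s]_x (f_ n x)%:E @[n --> \oo])%E).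
  rewrite -monotone_convergence//=.
  - by apply: eq_integral => x _; apply/esym/cvg_lim.
  - by move=> n x _; rewrite lee_fin.
transitivity (lim (\int[leb]_x ((f_ n x)%:E * (normal_pdf m s x)%:E) @[n --> \oo])%E).
  apply: congr_lim; apply/funext => n /=.
  have [c _ fc] : exists2 c : R, 0 <= c & forall x, `|f_ n x| <= c.
    have [c [_ hc]] := simple_bounded (f_ n).
    exists (`|c| + 1); first by rewrite addr_ge0.
    by move=> x; apply: hc => //; rewrite (le_lt_trans (ler_norm c))// ltrDl.
  exact: (integral_normal_prob_bounded m s _ fc).
rewrite -monotone_convergence//=.
- apply: eq_integral => x _; apply/cvg_lim => //.
  by apply: cvgeZr => //; exact: cf.
- by move=> n; apply: emeasurable_funM; [exact: mf_|exact: mpdf].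
- by move=> n x _; rewrite mule_ge0// lee_fin.
- by move=> x _ n k nk; rewrite lee_wpmul2r//; exact: nd.
Qed.

Let root2pi : R := Num.sqrt (pi * 2).

Let root2pi_gt0 : 0 < root2pi.
Proof. by rewrite sqrtr_gt0 mulr_gt0// pi_gt0. Qed.

Lemma normal_pdf_gt0E m s x : 0 < s ->
  normal_pdf m s x = (s * root2pi)^-1 * expR (- ((x - m) ^+ 2 / (2 * s ^+ 2))).
Proof.
move=> s0; rewrite normal_pdfE ?gt_eqF// /normal_fun /normal_peak; congr (_^-1 * expR _).
  rewrite -mulr_natr -mulrA sqrtrM ?sqr_ge0// sqrtr_sqr gtr0_norm//.
by rewrite mulNr -mulr_natl.
Qed.

Lemma normal_pdf_affine m s u : 0 < s -> normal_pdf m s (m + s * u) * s = normal_pdf 0 1 u.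
Proof.
move=> s0; rewrite !normal_pdf_gt0E// mul1r subr0 [m + _]addrC addrK exprMn expr1n.
have -> : s ^+ 2 * u ^+ 2 / (2 * s ^+ 2) = u ^+ 2 / (2 * 1).
  by field; rewrite gt_eqF.
by field; rewrite !gt_eqF.
Qed.

Lemma ge0_integral_normal_affine m s (f : R -> R) : 0 < s -> continuous f ->
  (forall x, 0 <= f x) ->
  (\int[normal_prob 0 1]_u (f (m + s * u))%:E =
   \int[leb]_x ((f x)%:E * (normal_pdf m s x)%:E))%E.
Proof.
move=> s0 cf f0.
pose F (u : R) : R := m + s * u.
have dF (u : R) : is_derive u 1 F s.
  by apply: is_derive_eq; rewrite /GRing.scale/=; ring.
have F'E : F^`()%classic = cst s.
  by apply/funext => u; rewrite derive1E; have [_ ->] := dF u.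
have mF : measurable_fun [set: R] F by apply: measurable_funD => //; exact: measurable_funM.
have mf : measurable_fun [set: R] f by exact: continuous_measurable_fun.
rewrite ge0_integral_normal_prob; last 2 first.
  by apply/measurable_EFinP; apply: (measurableT_comp mf).
  by move=> u; rewrite lee_fin.
under [RHS]eq_integral do rewrite -EFinM.
rewrite (@increasing_ge0_integration_by_substitutionT _ F (fun x => f x * normal_pdf m s x)).
- apply: eq_integral => u _; rewrite F'E !fctE /= -EFinM.
  by rewrite -mulrA normal_pdf_affine.
- by move=> x y xy; rewrite /F ltrD2l ltr_pM2l.
- by rewrite F'E => ?; exact: cvg_cst.
- by rewrite F'E; exact: is_cvg_cst.
- by rewrite F'E; exact: is_cvg_cst.
- by move=> u; have [] := dF u.
- apply: (@cvg_comp _ _ _ (fun u : R => s * u) (fun z => m + z) _ (-oo : set_system R)).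
    by apply: gt0_cvgMrNy => //; exact: cvg_id.
  exact: cvg_addrl_Ny.
- apply: (@cvg_comp _ _ _ (fun u : R => s * u) (fun z => m + z) _ (+oo : set_system R)).
    by apply: gt0_cvgMry => //; exact: cvg_id.
  exact: cvg_addrl.
- move=> x; apply: cvgM; first exact: cf.
  by apply: continuous_normal_pdf; rewrite gt_eqF.
- by move=> x; rewrite mulr_ge0// normal_pdf_ge0.
Qed.

(** Completing the square in [v]: the joint density of [v] and x = y + b v + a u is the density of
    [x] times the conditional density of [v] given [x], which is normal with mean b (x - y) / c^2
    and standard deviation a / c. *)
Lemma normal_pdf_convolution a b x y v : 0 < a -> 0 < b ->
  let c := Num.sqrt (a ^+ 2 + b ^+ 2) in
  normal_pdf (y + b * v) a x * normal_pdf 0 1 v =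
  normal_pdf y c x * normal_pdf (b * (x - y) / c ^+ 2) (a / c) v.
Proof.
move=> a0 b0 c.
have cE : c ^+ 2 = a ^+ 2 + b ^+ 2 by rewrite sqr_sqrtr// addr_ge0 ?sqr_ge0.
have c0 : 0 < c by rewrite sqrtr_gt0 addr_gt0 ?exprn_gt0.
rewrite !normal_pdf_gt0E ?divr_gt0//.
rewrite mulrACA -expRD [RHS]mulrACA -expRD; congr (_ * expR _).
  by field; rewrite ?gt_eqF.
rewrite subr0 expr1n -!opprD; congr (- _).
have -> : (a / c) ^+ 2 = a ^+ 2 / c ^+ 2 by rewrite exprMn exprVn.
rewrite cE; field; rewrite -cE !expf_eq0/= !gt_eqF//.
Qed.

(** After Tonelli, for which [f] is nonnegative, the conditional density of [v] integrates to 1 and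
    the density of the sum remains. *)
Lemma ge0_normal_convolution a b y (f : R -> R) : 0 < a -> 0 < b -> continuous f ->
  (forall x, 0 <= f x) ->
  (\int[normal_prob 0 1]_v \int[normal_prob 0 1]_u (f (y + b * v + a * u))%:E =
   \int[normal_prob 0 1]_w (f (y + Num.sqrt (a ^+ 2 + b ^+ 2) * w))%:E)%E.
Proof.
move=> a0 b0 cf f0; set c := Num.sqrt _.
have c0 : 0 < c by rewrite sqrtr_gt0 addr_gt0 ?exprn_gt0.
have mf : measurable_fun [set: R] f by exact: continuous_measurable_fun.
under eq_integral do rewrite ge0_integral_normal_affine//.
rewrite [RHS]ge0_integral_normal_affine//.
pose G (z : R * R) := f z.2 * (normal_pdf (y + b * z.1) a z.2).
have mG : measurable_fun [set: R * R] (fun z => (G z)%:E).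
  apply/measurable_EFinP; apply: measurable_funM.
    exact: (measurableT_comp mf measurable_snd).
  under eq_fun do rewrite normal_pdf_gt0E//.
  apply: measurable_funM => //; apply: measurableT_comp => //.
  apply: measurable_funN; apply: measurable_funM => //; apply: measurable_funX.
  apply: measurable_funB; first exact: measurable_snd.
  by apply: measurable_funD => //; apply: measurable_funM => //; exact: measurable_fst.
have G0 z : (0 <= (G z)%:E)%E by rewrite lee_fin mulr_ge0// normal_pdf_ge0.
have mpdf01 : measurable_fun [set: R] (fun v => (normal_pdf 0 1 v)%:E).
  by apply/measurable_EFinP; exact: measurable_normal_pdf.
transitivity (\int[normal_prob 0 1]_v fubini_F leb (fun z => (G z)%:E) v)%E.
  by apply: eq_integral => v _; apply: eq_integral => x _; rewrite -EFinM.
rewrite ge0_integral_normal_prob; last 2 first.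
  exact: measurable_fun_fubini_tonelli_F.
  by move=> v; apply: integral_ge0.
have mH : measurable_fun [set: R * R] (fun z => ((G z)%:E * (normal_pdf 0 1 z.1)%:E)%E).
  by apply: emeasurable_funM => //; exact: (measurableT_comp mpdf01 measurable_fst).
transitivity (\int[leb]_v \int[leb]_x ((G (v, x))%:E * (normal_pdf 0 1 v)%:E))%E.
  apply: eq_integral => v _; rewrite ge0_integralZr//.
  - by apply: measurableT_comp mG (measurable_pair1 v).
  - by rewrite lee_fin normal_pdf_ge0.
have H0 (z : R * R) : (0 <= (G z)%:E * (normal_pdf 0 1 z.1)%:E)%E.
  by rewrite mule_ge0// lee_fin normal_pdf_ge0.
transitivity (\int[leb]_x \int[leb]_v ((G (v, x))%:E * (normal_pdf 0 1 v)%:E))%E.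
  exact: (@fubini_tonelli _ _ _ _ R lebesgue_measure lebesgue_measure _ mH H0).
apply: eq_integral => x _.
transitivity (\int[leb]_v ((f x * normal_pdf y c x)%:E *
    (normal_pdf (b * (x - y) / c ^+ 2) (a / c) v)%:E))%E.
  apply: eq_integral => v _; rewrite /G /= -!EFinM; congr EFin.
  by rewrite -[LHS]mulrA normal_pdf_convolution// mulrA.
rewrite ge0_integralZl//.
- by rewrite integral_normal_pdf mule1 EFinM.
- by apply/measurable_EFinP; exact: measurable_normal_pdf.
- by move=> v _; rewrite lee_fin normal_pdf_ge0.
- by rewrite lee_fin mulr_ge0// normal_pdf_ge0.
Qed.

End gaussian.

Section gaussian_moments.
Context (R : realType).
Local Notation leb := (@lebesgue_measure R).
Local Notation gam := (@normal_prob R 0 1).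

Lemma normal_mgf (t : R) : integ gam (fun u => expR (t * u)) /\
  mean gam (fun u => expR (t * u)) = expR (t ^+ 2 / 2).
Proof.
have me : measurable_fun [set: R] (fun u : R => expR (t * u)).
  by apply: measurableT_comp; [exact: measurable_expR|exact: measurable_funM].
have mE : measurable_fun [set: R] (fun u : R => (expR (t * u))%:E).
  exact/measurable_EFinP.
have mgfE : (\int[gam]_u (expR (t * u))%:E = (expR (t ^+ 2 / 2))%:E)%E.
  rewrite ge0_integral_normal_prob//.
  (* Exponential tilting: the factor e^(t u) turns the standard density into e^(t^2/2) times the
     normal density centred at t. *)
  transitivity (\int[leb]_u ((expR (t ^+ 2 / 2))%:E * (normal_pdf t 1 u)%:E))%E.
    apply: eq_integral => u _; rewrite -!EFinM; congr EFin.
    rewrite !normal_pdf_gt0E// mulrCA [RHS]mulrCA -!expRD; congr (_ * expR _).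
    by field.
  rewrite ge0_integralZl//.
  - by rewrite integral_normal_pdf mule1.
  - by apply/measurable_EFinP; exact: measurable_normal_pdf.
  - by move=> v _; rewrite lee_fin normal_pdf_ge0.
split; last by rewrite /mean /Rintegral mgfE.
apply/integrableP; split => //=.
under eq_integral do rewrite ger0_norm ?expR_ge0//.
by rewrite mgfE ltry.
Qed.

Lemma integ_normal_expR_norm (t : R) : 0 <= t ->
  exists2 E : R -> R, integ gam E & forall u, expR (t * `|u|) <= E u.
Proof.
move=> t0; exists (fun u => expR (t * u) + expR (- t * u)).
  by apply: integD; [have [] := normal_mgf t|have [] := normal_mgf (- t)].
move=> u; have [u0|u0] := leP 0 u.
  by rewrite ger0_norm// lerDl expR_ge0.
by rewrite ltr0_norm// mulrN mulNr lerDr expR_ge0.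
Qed.

Lemma norm_le_expR (u : R) : `|u| <= expR `|u|.
Proof. by rewrite (le_trans _ (expR_ge1Dx _))// lerDr. Qed.

Lemma exprn_norm_le_expR n (u : R) : `|u| ^+ n <= expR (n%:R * `|u|).
Proof.
by rewrite expRM_natl lerXn2r ?nnegrE ?expR_ge0// norm_le_expR.
Qed.

Lemma integ_normal_exprn n : integ gam (fun u => u ^+ n).
Proof.
have [E iE leE] := integ_normal_expR_norm (ler0n R n).
apply: (integ_le _ _ iE); first exact: measurable_funX.
by move=> u; rewrite normrX (le_trans (exprn_norm_le_expR _ _)).
Qed.

Lemma expR_taylor (x : R) :
  `|expR x - 1 - x - x ^+ 2 / 2| <= `|x| ^+ 3 * expR `|x|.
Proof.
have dexp (y : R) : is_derive y 1 expR (expR y) by exact: is_derive_expR.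
have := @taylor_local _ expR expR expR 0 x (`|x| * expR `|x|) dexp dexp.
rewrite add0r expR0 !mul1r => H; apply: (le_trans (H _)).
- move=> t tx; rewrite add0r -expR0.
  rewrite (@le_trans _ _ (expR `|x| * `|t - 0|))//.
    apply: (derive_bound dexp) => s; rewrite !subr0 => st.
    rewrite ger0_norm ?expR_ge0// ler_expR (le_trans (ler_norm _))//.
    exact: le_trans st tx.
  by rewrite subr0 mulrC ler_wpM2r ?expR_ge0.
- by rewrite mulrAC -exprS.
Qed.

Lemma expR_sqr_taylor (t : R) : `|t| <= 1 ->
  `|expR (t ^+ 2 / 2) - 1 - t ^+ 2 / 2| <= `|t| ^+ 3.
Proof.
move=> t1; have t2 : 0 <= t ^+ 2 / 2 by rewrite divr_ge0 ?sqr_ge0.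
have tt : t ^+ 2 = `|t| ^+ 2 by rewrite real_normK ?num_real.
have x1 : t ^+ 2 / 2 <= 2^-1.
  by rewrite ler_pdivrMr// mulVf// tt expr_le1.
have := expR_taylor (t ^+ 2 / 2); rewrite (ger0_norm t2).
(* From e^x e^(-x) = 1 and e^(-x) >= 1 - x >= 1/2 at x = t^2/2. *)
have ex2 : expR (t ^+ 2 / 2) <= 2.
  have /(ler_wpM2l (expR_ge0 (t ^+ 2 / 2))) := expR_ge1Dx (- (t ^+ 2 / 2)).
  rewrite -expRD subrr expR0 => h.
  have : expR (t ^+ 2 / 2) * 2^-1 <= expR (t ^+ 2 / 2) * (1 - t ^+ 2 / 2).
    by rewrite ler_wpM2l ?expR_ge0//; lra.
  by move: h; lra.
rewrite tt in t2 x1 ex2 *; set x := `|t| ^+ 2 / 2 in t2 x1 ex2 *.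
have x3 : x ^+ 2 / 2 + x ^+ 3 * 2 <= `|t| ^+ 3.
  have t0 := normr_ge0 t.
  have -> : x ^+ 2 / 2 + x ^+ 3 * 2 = `|t| ^+ 3 * (`|t| / 8 + `|t| ^+ 3 / 4).
    by rewrite /x; field.
  have t3 : `|t| ^+ 3 <= 1 by rewrite expr_le1.
  by rewrite ler_piMr ?exprn_ge0//; lra.
have x3e : x ^+ 3 * expR x <= x ^+ 3 * 2 by rewrite ler_wpM2l ?exprn_ge0.
have x20 : 0 <= x ^+ 2 by rewrite sqr_ge0.
by rewrite !ler_norml => /andP[h1' h2']; apply/andP; split; lra.
Qed.

(** The moments are read off the Laplace transform: e^(t^2/2) = E e^(t u) gives t m1 + t^2/2 (m2 -
    1) = O(t^3), and comparing t with -t separates the two orders. *)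
Lemma normal_mean_var : mean gam (fun u => u) = 0 /\ mean gam (fun u => u ^+ 2) = 1.
Proof.
have i1 : integ gam (fun u : R => u) by exact: (integ_normal_exprn 1).
have i2 : integ gam (fun u : R => u ^+ 2) by exact: integ_normal_exprn.
set m1 := mean gam (fun u => u); set m2 := mean gam (fun u => u ^+ 2).
(* The 4 is 3 + 1: the Taylor remainder of e^(t u) is at most |t u|^3 e^|t u|, and |t| <= 1. *)
have [E iE leE] := integ_normal_expR_norm (ler0n R 4).
pose C := mean gam E + 1.
have E0 : 0 <= mean gam E.
  by apply: mean_ge0 => u; rewrite (le_trans _ (leE u))// expR_ge0.
have key (t : R) : `|t| <= 1 -> `|t * m1 + t ^+ 2 / 2 * (m2 - 1)| <= C * `|t| ^+ 3.
  move=> t1; have [ie me] := normal_mgf t.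
  have h1 : `|expR (t ^+ 2 / 2) - 1 - t * m1 - t ^+ 2 / 2 * m2| <= mean gam E * `|t| ^+ 3.
    have -> : expR (t ^+ 2 / 2) - 1 - t * m1 - t ^+ 2 / 2 * m2 =
        mean gam (fun u => expR (t * u) - 1 - t * u - t ^+ 2 / 2 * u ^+ 2).
      rewrite meanB; [|by apply: integB; [apply: integB => //; exact: integ_cst|exact: integZ]|exact: integZ].
      rewrite meanB; [|by apply: integB => //; exact: integ_cst|exact: integZ].
      by rewrite meanB//; [rewrite !meanZ// mean_cst me|exact: integ_cst].
    rewrite [leRHS]mulrC -[leRHS]meanZ//.
    have iL : integ gam (fun u => expR (t * u) - 1 - t * u - t ^+ 2 / 2 * u ^+ 2).
      apply: integB; [|exact: integZ]; apply: integB; [|exact: integZ].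
      by apply: integB => //; exact: integ_cst.
    rewrite (le_trans (mean_norm_le iL))//; apply: mean_le; [exact: integ_norm|exact: integZ|].
    move=> u; have := expR_taylor (t * u).
    rewrite (_ : (t * u) ^+ 2 / 2 = t ^+ 2 / 2 * u ^+ 2); last by field.
    move=> H; rewrite (le_trans H)// normrM exprMn -mulrA ler_wpM2l ?exprn_ge0//.
    rewrite (le_trans _ (leE u))// (_ : 4%:R * `|u| = 3%:R * `|u| + `|u|); last by ring.
    rewrite expRD ler_pM ?exprn_ge0 ?expR_ge0 ?exprn_norm_le_expR//.
    by rewrite ler_expR ler_piMl.
  have t2 : 0 <= t ^+ 2 / 2 by rewrite divr_ge0 ?sqr_ge0.
  have h2 : `|expR (t ^+ 2 / 2) - 1 - t ^+ 2 / 2| <= `|t| ^+ 3.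
    exact: expR_sqr_taylor.
  have -> : t * m1 + t ^+ 2 / 2 * (m2 - 1) =
    (expR (t ^+ 2 / 2) - 1 - t ^+ 2 / 2) - (expR (t ^+ 2 / 2) - 1 - t * m1 - t ^+ 2 / 2 * m2).
    by ring.
  rewrite (le_trans (ler_normB _ _))// /C mulrDl mul1r addrC lerD//.
have C0 : 0 < C by rewrite /C ltr_wpDl.
have small (a K : R) : (forall t, 0 < t <= 1 -> `|a| <= K * t) -> a = 0.
  move=> aK; apply/eqP; rewrite -normr_le0; apply/ler_addgt0Pr => e e0.
  rewrite add0r.
  have K0 : 0 <= K by have := aK 1; rewrite ltr01 lexx mulr1 => /(_ isT); apply: le_trans.
  have K1 : 0 < K + 1 by rewrite ltr_wpDl.
  pose t := Num.min 1 (e / (K + 1)).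
  have t01 : 0 < t <= 1 by rewrite /t lt_min ltr01 divr_gt0//= ge_min lexx.
  have tK : K * t <= e.
    rewrite (@le_trans _ _ (K * (e / (K + 1))))//.
      by rewrite ler_wpM2l// /t ge_min lexx orbT.
    by rewrite mulrA ler_pdivrMr// mulrC ler_wpM2l ?(ltW e0)// lerDl.
  by rewrite (le_trans (aK _ t01)).
have m10 : m1 = 0.
  apply: (small _ C) => t /andP[t0 t1].
  have h1 := key t; have h2 := key (- t).
  rewrite normrN sqrrN mulNr (gtr0_norm t0) in h1 h2.
  have {}h1 := h1 t1; have {}h2 := h2 t1.
  have ht : `|t * m1| <= C * t ^+ 3.
    move: h1 h2; set z := t ^+ 2 / 2 * _; rewrite !ler_norml => /andP[? ?] /andP[? ?].
    by apply/andP; split; lra.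
  rewrite normrM (gtr0_norm t0) mulrC -ler_pdivlMr// in ht.
  rewrite (le_trans ht)// exprS mulrCA mulrAC mulfV ?gt_eqF// mul1r ler_wpM2l ?(ltW C0)//.
  by rewrite expr2 ler_piMl// ltW.
split => //; apply/eqP; rewrite -subr_eq0; apply/eqP.
apply: (small _ (2 * C)) => t /andP[t0 t1].
have := key t; rewrite m10 mulr0 add0r (gtr0_norm t0) => /(_ t1).
rewrite normrM (gtr0_norm (_ : 0 < t ^+ 2 / 2)) ?divr_gt0 ?exprn_gt0//.
rewrite mulrC -ler_pdivlMr ?divr_gt0 ?exprn_gt0// => h; rewrite (le_trans h)//.
by rewrite le_eqVlt; apply/orP; left; apply/eqP; field; rewrite gt_eqF.
Qed.

End gaussian_moments.

Section gaussian_average.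
Context (R : realType).
Local Notation gam := (@normal_prob R 0 1).
Implicit Types (p : R -> R) (s a b y C : R).

(** The heat flow of [p] at variance s^2. *)
Definition gauss_avg s p y := mean gam (fun u => p (y + s * u)).

Lemma measurable_affine y s : measurable_fun [set: R] (fun u : R => y + s * u).
Proof. by apply: measurable_funD => //; exact: measurable_funM. Qed.

Lemma integ_affine B s p y : continuous p -> (forall x, `|p x| <= B) ->
  integ gam (fun u => p (y + s * u)).
Proof. by move=> cp pB; apply: (integ_comp gam cp pB); exact: measurable_affine. Qed.

Lemma gauss_avg_bound B s p : continuous p -> (forall x, `|p x| <= B) ->
  forall y, `|gauss_avg s p y| <= B.
Proof. by move=> cp pB y; apply: mean_norm_le_cst => //; exact: (integ_affine _ _ cp pB). Qed.

Lemma gauss_avg_lip B C s p : continuous p -> (forall x, `|p x| <= B) ->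
  (forall x y, `|p x - p y| <= C * `|x - y|) ->
  forall x y, `|gauss_avg s p x - gauss_avg s p y| <= C * `|x - y|.
Proof.
move=> cp pB pC x y; rewrite -meanB; try exact: (integ_affine _ _ cp pB).
apply: mean_norm_le_cst.
  by apply: integB; exact: (integ_affine _ _ cp pB).
by move=> u; rewrite (le_trans (pC _ _))// opprD addrACA subrr addr0.
Qed.

Lemma taylor3_gauss_avg C s p p1 p2 : taylor3 C p p1 p2 ->
  taylor3 C (gauss_avg s p) (gauss_avg s p1) (gauss_avg s p2).
Proof.
case=> b0 b1 b2 l0 l1 l2 tp.
have c0 := lipschitz_continuous_fun l0.
have c1 := lipschitz_continuous_fun l1.
have c2 := lipschitz_continuous_fun l2.
split; try exact: gauss_avg_bound; try exact: gauss_avg_lip.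
move=> x y.
have i0 z := integ_affine s z c0 b0; have i1 z := integ_affine s z c1 b1.
have i2 z := integ_affine s z c2 b2.
have i0' : integ gam (fun u => p (x + s * u + y)).
  by have := i0 (x + y); under eq_fun do rewrite addrAC.
have j1 : integ gam (fun u => p (x + s * u + y) - p (x + s * u)) by exact: integB.
have j2 : integ gam (fun u => p (x + s * u + y) - p (x + s * u) - y * p1 (x + s * u)).
  by apply: integB => //; exact: integZ.
have j3 : integ gam (fun u => y ^+ 2 / 2 * p2 (x + s * u)) by exact: integZ.
have -> : gauss_avg s p (x + y) - gauss_avg s p x - gauss_avg s p1 x * y -
    gauss_avg s p2 x * (y ^+ 2 / 2) =
    mean gam (fun u => p (x + s * u + y) - p (x + s * u) - y * p1 (x + s * u) -
      (y ^+ 2 / 2) * p2 (x + s * u)).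
  rewrite (meanB j2 j3) (meanB j1 (integZ y (i1 x))) (meanB i0' (i0 x)) !meanZ//.
  rewrite [gauss_avg s p1 x * y]mulrC [gauss_avg s p2 x * _]mulrC; congr (_ - _ - _ - _).
  by apply: eq_mean => u; rewrite addrAC.
apply: mean_norm_le_cst; first exact: integB.
by move=> u; have := tp (x + s * u) y; rewrite [p1 _ * y]mulrC [p2 _ * _]mulrC.
Qed.

Lemma gauss_avg_convolution B C a b p y : (forall x, `|p x| <= B) ->
  (forall x z, `|p x - p z| <= C * `|x - z|) -> 0 <= a -> 0 < b ->
  mean gam (fun v => gauss_avg a p (y + b * v)) = gauss_avg (Num.sqrt (a ^+ 2 + b ^+ 2)) p y.
Proof.
move=> pB pC; have cp := lipschitz_continuous_fun pC.
(* The case a = 0, which occurs at the last step of the interpolation, has no density and is treated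
   apart. *)
rewrite le_eqVlt => /predU1P[<- b0|a0 b0].
  rewrite expr0n add0r sqrtr_sqr gtr0_norm//; apply: eq_mean => v.
  rewrite /gauss_avg (@eq_mean _ _ _ _ _ (fun=> p (y + b * v))) ?mean_cst// => u.
  by rewrite mul0r addr0.
(* Adding the bound makes the function nonnegative, as the convolution identity requires; constants
   pass through the averages. *)
pose f x := p x + B.
have fC x z : `|f x - f z| <= C * `|x - z|.
  by rewrite /f opprD addrACA subrr addr0.
have cf := lipschitz_continuous_fun fC.
have f0 x : 0 <= f x by have := pB x; rewrite ler_norml /f => /andP[? _]; lra.
have fB x : `|f x| <= B + B.
  by rewrite ger0_norm// /f lerD2r (le_trans (ler_norm _)).
have fE s z : gauss_avg s f z = gauss_avg s p z + B.
  rewrite /gauss_avg meanD ?mean_cst//; last exact: integ_cst.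
  exact: (integ_affine _ _ cp pB).
have cg := lipschitz_continuous_fun (gauss_avg_lip a cf fB fC).
have gB := gauss_avg_bound a cf fB.
have fEp z : gauss_avg a p z = gauss_avg a f z - B by rewrite fE addrK.
under eq_mean do rewrite fEp.
rewrite meanB; [|exact: (integ_affine _ _ cg gB)|exact: integ_cst].
rewrite mean_cst; apply/eqP; rewrite subr_eq -fE; apply/eqP; apply: EFin_inj.
have meanE (g : R -> R) : integ gam g -> (mean gam g)%:E = (\int[gam]_u (g u)%:E)%E.
  by move=> ig; rewrite /mean /Rintegral fineK//; exact: integrable_fin_num.
rewrite meanE; last exact: (integ_affine _ _ cg gB).
rewrite /gauss_avg meanE; last exact: (integ_affine _ _ cf fB).
rewrite -(ge0_normal_convolution y a0 b0 cf f0); apply: eq_integral => v _.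
by rewrite meanE//; exact: (integ_affine _ _ cf fB).
Qed.

Definition normal_m4 : R := mean gam (fun u => u ^+ 4).

(** Young's inequality trades the cubic Taylor remainder for second and fourth moments, for which
    there are explicit bounds; [k] is the weight that ends up in [lindeberg_error]. *)
Lemma norm_cube_le (k t : R) : 0 < k -> `|t| ^+ 3 <= k * t ^+ 2 + t ^+ 4 / k.
Proof.
move=> k0; have -> : t ^+ 2 = `|t| ^+ 2 by rewrite real_normK ?num_real.
have -> : t ^+ 4 = `|t| ^+ 4.
  by rewrite -normrX ger0_norm// (_ : t ^+ 4 = (t ^+ 2) ^+ 2) ?sqr_ge0 -?exprM.
set x := `|t|; have x0 : 0 <= x by rewrite normr_ge0.
rewrite -subr_ge0.
have -> : k * x ^+ 2 + x ^+ 4 / k - x ^+ 3 =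
    x ^+ 2 * ((k - x / 2) ^+ 2 + 3 / 4 * x ^+ 2) / k by field; rewrite gt_eqF.
apply: divr_ge0 (ltW k0); apply: mulr_ge0; first exact: sqr_ge0.
by rewrite addr_ge0 ?sqr_ge0// mulr_ge0 ?sqr_ge0.
Qed.

(* By the convolution identity the first average adds an independent Gaussian
   increment of variance b^2 to the second. *)
Lemma gauss_avg_step C a b k p p1 p2 y : taylor3 C p p1 p2 -> 0 < k -> 0 <= a -> 0 < b ->
  `|gauss_avg (Num.sqrt (a ^+ 2 + b ^+ 2)) p y - gauss_avg a p y -
     b ^+ 2 / 2 * gauss_avg a p2 y| <= C * (k * b ^+ 2 + b ^+ 4 * normal_m4 / k).
Proof.
move=> tp k0 a0 b0; have tq := taylor3_gauss_avg a tp.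
have C0 : 0 <= C by rewrite (le_trans _ (t3_bnd tp 0)).
rewrite -(gauss_avg_convolution _ (t3_bnd tp) (t3_lip tp) a0 b0).
set q := gauss_avg a p in tq *; set q2 := gauss_avg a p2 in tq *.
set q1 := gauss_avg a p1 in tq *.
have cq := lipschitz_continuous_fun (t3_lip tq).
have iq : integ gam (fun u => q (y + b * u)) := integ_affine b y cq (t3_bnd tq).
have i1 : integ gam (fun u : R => u) by exact: (integ_normal_exprn R 1).
have i2 : integ gam (fun u : R => u ^+ 2) by exact: integ_normal_exprn.
have i4 : integ gam (fun u : R => u ^+ 4) by exact: integ_normal_exprn.
have j1 : integ gam (fun u => q (y + b * u) - q y) by apply: integB => //; exact: integ_cst.
have j2 : integ gam (fun u => q (y + b * u) - q y - (q1 y * b) * u).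
  by apply: integB => //; exact: integZ.
have j3 : integ gam (fun u => (q2 y * (b ^+ 2 / 2)) * u ^+ 2) by exact: integZ.
have [m1 m2] := normal_mean_var R.
have -> : mean gam (fun v => q (y + b * v)) - q y - b ^+ 2 / 2 * q2 y =
   mean gam (fun u => q (y + b * u) - q y - (q1 y * b) * u - (q2 y * (b ^+ 2 / 2)) * u ^+ 2).
  rewrite (meanB j2 j3) (meanB j1 (integZ (q1 y * b) i1)) (meanB iq (integ_cst _ _)) mean_cst.
  by rewrite !meanZ// m1 m2 mulr0 subr0 mulr1 [q2 y * _]mulrC.
have -> : C * (k * b ^+ 2 + b ^+ 4 * normal_m4 / k) =
    mean gam (fun u => C * (k * b ^+ 2 * u ^+ 2 + b ^+ 4 / k * u ^+ 4)).
  rewrite meanZ; last by apply: integD; exact: integZ.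
  by rewrite meanD ?meanZ// ?m2 ?mulr1 1?mulrAC//; exact: integZ.
have j : integ gam (fun u => q (y + b * u) - q y - (q1 y * b) * u - (q2 y * (b ^+ 2 / 2)) * u ^+ 2).
  exact: integB.
rewrite (le_trans (mean_norm_le j))//; apply: mean_le; first exact: integ_norm.
  by apply: integZ; apply: integD; exact: integZ.
move=> u; have := t3_taylor tq y (b * u).
have -> : q2 y * ((b * u) ^+ 2 / 2) = q2 y * (b ^+ 2 / 2) * u ^+ 2 by field.
rewrite mulrA => /le_trans; apply; rewrite ler_wpM2l//.
rewrite (le_trans (norm_cube_le _ k0))// !exprMn mulrA lerD2l.
by rewrite mulrAC.
Qed.

End gaussian_average.

(** * Moments of the walk *)

Section same_law_mean.
Context dT (T : measurableType dT) dU (U : measurableType dU) (R : realType).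
Context (P : probability T R) (Q : probability U R).

Lemma same_law_integ_mean (X : {RV P >-> R}) (Y : {RV Q >-> R}) (f : R -> R) :
  same_law X Y -> measurable_fun [set: R] f ->
  integ Q (fun w => f (Y w)) ->
  integ P (fun w => f (X w)) /\ mean P (fun w => f (X w)) = mean Q (fun w => f (Y w)).
Proof.
move=> XY mf iY.
have mEf : measurable_fun [set: R] (EFin \o f) by exact/measurable_EFinP.
have lawE (g : R -> \bar R) :
    (\int[distribution P X]_x g x = \int[distribution Q Y]_x g x)%E.
  by apply: eq_measure_integral => A mA _; exact: XY.
have iX : integ P (fun w => f (X w)).
  apply/integrableP; split; first by apply/measurable_EFinP; apply: (measurableT_comp mf).
  have mg : measurable_fun [set: R] (fun x => `|(f x)%:E|%E) by exact: measurableT_comp.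
  rewrite -(ge0_integral_distribution X mg)// lawE ge0_integral_distribution//.
  by case/integrableP: iY.
split => //; apply: EFin_inj; rewrite -!expectation_mean// unlock.
by rewrite -(integral_distribution (X := X) mEf iX) lawE (integral_distribution (X := Y) mEf iY).
Qed.

End same_law_mean.

(** Rectangles in place of sigma(X_i, Y_i): they are closed under intersection and split at once
    into an X part and a Y part. *)
Definition sigma_pair dT (T : measurableType dT) dU (U : measurableType dU)
    dW (W : measurableType dW) (X : nat -> T -> U) (Y : nat -> T -> W) i : set_system T :=
  [set A | exists B : set T * set T,
    [/\ sigma_rv (X i) B.1, sigma_rv (Y i) B.2 & A = B.1 `&` B.2]].

Section joint_independence.
Context dT (T : measurableType dT) (R : realType) (P : probability T R).
Context dU (U : measurableType dU) (X : nat -> {RV P >-> R}) (Y : nat -> {RV P >-> U}).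
Context (X_indep : mutually_independent P (fun i => sigma_rv (X i))).
Context (Y_indep : mutually_independent P (fun i => sigma_rv (Y i))).
Context (XY_indep : independent P (sigma_seq X) (sigma_seq Y)).

Lemma sigma_rv_measurable dS (S : measurableType dS) (Z : {RV P >-> S}) :
  sigma_rv Z `<=` measurable.
Proof. by move=> _ [A mA <-]; apply: measurable_funPT => //. Qed.

Lemma sigma_rv_setI dS (S : measurableType dS) (Z : {RV P >-> S}) : setI_closed (sigma_rv Z).
Proof.
move=> _ _ [A mA <-] [B mB <-]; exists (A `&` B); first exact: measurableI.
by rewrite preimage_setI !setTI.
Qed.

Lemma sigma_rv_setT dS (S : measurableType dS) (Z : {RV P >-> S}) : sigma_rv Z [set: T].
Proof. by exists [set: S] => //; rewrite preimage_setT setTI. Qed.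

Lemma sigma_rv_comp dS (S : measurableType dS) (Z : T -> S) (f : S -> R) :
  measurable_fun [set: S] f -> sigma_rv (fun w => f (Z w)) `<=` sigma_rv Z.
Proof.
move=> mf _ [A mA <-]; exists (f @^-1` A); last by rewrite !setTI.
by rewrite -[X in measurable X]setTI; exact: mf.
Qed.

Lemma sigma_rv_seq dS (S : measurableType dS) (Z : nat -> {RV P >-> S}) i :
  sigma_rv (Z i) `<=` sigma_seq Z.
Proof. by move=> A ZA; apply: sub_sigma_algebra; exists i. Qed.

Lemma sigma_seq_bigcap dS (S : measurableType dS) (Z : nat -> {RV P >-> S}) (J : set nat)
    (A : nat -> set T) : (forall i, J i -> sigma_rv (Z i) (A i)) ->
  sigma_seq Z (\bigcap_(i in J) A i).
Proof.
move=> ZA.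
apply: (@bigcap_measurableType _ (g_sigma_algebraType (\bigcup_i sigma_rv (Z i)))).
by move=> i Ji; apply: sigma_rv_seq; exact: ZA.
Qed.

Lemma sigma_pair_measurable i : sigma_pair X Y i `<=` measurable.
Proof.
move=> _ [B [XB YB ->]]; apply: measurableI.
  exact: (@sigma_rv_measurable _ _ (X i)).
exact: (@sigma_rv_measurable _ _ (Y i)).
Qed.

Lemma sigma_pair_setI i : setI_closed (sigma_pair X Y i).
Proof.
move=> _ _ [A [XA YA ->]] [B [XB YB ->]]; exists (A.1 `&` B.1, A.2 `&` B.2); split => /=.
- exact: (@sigma_rv_setI _ _ (X i)).
- exact: (@sigma_rv_setI _ _ (Y i)).
- by rewrite setIACA.
Qed.

Lemma sigma_pair_left i : sigma_rv (X i) `<=` sigma_pair X Y i.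
Proof.
move=> A XA; exists (A, [set: T]); split => //=; last by rewrite setIT.
exact: (@sigma_rv_setT _ _ (Y i)).
Qed.

Lemma sigma_pair_right i : sigma_rv (Y i) `<=` sigma_pair X Y i.
Proof.
move=> A YA; exists ([set: T], A); split => //=; last by rewrite setTI.
exact: (@sigma_rv_setT _ _ (X i)).
Qed.

Lemma sigma_pair_setT i : sigma_pair X Y i [set: T].
Proof. by apply: sigma_pair_left; exact: (@sigma_rv_setT _ _ (X i)). Qed.

(** A finite intersection of rectangles is regrouped into its X part and its Y part, split by the
    independence of the two sequences, factored within each, and recombined index by index. *)
Lemma sigma_pair_independent : mutually_independent P (sigma_pair X Y).
Proof.
move=> J A FA.
have /choice [B HB] : forall i, exists B : set T * set T, i \in J ->
    [/\ sigma_rv (X i) B.1, sigma_rv (Y i) B.2 & A i = B.1 `&` B.2].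
  move=> i; case: (boolP (i \in J)) => [iJ|_]; last by exists (set0, set0).
  by have [B HB] := FA i iJ; exists B.
transitivity (P ((\bigcap_(i in [set` J]) (B i).1) `&` (\bigcap_(i in [set` J]) (B i).2))).
  rewrite -bigcapI; congr (P _); apply: eq_bigcapr => i /= iJ.
  by have [_ _] := HB i iJ.
rewrite XY_indep; last 2 first.
  by apply: sigma_seq_bigcap => i /= /HB [].
  by apply: sigma_seq_bigcap => i /= /HB [].
rewrite X_indep; last by move=> i /HB [].
rewrite Y_indep; last by move=> i /HB [].
rewrite -big_split/=; apply: eq_big_seq => i iJ.
have [XB YB ->] := HB i iJ.
by rewrite XY_indep//; [exact: (sigma_rv_seq XB)|exact: (sigma_rv_seq YB)].
Qed.

End joint_independence.

(** * Algebra of the walk along the coordinate axes *)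

Section walk_structure.
Context (R : realType) dT (T : measurableType dT) (d : nat).
Context (r : nat -> T -> R) (v : nat -> T -> borel_rV R d).

(** The coordinates of [v i] equal these indicators only almost surely. With the indicators,
    idempotence, disjointness and the identities built on them hold at every point. *)
Definition ind i (a : 'I_d) w : R := (v i w == delta_mx 0 a)%:R.

Lemma ind_mul i a w : ind i a w * ind i a w = ind i a w.
Proof. by rewrite /ind; case: eqP => _; rewrite ?mulr1 ?mulr0. Qed.

Lemma ind_bound i a w : 0 <= ind i a w <= 1.
Proof. by rewrite /ind; case: eqP => _ /=; rewrite ?lexx ler01. Qed.

Lemma delta_row_inj : injective (fun a : 'I_d => delta_mx 0 a : 'rV[R]_d).
Proof.
move=> a b /rowP /(_ a); rewrite !mxE !eqxx/=.
by case: eqP => // _ /eqP; rewrite oner_eq0.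
Qed.

Lemma ind_disjoint i a b w : a != b -> ind i a w * ind i b w = 0.
Proof.
rewrite /ind => ab; have [va|_] := eqVneq (v i w) (delta_mx 0 a); last by rewrite mul0r.
rewrite va; case: eqP => [/delta_row_inj abE|_]; last by rewrite mulr0.
by rewrite abE eqxx in ab.
Qed.

Lemma sum_ind_le1 i w : 0 <= \sum_(a < d) ind i a w <= 1.
Proof.
rewrite sumr_ge0 => [|a _]; last by case/andP: (ind_bound i a w).
have [[a va]|none] := pselect (exists a : 'I_d, v i w = delta_mx 0 a).
  rewrite (bigD1 a)//= big1 ?addr0; first by case/andP: (ind_bound i a w).
  move=> b ba; have := ind_disjoint i w ba.
  by rewrite [ind i a w]/ind va eqxx mulr1.
rewrite big1 ?ler01// => a _; rewrite /ind; case: eqP => // va.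
by case: none; exists a.
Qed.

(* At most one of the indicators is nonzero, so powers can be taken termwise. *)
Lemma sum_ind_expr i w (x : 'I_d -> R) n :
  (\sum_(a < d) x a * ind i a w) ^+ n.+1 = \sum_(a < d) x a ^+ n.+1 * ind i a w.
Proof.
have [[a va]|none] := pselect (exists a : 'I_d, v i w = delta_mx 0 a).
  have ia : ind i a w = 1 by rewrite /ind va eqxx.
  have ib b : b != a -> ind i b w = 0.
    by move=> ba; have := ind_disjoint i w ba; rewrite ia mulr1.
  rewrite (bigD1 a)//= big1 => [|b ba]; last by rewrite ib// mulr0.
  rewrite [RHS](bigD1 a)//= [X in _ = _ + X]big1 => [|b ba]; last by rewrite ib// mulr0.
  by rewrite ia !mulr1 !addr0.
have i0 a : ind i a w = 0.
  by rewrite /ind; case: eqP => // va; case: none; exists a.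
by rewrite !big1 ?expr0n// => a _; rewrite i0 mulr0.
Qed.

Lemma sum_ind_mul i w (x y : 'I_d -> R) :
  (\sum_(a < d) x a * ind i a w) * (\sum_(a < d) y a * ind i a w) =
  \sum_(a < d) x a * y a * ind i a w.
Proof.
rewrite mulr_suml; apply: eq_bigr => a _.
rewrite mulr_sumr (bigD1 a)//= big1 => [|b ba].
  by rewrite addr0 mulrACA ind_mul.
by rewrite mulrACA ind_disjoint ?mulr0// eq_sym.
Qed.

Lemma measurable_ind_fun (a : 'I_d) :
  measurable_fun [set: borel_rV R d] (fun u : borel_rV R d => (u == delta_mx 0 a)%:R : R).
Proof.
have -> : (fun u : borel_rV R d => (u == delta_mx 0 a)%:R : R) =
    \1_([set delta_mx 0 a] : set (borel_rV R d)).
  apply/funext => u; rewrite indicE; congr (_%:R); congr nat_of_bool.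
  by apply/eqP/idP; rewrite inE.
apply: measurable_indic; rewrite -[X in measurable X]setCK; apply: measurableC.
apply: sub_sigma_algebra; apply: closed_openC.
exact: (accessible_closed_set1 (hausdorff_accessible (@norm_hausdorff _ _))).
Qed.

(** Cylinders generating the past of the walk: [k] is the time and [N] a fixed horizon. *)
Definition pair_block N k : set_system T := block (sigma_pair r v) N (fun i => (i < k)%N).

(* [partial] is coordinate a of the walk with steps g(r_i) v_i, and [tang] its
   coordinate in the direction of the next step, so that
   |S_(k+1)|^2 = |S_k|^2 + 2 g(r_k) tang + g(r_k)^2. *)
Definition partial (g : R -> R) k a w := \sum_(i < k) g (r i w) * ind i a w.

Definition tang (g : R -> R) k w := \sum_(a < d) partial g k a w * ind k a w.

Definition cross (g : R -> R) k w := \sum_(i < k) 2 * (g (r i w) * tang g i w).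

Lemma partialS g k a w : partial g k.+1 a w = partial g k a w + g (r k w) * ind k a w.
Proof. by rewrite /partial big_ord_recr. Qed.

Lemma crossS g k w : cross g k.+1 w = cross g k w + 2 * (g (r k w) * tang g k w).
Proof. by rewrite /cross big_ord_recr. Qed.

Lemma partial0 g a w : partial g 0 a w = 0.
Proof. by rewrite /partial big_ord0. Qed.

Lemma cross0 g w : cross g 0 w = 0.
Proof. by rewrite /cross big_ord0. Qed.

Lemma sum_sqr_partialS g k w : \sum_(a < d) partial g k.+1 a w ^+ 2 =
  \sum_(a < d) partial g k a w ^+ 2 + 2 * (g (r k w) * tang g k w) +
  g (r k w) ^+ 2 * \sum_(a < d) ind k a w.
Proof.
rewrite /tang !mulr_sumr -!big_split/=; apply: eq_bigr => a _.
by rewrite partialS sqrrD exprMn [ind _ _ _ ^+ 2]expr2 ind_mul; ring.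
Qed.

Lemma walk_norm_sqr g k w : (forall i, (i < k)%N -> \sum_(a < d) ind i a w = 1) ->
  \sum_(a < d) partial g k a w ^+ 2 = \sum_(i < k) g (r i w) ^+ 2 + cross g k w.
Proof.
elim: k => [one|k IH one].
  rewrite cross0 [X in _ = X + _]big_ord0 addr0; apply: big1 => a _.
  by rewrite partial0 expr0n.
rewrite sum_sqr_partialS IH; last by move=> i ik; apply: one; rewrite ltnS ltnW.
by rewrite one// crossS big_ord_recr/=; ring.
Qed.

End walk_structure.

Section walk_moments.
Context (R : realType) dT (T : measurableType dT) (P : probability T R) (d : nat).
Context (r : nat -> {RV P >-> R}) (v : nat -> {RV P >-> borel_rV R d}).
Context (d_gt0 : (0 < d)%N).
Context (r_law : forall i, same_law (r i) (r 0%N)).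
Context (r_indep : mutually_independent P (fun i => sigma_rv (r i))).
Context (v_law : forall i (a : 'I_d), P [set w | v i w = delta_mx 0 a] = (d%:R^-1)%:E).
Context (v_indep : mutually_independent P (fun i => sigma_rv (v i))).
Context (rv_indep : independent P (sigma_seq r) (sigma_seq v)).

Local Notation pblock := (@pair_block R _ _ _ r v).
Local Notation ind := (@ind R _ _ _ v).
Local Notation partial := (@partial R _ _ _ r v).
Local Notation tang := (@tang R _ _ _ r v).
Local Notation cross := (@cross R _ _ _ r v).
Local Notation past N k := (measurable_wrt (pblock N k)).
Local Notation e f := (mean P (fun w => f (r 0%N w))).

Implicit Types (f g h : R -> R).

Let d_neq0 : d%:R != 0 :> R.
Proof. by rewrite pnatr_eq0 -lt0n. Qed.

Let pair_meas i : sigma_pair r v i `<=` measurable .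
Proof. exact: sigma_pair_measurable. Qed.
Let pair_setI i : setI_closed (sigma_pair r v i) .
Proof. exact: sigma_pair_setI. Qed.
Let pair_setT i : sigma_pair r v i [set: T] .
Proof. exact: sigma_pair_setT. Qed.
Let pair_indep : mutually_independent P (sigma_pair r v).
Proof. exact: sigma_pair_independent. Qed.

Lemma pair_block_measurable N k : pblock N k `<=` measurable.
Proof. exact: block_measurable. Qed.

Lemma past_measurable N k (X : T -> R) : past N k X -> measurable_fun [set: T] X.
Proof. by apply: measurable_wrt_measurable; exact: pair_block_measurable. Qed.

Lemma block_measurable_wrt_r N (J : pred nat) i (f : R -> R) : (i < N)%N -> J i ->
  measurable_fun [set: R] f ->
  measurable_wrt (block (@sigma_pair _ T _ R _ (borel_rV R d) r v) N J) (fun w => f (r i w)).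
Proof.
move=> iN Ji mf; apply: (block_measurable_wrt pair_setT iN Ji) => A fA.
apply: sigma_pair_left; exact: (sigma_rv_comp mf).
Qed.

Lemma block_measurable_wrt_ind N (J : pred nat) i a : (i < N)%N -> J i ->
  measurable_wrt (block (@sigma_pair _ T _ R _ (borel_rV R d) r v) N J) (ind i a).
Proof.
move=> iN Ji; apply: (block_measurable_wrt pair_setT iN Ji) => A fA.
by apply: sigma_pair_right; exact: (sigma_rv_comp (measurable_ind_fun a)).
Qed.

Lemma past_partial N j k g a : (j <= k <= N)%N -> measurable_fun [set: R] g ->
  past N k (partial g j a).
Proof.
move=> /andP[jk kN] mg; apply: measurable_sum => i; apply: measurable_funM.
  apply: block_measurable_wrt_r => //; last exact: leq_trans jk.
  by rewrite (leq_trans (ltn_ord i))// (leq_trans jk).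
apply: block_measurable_wrt_ind => //; last exact: leq_trans jk.
by rewrite (leq_trans (ltn_ord i))// (leq_trans jk).
Qed.

Lemma past_tang N j k g : (j < k <= N)%N -> measurable_fun [set: R] g -> past N k (tang g j).
Proof.
move=> /andP[jk kN] mg; apply: measurable_sum => a; apply: measurable_funM.
  by apply: past_partial => //; rewrite (ltnW jk).
by apply: block_measurable_wrt_ind => //; exact: leq_trans kN.
Qed.

Lemma past_cross N j k g : (j <= k <= N)%N -> measurable_fun [set: R] g ->
  past N k (cross g j).
Proof.
move=> /andP[jk kN] mg; apply: measurable_sum => i.
apply: measurable_funM => //; apply: measurable_funM.
  apply: block_measurable_wrt_r => //; last exact: leq_trans jk.
  by rewrite (leq_trans (ltn_ord i))// (leq_trans jk).
by apply: past_tang => //; rewrite kN andbT (leq_trans (ltn_ord i)).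
Qed.

Lemma measurable_partial g k a : measurable_fun [set: R] g -> measurable_fun [set: T] (partial g k a).
Proof. by move=> mg; apply: (@past_measurable k k); apply: past_partial; rewrite ?leqnn. Qed.

Lemma measurable_cross g k : measurable_fun [set: R] g -> measurable_fun [set: T] (cross g k).
Proof. by move=> mg; apply: (@past_measurable k k); apply: past_cross; rewrite ?leqnn. Qed.

Lemma measurable_tang g k : measurable_fun [set: R] g -> measurable_fun [set: T] (tang g k).
Proof. by move=> mg; apply: (@past_measurable k.+1 k.+1); apply: past_tang; rewrite ?leqnn. Qed.

Lemma measurable_ind k a : measurable_fun [set: T] (ind k a).
Proof.
by apply: (@past_measurable k.+1 k.+1); exact: block_measurable_wrt_ind.
Qed.

Lemma measurable_comp_r g k : measurable_fun [set: R] g -> measurable_fun [set: T] (fun w => g (r k w)).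
Proof. by move=> mg; apply: (measurableT_comp mg). Qed.

Lemma mean_ind k a : mean P (ind k a) = d%:R^-1.
Proof.
apply: EFin_inj; rewrite -(v_law k a) -expectation_mean; last first.
  apply: (@integ_bounded _ _ _ _ 1); first exact: measurable_ind.
  by move=> w; have /andP[i0 i1] := ind_bound v k a w; rewrite ger0_norm.
rewrite unlock; transitivity (\int[P]_w (\1_[set w | v k w = delta_mx 0 a] w)%:E)%E.
  apply: eq_integral => w _; congr EFin; rewrite indicE /ind; congr (_%:R); congr nat_of_bool.
  by apply/eqP/idP; rewrite inE.
rewrite integral_indic ?setIT//.
rewrite (_ : [set w | _] = v k @^-1` [set delta_mx 0 a]); last by [].
rewrite -[X in measurable X]setTI; apply: measurable_funPT => //.
rewrite -[X in measurable X]setCK; apply: measurableC.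
apply: sub_sigma_algebra; apply: closed_openC.
exact: (accessible_closed_set1 (hausdorff_accessible (@norm_hausdorff _ _))).
Qed.

Lemma mean_r_ind (f : R -> R) k a : measurable_fun [set: R] f ->
  integ P (fun w => f (r 0%N w)) ->
  integ P (fun w => f (r k w) * ind k a w) /\
  mean P (fun w => f (r k w) * ind k a w) = e f / d%:R.
Proof.
move=> mf if0; have [ifk fkE] := same_law_integ_mean (r_law k) mf if0.
have iind : integ P (ind k a).
  apply: (@integ_bounded _ _ _ _ 1); first exact: measurable_ind.
  by move=> w; have /andP[i0 i1] := ind_bound v k a w; rewrite ger0_norm.
have [ii mm] : integ P (fun w => f (r k w) * ind k a w) /\
  mean P (fun w => f (r k w) * ind k a w) = mean P (fun w => f (r k w)) * mean P (ind k a).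
  apply: indep_mean_mul => // A B fA iB; apply: rv_indep.
    by apply: sigma_rv_seq; exact: (sigma_rv_comp mf fA).
  by apply: sigma_rv_seq; exact: (sigma_rv_comp (measurable_ind_fun a) iB).
by split => //; rewrite mm fkE mean_ind.
Qed.

(** Replaces conditioning on the past: a centred [f] gives the martingale property, and the square
    of the step function gives conditional variances. *)
Lemma mean_past_step N k (X : T -> R) (f : R -> R) a : (k < N)%N -> past N k X -> integ P X ->
  measurable_fun [set: R] f -> integ P (fun w => f (r 0%N w)) ->
  integ P (fun w => X w * (f (r k w) * ind k a w)) /\
  mean P (fun w => X w * (f (r k w) * ind k a w)) = mean P X * (e f / d%:R).
Proof.
move=> kN pX iX mf if0; have [ifi <-] := mean_r_ind k a mf if0.
have bi : independent P <<s pblock N k >> <<s block (@sigma_pair _ T _ R _ (borel_rV R d) r v) N (pred1 k) >>.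
  apply: block_independent => // i ik /=.
  by rewrite neq_ltn ik.
apply: (independent_mean_mul bi) => //.
apply: measurable_funM; first by apply: block_measurable_wrt_r => //=; rewrite eqxx.
by apply: block_measurable_wrt_ind => //=; rewrite eqxx.
Qed.

Lemma sqint_r_ind g k a : measurable_fun [set: R] g -> sqint P (fun w => g (r 0%N w)) ->
  sqint P (fun w => g (r k w) * ind k a w).
Proof.
move=> mg [_ sg]; split.
  by apply: measurable_funM; [exact: measurable_comp_r|exact: measurable_ind].
under eq_fun do rewrite exprMn [_ _ _ _ ^+ 2]expr2 ind_mul.
by have [] := @mean_r_ind (fun x => g x ^+ 2) k a (measurable_funX 2 mg) sg.
Qed.

Lemma sqint_partial g k a : measurable_fun [set: R] g -> sqint P (fun w => g (r 0%N w)) ->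
  sqint P (partial g k a).
Proof. by move=> mg sg; apply: sqint_sum => i; exact: sqint_r_ind. Qed.

(** [g] may be the identity, for which no fourth moment is at hand: the square is integrable because
    each of its terms is a past variable times an independent one. *)
Lemma sqint_r_tang g k : measurable_fun [set: R] g -> sqint P (fun w => g (r 0%N w)) ->
  sqint P (fun w => g (r k w) * tang g k w).
Proof.
move=> mg sg; have [_ sg2] := sg; split.
  by apply: measurable_funM; [exact: measurable_comp_r|exact: measurable_tang].
under eq_fun do rewrite exprMn sum_ind_expr mulr_sumr.
apply: integ_sum => a.
under eq_fun do rewrite mulrCA.
have [] // := @mean_past_step k.+1 k (fun w => partial g k a w ^+ 2) (fun x => g x ^+ 2) a.
- by apply: measurable_funX; apply: past_partial; rewrite ?leqnn ?leqnSn.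
- by case: (sqint_partial k a mg sg).
- exact: measurable_funX.
Qed.

Lemma sqint_cross g k : measurable_fun [set: R] g -> sqint P (fun w => g (r 0%N w)) ->
  sqint P (cross g k).
Proof. by move=> mg sg; apply: sqint_sum => i; apply: sqintZ; exact: sqint_r_tang. Qed.

Lemma mean_partial_mul g h k a : measurable_fun [set: R] g -> measurable_fun [set: R] h ->
  sqint P (fun w => g (r 0%N w)) -> sqint P (fun w => h (r 0%N w)) -> e g = 0 -> e h = 0 ->
  mean P (fun w => partial g k a w * partial h k a w) =
    k%:R * mean P (fun w => g (r 0%N w) * h (r 0%N w)) / d%:R.
Proof.
move=> mg mh sg sh g0 h0; elim: k => [|k IH].
  rewrite !mul0r -[RHS](mean_cst P); apply: eq_mean => w.
  by rewrite partial0 mul0r.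
have mgh : measurable_fun [set: R] (fun x => g x * h x) by exact: measurable_funM.
have pg : past k.+1 k (partial g k a) by apply: past_partial; rewrite ?leqnn ?leqnSn.
have ph : past k.+1 k (partial h k a) by apply: past_partial; rewrite ?leqnn ?leqnSn.
have spg := sqint_partial k a mg sg; have sph := sqint_partial k a mh sh.
have ispg := sqint_integ spg; have isph := sqint_integ sph.
have ig := sqint_integ sg; have ih := sqint_integ sh.
have [i1 e1] := mean_past_step a (ltnSn k) pg ispg mh ih.
have [i2 e2] := mean_past_step a (ltnSn k) ph isph mg ig.
have [i3 e3] := mean_r_ind k a mgh (sqint_mul sg sh).
have i0 := sqint_mul spg sph.
transitivity (mean P (fun w => partial g k a w * partial h k a w +
    partial g k a w * (h (r k w) * ind k a w) + partial h k a w * (g (r k w) * ind k a w) +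
    g (r k w) * h (r k w) * ind k a w)).
  apply: eq_mean => w; rewrite !partialS mulrDl !mulrDr addrA; congr (_ + _ + _).
    by rewrite [in RHS]mulrC.
  by rewrite mulrACA ind_mul.
rewrite meanD; [|by apply: integD => //; exact: integD|exact: i3].
rewrite meanD; [|exact: integD|exact: i2].
rewrite meanD// e1 e2 e3 IH g0 h0 -natr1.
by field.
Qed.

(** Bilinear in the step function, so that the L^2 distance between the cross terms of the original
    and of the bounded walk can be expanded. Increments are orthogonal to the past, and the [i]-th
    ones contribute 4 i / d times the squared mean of g h; these sum to the factor 2 k (k - 1) /
    d. *)
Lemma mean_cross_mul g h k : measurable_fun [set: R] g -> measurable_fun [set: R] h ->
  sqint P (fun w => g (r 0%N w)) -> sqint P (fun w => h (r 0%N w)) -> e g = 0 -> e h = 0 ->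
  mean P (fun w => cross g k w * cross h k w) =
    2 * k%:R * (k%:R - 1) / d%:R * mean P (fun w => g (r 0%N w) * h (r 0%N w)) ^+ 2.
Proof.
move=> mg mh sg sh g0 h0; elim: k => [|k IH].
  rewrite mulr0 !mul0r -[RHS](mean_cst P); apply: eq_mean => w.
  by rewrite cross0 mul0r.
set c := mean P (fun w => g (r 0%N w) * h (r 0%N w)) in IH *.
have mgh : measurable_fun [set: R] (fun x => g x * h x) by exact: measurable_funM.
have kk : (k <= k <= k.+1)%N by rewrite leqnn leqnSn.
have ig := sqint_integ sg; have ih := sqint_integ sh.
have scg := sqint_cross k mg sg; have sch := sqint_cross k mh sh.
have step1 a := mean_past_step a (ltnSn k)
  (measurable_funM (past_cross kk mg) (past_partial a kk mh))
  (sqint_mul scg (sqint_partial k a mh sh)) mh ih.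
have step2 a := mean_past_step a (ltnSn k)
  (measurable_funM (past_cross kk mh) (past_partial a kk mg))
  (sqint_mul sch (sqint_partial k a mg sg)) mg ig.
have step3 a := mean_past_step a (ltnSn k)
  (measurable_funM (past_partial a kk mg) (past_partial a kk mh))
  (sqint_mul (sqint_partial k a mg sg) (sqint_partial k a mh sh)) mgh (sqint_mul sg sh).
pose A1 w := \sum_(a < d) (cross g k w * partial h k a w) * (h (r k w) * ind k a w).
pose A2 w := \sum_(a < d) (cross h k w * partial g k a w) * (g (r k w) * ind k a w).
pose A3 w := \sum_(a < d) (partial g k a w * partial h k a w) *
  (g (r k w) * h (r k w) * ind k a w).
have i1 : integ P A1 by apply: integ_sum => a; have [] := step1 a.
have i2 : integ P A2 by apply: integ_sum => a; have [] := step2 a.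
have i3 : integ P A3 by apply: integ_sum => a; have [] := step3 a.
have e1 : mean P A1 = 0.
  rewrite mean_sum; last by move=> a; have [] := step1 a.
  by apply: big1 => a _; have [_ ->] := step1 a; rewrite h0 mul0r mulr0.
have e2 : mean P A2 = 0.
  rewrite mean_sum; last by move=> a; have [] := step2 a.
  by apply: big1 => a _; have [_ ->] := step2 a; rewrite g0 mul0r mulr0.
have e3 : mean P A3 = k%:R * c ^+ 2 / d%:R.
  rewrite mean_sum; last by move=> a; have [] := step3 a.
  under eq_bigr => a _.
    have [_ ->] := step3 a; rewrite mean_partial_mul// -/c.
    over.
  rewrite sumr_const card_ord -[_ *+ d]mulr_natl; by field.
have i0 := sqint_mul scg sch.
transitivity (mean P (fun w => cross g k w * cross h k w + 2 * A1 w + 2 * A2 w + 4 * A3 w)).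
  apply: eq_mean => w; rewrite !crossS.
  have -> : A1 w = cross g k w * (h (r k w) * tang h k w).
    by rewrite /A1 /tang !mulr_sumr; apply: eq_bigr => a _; ring.
  have -> : A2 w = cross h k w * (g (r k w) * tang g k w).
    by rewrite /A2 /tang !mulr_sumr; apply: eq_bigr => a _; ring.
  have -> : A3 w = g (r k w) * h (r k w) * (tang g k w * tang h k w).
    by rewrite /tang sum_ind_mul mulr_sumr; apply: eq_bigr => a _; ring.
  by ring.
rewrite meanD; [|apply: integD; [apply: integD => //|]; exact: integZ|exact: integZ].
rewrite meanD; [|apply: integD => //; exact: integZ|exact: integZ].
rewrite meanD; [|by []|exact: integZ].
rewrite !meanZ// e1 e2 e3 IH -natr1.
by field.
Qed.

(** * Moment recursions for bounded steps *)

Section bounded_increments.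
Context (g : R -> R) (B : R).
Context (mg : measurable_fun [set: R] g) (gB : forall x, `|g x| <= B) (g0 : e g = 0).
Local Notation s2 := (mean P (fun w => g (r 0%N w) ^+ 2)).

Let B0 : 0 <= B. Proof. by rewrite (le_trans _ (gB 0)). Qed.

Let B4 : B ^+ 4 = (B ^+ 2) ^+ 2. Proof. by rewrite -exprM. Qed.

Let g2B x : g x ^+ 2 <= B ^+ 2.
Proof. by rewrite -real_normK ?num_real// lerXn2r ?nnegrE. Qed.

Let sg : sqint P (fun w => g (r 0%N w)).
Proof. by apply: (@sqint_bounded _ _ _ _ B) => //; exact: measurable_comp_r. Qed.

Let integ_gX n : integ P (fun w => g (r 0%N w) ^+ n).
Proof.
apply: (@integ_bounded _ _ _ _ (B ^+ n)); first exact/measurable_funX/measurable_comp_r.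
by move=> w; rewrite normrX lerXn2r ?nnegrE.
Qed.

Lemma var_ge0 : 0 <= s2.
Proof. by apply: mean_ge0 => w; exact: sqr_ge0. Qed.

Lemma var_le : s2 <= B ^+ 2.
Proof. by apply: mean_le_cst => //; exact: (integ_gX 2). Qed.

(** Qualitative boundedness, meant for integrability: its constants grow with the number of steps,
    and the quantitative bounds come from the moment recursions. *)
Definition bnd (X : T -> R) := exists c, forall w, `|X w| <= c.

Lemma bndD X Y : bnd X -> bnd Y -> bnd (fun w => X w + Y w).
Proof.
by move=> [c Xc] [c' Yc]; exists (c + c') => w; rewrite (le_trans (ler_normD _ _))// lerD.
Qed.

Lemma bndM X Y : bnd X -> bnd Y -> bnd (fun w => X w * Y w).
Proof.
by move=> [c Xc] [c' Yc]; exists (c * c') => w; rewrite normrM ler_pM.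
Qed.

Lemma bndX X n : bnd X -> bnd (fun w => X w ^+ n).
Proof.
move=> [c Xc]; exists (c ^+ n) => w; rewrite normrX lerXn2r ?nnegrE//.
by rewrite (le_trans _ (Xc w)).
Qed.

Lemma bnd_cst c : bnd (fun=> c).
Proof. by exists `|c|. Qed.

Lemma bnd_sum (I : Type) (s : seq I) (F : I -> T -> R) : (forall i, bnd (F i)) ->
  bnd (fun w => \sum_(i <- s) F i w).
Proof.
move=> bF; elim: s => [|i s IH].
  by under eq_fun do rewrite big_nil; exact: bnd_cst.
by under eq_fun do rewrite big_cons; exact: bndD.
Qed.

Lemma bnd_integ X : measurable_fun [set: T] X -> bnd X -> integ P X.
Proof. by move=> mX [c Xc]; exact: (integ_bounded P mX Xc). Qed.

Lemma bnd_sqint X : measurable_fun [set: T] X -> bnd X -> sqint P X.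
Proof. by move=> mX [c Xc]; exact: (sqint_bounded P mX Xc). Qed.

Lemma bnd_g k : bnd (fun w => g (r k w)).
Proof. by exists B. Qed.

Lemma bnd_ind k a : bnd (ind k a).
Proof.
by exists 1 => w; have /andP[i0 i1] := ind_bound v k a w; rewrite ger0_norm.
Qed.

Lemma bnd_partial k a : bnd (partial g k a).
Proof. by apply: bnd_sum => i; apply: bndM; [exact: bnd_g|exact: bnd_ind]. Qed.

Lemma bnd_tang k : bnd (tang g k).
Proof. by apply: bnd_sum => a; apply: bndM; [exact: bnd_partial|exact: bnd_ind]. Qed.

(** Up to a constant factor, the squared norm of the bounded walk is the conditional variance of the
    next term of [cross]; [drift] is its deviation from the mean. *)
Definition drift k w := \sum_(a < d) partial g k a w ^+ 2 - k%:R * s2.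

Lemma bnd_drift k : bnd (drift k).
Proof.
apply: bndD; last exact: bnd_cst.
by apply: bnd_sum => a; apply: bndX; exact: bnd_partial.
Qed.

Lemma past_drift N j k : (j <= k <= N)%N -> past N k (drift j).
Proof.
move=> jkN; apply: measurable_funB => //; apply: measurable_sum => a.
by apply: measurable_funX; exact: past_partial.
Qed.

Lemma mean_r_tang_sqr N k X : (k < N)%N -> past N k X -> bnd X ->
  mean P (fun w => X w * (g (r k w) * tang g k w) ^+ 2) =
  s2 / d%:R * mean P (fun w => X w * \sum_(a < d) partial g k a w ^+ 2).
Proof.
move=> kN pX bX; have kk : (k <= k <= N)%N by rewrite leqnn ltnW.
have pXa a : past N k (fun w => X w * partial g k a w ^+ 2).
  by apply: measurable_funM => //; apply: measurable_funX; exact: past_partial.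
have iXa a : integ P (fun w => X w * partial g k a w ^+ 2).
  apply: bnd_integ; first exact: (past_measurable (pXa a)).
  by apply: bndM => //; apply: bndX; exact: bnd_partial.
have step a := mean_past_step a kN (pXa a) (iXa a) (measurable_funX 2 mg) (integ_gX 2).
transitivity (mean P (fun w => \sum_(a < d) (X w * partial g k a w ^+ 2) *
    (g (r k w) ^+ 2 * ind k a w))).
  apply: eq_mean => w; rewrite exprMn sum_ind_expr !mulr_sumr.
  by apply: eq_bigr => a _; ring.
rewrite mean_sum; last by move=> a; have [] := step a.
rewrite (eq_bigr (fun a => s2 / d%:R * mean P (fun w => X w * partial g k a w ^+ 2))); last first.
  by move=> a _; have [_ ->] := step a; rewrite mulrC.
rewrite -mulr_sumr -mean_sum//; congr (_ * _); apply: eq_mean => w.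
by rewrite mulr_sumr.
Qed.

Lemma mean_past_r_tang N k X : (k < N)%N -> past N k X -> bnd X ->
  mean P (fun w => X w * (g (r k w) * tang g k w)) = 0.
Proof.
move=> kN pX bX; have kk : (k <= k <= N)%N by rewrite leqnn ltnW.
have pXa a : past N k (fun w => X w * partial g k a w).
  by apply: measurable_funM => //; exact: past_partial.
have iXa a : integ P (fun w => X w * partial g k a w).
  apply: bnd_integ; first exact: (past_measurable (pXa a)).
  by apply: bndM => //; exact: bnd_partial.
have step a := mean_past_step a kN (pXa a) (iXa a) mg (integ_gX 1).
transitivity (mean P (fun w => \sum_(a < d) (X w * partial g k a w) *
    (g (r k w) * ind k a w))).
  by apply: eq_mean => w; rewrite !mulr_sumr; apply: eq_bigr => a _; ring.
rewrite mean_sum; last by move=> a; have [] := step a.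
by apply: big1 => a _; have [_ ->] := step a; rewrite g0 mul0r mulr0.
Qed.

Lemma mean_sum_sqr_partial k :
  mean P (fun w => \sum_(a < d) partial g k a w ^+ 2) = k%:R * s2.
Proof.
rewrite mean_sum; last first.
  move=> a; apply: bnd_integ; last by apply: bndX; exact: bnd_partial.
  exact/measurable_funX/measurable_partial.
under eq_bigr do rewrite (mean_partial_mul _ _ mg mg)//.
by rewrite sumr_const card_ord -[_ *+ d]mulr_natl; field.
Qed.

Lemma mean_r_tang_sqr1 k :
  mean P (fun w => (g (r k w) * tang g k w) ^+ 2) = k%:R * s2 ^+ 2 / d%:R.
Proof.
have H := @mean_r_tang_sqr k.+1 k (fun=> 1) (ltnSn k) (measurable_cst _) (bnd_cst 1).
rewrite (@eq_mean _ _ _ _ _ (fun w => 1 * (g (r k w) * tang g k w) ^+ 2)); last first.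
  by move=> w; rewrite mul1r.
rewrite H [X in _ * X](_ : _ = k%:R * s2); first by field.
by rewrite -mean_sum_sqr_partial; apply: eq_mean => w; rewrite mul1r.
Qed.

Lemma measurable_r_tang k : measurable_fun [set: T] (fun w => g (r k w) * tang g k w).
Proof. by apply: measurable_funM; [exact: measurable_comp_r|exact: measurable_tang]. Qed.

Lemma bnd_r_tang k : bnd (fun w => g (r k w) * tang g k w).
Proof. by apply: bndM; [exact: bnd_g|exact: bnd_tang]. Qed.

(** [drift] is a martingale with increment 2 [W1] + [W2], so the second moments of the increments
    add up. [W1], the scalar product of the walk with its next step, contributes order k^2/d and the
    bounded [W2] order k: both are small against k^2. *)
Lemma mean_drift_sqr k :
  mean P (fun w => drift k w ^+ 2) <= k%:R * (8 * B ^+ 4 * k%:R / d%:R + 2 * B ^+ 4).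
Proof.
elim: k => [|k IH].
  rewrite mul0r (@eq_mean _ _ _ _ _ (fun=> 0)) ?mean_cst// => w.
  rewrite /drift big1 ?mul0r ?subr0 ?expr0n// => a _.
  by rewrite partial0 expr0n.
have kk : (k <= k <= k.+1)%N by rewrite leqnn leqnSn.
have mJ : measurable_fun [set: T] (fun w => \sum_(a < d) ind k a w).
  by apply: measurable_sum => a; exact: measurable_ind.
have bJ : bnd (fun w => \sum_(a < d) ind k a w) by apply: bnd_sum => a; exact: bnd_ind.
have pZ := past_drift kk; have bZ := bnd_drift k; have mZ := past_measurable pZ.
have iZ := bnd_integ mZ bZ.
pose W1 w := g (r k w) * tang g k w.
pose W2 w := g (r k w) ^+ 2 * (\sum_(a < d) ind k a w) - s2.
have mW1 : measurable_fun [set: T] W1 := measurable_r_tang k.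
have bW1 : bnd W1 := bnd_r_tang k.
have mW2 : measurable_fun [set: T] W2.
  apply: measurable_funB => //; apply: measurable_funM => //.
  exact/measurable_funX/measurable_comp_r.
have bW2 : bnd W2.
  apply: bndD; last exact: bnd_cst.
  by apply: bndM => //; apply: bndX; exact: bnd_g.
have driftS w : drift k.+1 w = drift k w + (2 * W1 w + W2 w).
  by rewrite /drift sum_sqr_partialS -natr1 /W1 /W2; ring.
have sZ := bnd_sqint mZ bZ; have sW1 := bnd_sqint mW1 bW1; have sW2 := bnd_sqint mW2 bW2.
have ZW1 : mean P (fun w => drift k w * W1 w) = 0 by exact: mean_past_r_tang pZ bZ.
(* Given the past, g^2 times each indicator has mean s2/d, and the d directions together restore the
   s2 that is subtracted in [W2]. *)
have ZW2 : mean P (fun w => drift k w * W2 w) = 0.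
  have step a := mean_past_step a (ltnSn k) pZ iZ (measurable_funX 2 mg) (integ_gX 2).
  transitivity (mean P (fun w => \sum_(a < d) drift k w * (g (r k w) ^+ 2 * ind k a w)
      - s2 * drift k w)).
    by apply: eq_mean => w; rewrite -mulr_sumr -mulr_sumr /W2; ring.
  rewrite meanB; [|by apply: integ_sum => a; have [] := step a|exact: integZ].
  rewrite meanZ// mean_sum; last by move=> a; have [] := step a.
  under eq_bigr => a _ do have [_ ->] := step a.
  by rewrite sumr_const card_ord -[_ *+ d]mulr_natl; field.
have W_le w : (2 * W1 w + W2 w) ^+ 2 <= 8 * W1 w ^+ 2 + 2 * B ^+ 4.
  have W2B : `|W2 w| <= B ^+ 2.
    have /andP[J0 J1] := sum_ind_le1 v k w.
    have h1 := var_ge0; have h2 := var_le; have h3 := g2B (r k w); have h4 := sqr_ge0 (g (r k w)).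
    rewrite ler_norml /W2; move: J0 J1 h1 h2 h3 h4.
    set x := g _ ^+ 2; set j := \sum_(a < d) _; set z := mean _ _ => J0 J1 h1 h2 h3 h4.
    have hj0 : 0 <= x * j by rewrite mulr_ge0.
    have hj1 : x * j <= x by rewrite ler_piMr.
    by apply/andP; split; lra.
  have W22 : W2 w ^+ 2 <= B ^+ 4.
    rewrite -real_normK ?num_real// B4.
    by rewrite lerXn2r ?nnegrE// exprn_ge0.
  rewrite -subr_ge0 (_ : _ - _ = (2 * W1 w - W2 w) ^+ 2 + 2 * (B ^+ 4 - W2 w ^+ 2)); last by ring.
  by rewrite addr_ge0 ?sqr_ge0// mulr_ge0// subr_ge0.
rewrite (@eq_mean _ _ _ _ _ (fun w => drift k w ^+ 2 +
    (2 * (2 * (drift k w * W1 w) + drift k w * W2 w) + (2 * W1 w + W2 w) ^+ 2))); last first.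
  by move=> w; rewrite driftS; ring.
have iZW1 := sqint_mul sZ sW1; have iZW2 := sqint_mul sZ sW2.
have iZ2 : integ P (fun w => drift k w ^+ 2) by case: sZ.
have iW2 : integ P (fun w => (2 * W1 w + W2 w) ^+ 2).
  by have [] := sqintD (sqintZ 2 sW1) sW2.
have iW12 : integ P (fun w => W1 w ^+ 2) by case: sW1.
have iZW : integ P (fun w => 2 * (drift k w * W1 w) + drift k w * W2 w).
  by apply: integD => //; exact: integZ.
have i2ZW : integ P (fun w => 2 * (2 * (drift k w * W1 w) + drift k w * W2 w)) by exact: integZ.
rewrite (meanD iZ2 (integD i2ZW iW2)) (meanD i2ZW iW2) (meanZ 2 iZW).
rewrite (meanD (integZ 2 iZW1) iZW2) (meanZ 2 iZW1) ZW1 ZW2 mulr0 addr0 mulr0 add0r.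
have W_mean : mean P (fun w => (2 * W1 w + W2 w) ^+ 2) <= 8 * (k%:R * B ^+ 4 / d%:R) + 2 * B ^+ 4.
  apply: (@le_trans _ _ (mean P (fun w => 8 * W1 w ^+ 2 + 2 * B ^+ 4))).
    by apply: mean_le => //; apply: integD; [exact: integZ|exact: integ_cst].
  rewrite meanD; [|exact: integZ|exact: integ_cst].
  rewrite meanZ// mean_cst lerD2r ler_wpM2l// mean_r_tang_sqr1.
  rewrite ler_wpM2r ?invr_ge0// ler_wpM2l// B4.
  by rewrite lerXn2r ?nnegrE ?var_ge0 ?var_le// exprn_ge0.
apply: (le_trans (lerD IH W_mean)).
have -> : k%:R * (8 * B ^+ 4 * k%:R / d%:R + 2 * B ^+ 4) +
    (8 * (k%:R * B ^+ 4 / d%:R) + 2 * B ^+ 4) =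
    k.+1%:R * (8 * B ^+ 4 * k%:R / d%:R + 2 * B ^+ 4).
  by rewrite -natr1; field.
rewrite ler_wpM2l// lerD2r ler_wpM2r ?invr_ge0// ler_wpM2l ?ler_nat//.
by rewrite mulr_ge0// exprn_ge0.
Qed.

(** In the binomial expansion the centring of g removes the term (3, 1), and the vanishing mean of
    the partial sum removes (1, 3). A coordinate moves about k/d times: the term (2, 2) yields the
    Gaussian order (k/d)^2, the term (0, 4) the single-jump order k/d. *)
Lemma mean_partial4 k a : mean P (fun w => partial g k a w ^+ 4) <=
  k%:R * (6 * k%:R * B ^+ 4 / d%:R ^+ 2 + B ^+ 4 / d%:R).
Proof.
elim: k => [|k IH].
  by rewrite mul0r (@eq_mean _ _ _ _ _ (fun=> 0)) ?mean_cst// => w; rewrite partial0 expr0n.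
have kk : (k <= k <= k.+1)%N by rewrite leqnn leqnSn.
have pS := past_partial a kk mg; have mS := past_measurable pS; have bS := bnd_partial k a.
have pX n : past k.+1 k (fun w => partial g k a w ^+ n) by exact: measurable_funX.
have iX n : integ P (fun w => partial g k a w ^+ n).
  by apply: bnd_integ; [exact: measurable_funX|exact: bndX].
have step n m := mean_past_step a (ltnSn k) (pX n) (iX n) (measurable_funX m mg) (integ_gX m).
pose E n m := mean P (fun w => partial g k a w ^+ n * (g (r k w) ^+ m * ind k a w)).
rewrite (@eq_mean _ _ _ _ _ (fun w => partial g k a w ^+ 4 +
    (4 * (partial g k a w ^+ 3 * (g (r k w) ^+ 1 * ind k a w)) +
    (6 * (partial g k a w ^+ 2 * (g (r k w) ^+ 2 * ind k a w)) +
    (4 * (partial g k a w ^+ 1 * (g (r k w) ^+ 3 * ind k a w)) +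
     partial g k a w ^+ 0 * (g (r k w) ^+ 4 * ind k a w)))))); last first.
  by move=> w; rewrite partialS /ind; case: eqP => _ /=; ring.
have i31 := integZ 4 (step 3%N 1%N).1; have i22 := integZ 6 (step 2%N 2%N).1.
have i13 := integZ 4 (step 1%N 3%N).1; have i04 := (step 0%N 4%N).1.
rewrite (meanD (iX 4%N) (integD i31 (integD i22 (integD i13 i04)))).
rewrite (meanD i31 (integD i22 (integD i13 i04))) (meanD i22 (integD i13 i04)) (meanD i13 i04).
rewrite (meanZ 4 (step 3%N 1%N).1) (meanZ 6 (step 2%N 2%N).1) (meanZ 4 (step 1%N 3%N).1).
rewrite (step 3%N 1%N).2 (step 2%N 2%N).2 (step 1%N 3%N).2 (step 0%N 4%N).2.
have -> : mean P (fun w => g (r 0%N w) ^+ 1) = 0 by rewrite -[RHS]g0.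
have -> : mean P (fun w => partial g k a w ^+ 1) = 0.
  rewrite mean_sum; last by move=> i; have [] := mean_r_ind i a mg (integ_gX 1).
  apply: big1 => i _; have [_ ->] := mean_r_ind i a mg (integ_gX 1).
  by rewrite g0 mul0r.
have -> : mean P (fun w => partial g k a w ^+ 0) = 1 by rewrite mean_cst.
have m2 : mean P (fun w => partial g k a w ^+ 2) = k%:R * s2 / d%:R.
  exact: mean_partial_mul.
have m4 : mean P (fun w => g (r 0%N w) ^+ 4) <= B ^+ 4.
  apply: mean_le_cst => // w; rewrite (_ : 4%N = (2 * 2)%N)// !exprM.
  by rewrite lerXn2r ?nnegrE ?sqr_ge0.
rewrite m2 !mul0r !mulr0 !add0r mul1r.
have s4 : s2 ^+ 2 <= B ^+ 4.
  rewrite B4.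
  by rewrite lerXn2r ?nnegrE ?var_ge0 ?var_le// exprn_ge0.
have dV : 0 <= d%:R^-1 :> R by rewrite invr_ge0.
have h1 : mean P (fun w => g (r 0%N w) ^+ 4) / d%:R <= B ^+ 4 / d%:R by rewrite ler_wpM2r.
have h2 : 6 * (k%:R * s2 / d%:R * (s2 / d%:R)) <= 6 * k%:R * B ^+ 4 / d%:R ^+ 2.
  rewrite (_ : 6 * (k%:R * s2 / d%:R * (s2 / d%:R)) = 6 * k%:R / d%:R ^+ 2 * s2 ^+ 2); last by field.
  rewrite (_ : 6 * k%:R * B ^+ 4 / d%:R ^+ 2 = 6 * k%:R / d%:R ^+ 2 * B ^+ 4); last by field.
  by rewrite ler_wpM2l// divr_ge0 ?mulr_ge0 ?exprn_ge0.
apply: (le_trans (lerD IH (lerD h2 h1))).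
have -> : k%:R * (6 * k%:R * B ^+ 4 / d%:R ^+ 2 + B ^+ 4 / d%:R) +
    (6 * k%:R * B ^+ 4 / d%:R ^+ 2 + B ^+ 4 / d%:R) =
    k.+1%:R * (6 * k%:R * B ^+ 4 / d%:R ^+ 2 + B ^+ 4 / d%:R).
  by rewrite -natr1; ring.
rewrite ler_wpM2l// lerD2r.
have kS (x : R) : 6 * x * B ^+ 4 / d%:R ^+ 2 = 6 * B ^+ 4 / d%:R ^+ 2 * x by field.
rewrite !kS ler_wpM2l ?ler_nat ?leqnSn// divr_ge0 ?exprn_ge0// mulr_ge0// exprn_ge0//.
Qed.

Lemma mean_r_tang4 k : mean P (fun w => (g (r k w) * tang g k w) ^+ 4) <=
  B ^+ 8 * k%:R * (6 * k%:R / d%:R ^+ 2 + d%:R^-1).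
Proof.
have kk : (k <= k <= k.+1)%N by rewrite leqnn leqnSn.
have pXa a : past k.+1 k (fun w => partial g k a w ^+ 4).
  by apply: measurable_funX; exact: past_partial.
have iXa a : integ P (fun w => partial g k a w ^+ 4).
  apply: bnd_integ; first exact: (past_measurable (pXa a)).
  by apply: bndX; exact: bnd_partial.
have step a := mean_past_step a (ltnSn k) (pXa a) (iXa a) (measurable_funX 4 mg) (integ_gX 4).
rewrite (@eq_mean _ _ _ _ _ (fun w => \sum_(a < d) partial g k a w ^+ 4 *
    (g (r k w) ^+ 4 * ind k a w))); last first.
  by move=> w; rewrite exprMn sum_ind_expr mulr_sumr; apply: eq_bigr => a _; ring.
rewrite mean_sum; last by move=> a; have [] := step a.
have m4 : mean P (fun w => g (r 0%N w) ^+ 4) <= B ^+ 4.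
  apply: mean_le_cst => // w; rewrite (_ : 4%N = (2 * 2)%N)// !exprM.
  by rewrite lerXn2r ?nnegrE ?sqr_ge0.
have m40 : 0 <= mean P (fun w => g (r 0%N w) ^+ 4).
  by apply: mean_ge0 => w; rewrite (_ : 4%N = (2 * 2)%N)// exprM sqr_ge0.
pose b := k%:R * (6 * k%:R * B ^+ 4 / d%:R ^+ 2 + B ^+ 4 / d%:R) * (B ^+ 4 / d%:R).
apply: (@le_trans _ _ (\sum_(a < d) b)).
  apply: ler_sum => a _; have [_ ->] := step a.
  apply: ler_pM => //; last 2 first.
  - exact: mean_partial4.
  - by rewrite ler_wpM2r ?invr_ge0.
  - by apply: mean_ge0 => w; rewrite (_ : 4%N = (2 * 2)%N)// exprM sqr_ge0.
  - by rewrite divr_ge0.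
rewrite sumr_const card_ord -[_ *+ d]mulr_natl le_eqVlt; apply/orP; left; apply/eqP.
by rewrite /b; field.
Qed.

(** * Gaussian comparison of the cross term *)

Section lindeberg.
Context (n : nat) (n_gt0 : (0 < n)%N).

Local Notation s := (Num.sqrt (2 * n%:R ^+ 2 / d%:R) : R).

Let n0 : 0 < n%:R :> R. Proof. by rewrite ltr0n. Qed.

Let d0 : 0 < d%:R :> R. Proof. by rewrite ltr0n. Qed.

Let s0 : 0 < s.
Proof. by rewrite sqrtr_gt0 divr_gt0// mulr_gt0// exprn_gt0. Qed.

Let s_sqr : s ^+ 2 = 2 * n%:R ^+ 2 / d%:R.
Proof. by rewrite sqr_sqrtr// divr_ge0// mulr_ge0// exprn_ge0. Qed.

(** Error of one step in units of C/n. The weight [k] and its inverse come from Young's inequality,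
    applied to [drift] (terms B^2/2 and B^6) and to the cubic remainder (terms 2 B^4 and 4 B^8). The
    last two terms are the variance defect of the truncation and the half step in j + 1/2. *)
Definition lindeberg_error (k : R) : R :=
  k * (B ^+ 2 / 2 + 2 * B ^+ 4) +
  k^-1 * (B ^+ 6 * (4 / d%:R + n%:R^-1) + 4 * B ^+ 8 * (6 / n%:R + d%:R / n%:R ^+ 2)) +
  `|s2 ^+ 2 - 1| + (2 * n%:R)^-1.

(* 2 (j + 1/2) / n^2 is the increment of (j/n)^2, while the conditional variance of
   the j-th increment of cross / s is close to 2 j / n^2. *)
Lemma lindeberg_step C p p1 p2 j (k : R) : taylor3 C p p1 p2 -> (j < n)%N -> 0 < k ->
  `|mean P (fun w => p (cross g j.+1 w / s)) - mean P (fun w => p (cross g j w / s)) -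
    (j%:R + 2^-1) / n%:R ^+ 2 * mean P (fun w => p2 (cross g j w / s))| <=
  C / n%:R * lindeberg_error k.
Proof.
move=> tp jn k0.
have C0 : 0 <= C by rewrite (le_trans _ (t3_bnd tp 0)).
have jj : (j <= j <= n)%N by rewrite leqnn ltnW.
have jnR : j%:R <= n%:R :> R by rewrite ler_nat ltnW.
pose M w := cross g j w / s; pose W w := g (r j w) * tang g j w.
pose D w := 2 / s * W w.
have pM : past n j M by apply: measurable_funM => //; exact: past_cross.
have pf (f : R -> R) (c : R) : (forall x y, `|f x - f y| <= c * `|x - y|) ->
    past n j (fun w => f (M w)).
  move=> fc; apply: (measurableT_comp _ pM).
  by apply: continuous_measurable_fun; exact: lipschitz_continuous_fun fc.
have pp := pf _ _ (t3_lip tp); have pp1 := pf _ _ (t3_lip1 tp); have pp2 := pf _ _ (t3_lip2 tp).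
have bp : bnd (fun w => p (M w)) by exists C => w; exact: t3_bnd tp _.
have bp1 : bnd (fun w => p1 (M w)) by exists C => w; exact: t3_bnd1 tp _.
have bp2 : bnd (fun w => p2 (M w)) by exists C => w; exact: t3_bnd2 tp _.
have mp := past_measurable pp; have mp1 := past_measurable pp1.
have mp2 := past_measurable pp2.
have mW : measurable_fun [set: T] W := measurable_r_tang j.
have bW : bnd W := bnd_r_tang j.
have mD : measurable_fun [set: T] D by exact: measurable_funM.
have bD : bnd D by apply: bndM => //; exact: bnd_cst.
have mpD : measurable_fun [set: T] (fun w => p (M w + D w)).
  apply: (measurableT_comp (f := p)).
    by apply: continuous_measurable_fun; exact: lipschitz_continuous_fun (t3_lip tp).
  by apply: measurable_funD => //; exact: (past_measurable pM).
have ip := bnd_integ mp bp; have ip2 := bnd_integ mp2 bp2.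
have ipD : integ P (fun w => p (M w + D w)).
  by apply: bnd_integ => //; exists C => w; exact: t3_bnd tp _.
have i1 : integ P (fun w => p1 (M w) * D w).
  by apply: bnd_integ; [exact: measurable_funM|exact: bndM].
have mD2 : measurable_fun [set: T] (fun w => D w ^+ 2 / 2).
  by apply: measurable_funM => //; exact: measurable_funX.
have i2 : integ P (fun w => p2 (M w) * (D w ^+ 2 / 2)).
  apply: bnd_integ; first exact: measurable_funM.
  by apply: bndM => //; apply: bndM; [exact: bndX|exact: bnd_cst].
have iD n' : integ P (fun w => D w ^+ n').
  by apply: bnd_integ; [exact: measurable_funX|exact: bndX].
have -> : mean P (fun w => p (cross g j.+1 w / s)) = mean P (fun w => p (M w + D w)).
  apply: eq_mean => w; rewrite crossS; congr p; rewrite /M /D -/(W w).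
  by rewrite mulrDl; congr (_ + _); rewrite mulrAC.
rewrite -/(M _).
have mean1 : mean P (fun w => p1 (M w) * D w) = 0.
  rewrite (@eq_mean _ _ _ _ _ (fun w => 2 / s * (p1 (M w) * W w))); last first.
    by move=> w; rewrite /D mulrCA.
  rewrite meanZ; last by apply: bnd_integ; [exact: measurable_funM|exact: bndM].
  by rewrite (mean_past_r_tang jn pp1 bp1) mulr0.
have mdrift := past_measurable (past_drift jj).
have i2d : integ P (fun w => p2 (M w) * drift j w).
  by apply: bnd_integ; [exact: measurable_funM|apply: bndM => //; exact: bnd_drift].
have mean2 : mean P (fun w => p2 (M w) * (D w ^+ 2 / 2)) =
    s2 / n%:R ^+ 2 * mean P (fun w => p2 (M w) * drift j w) +
    j%:R * s2 ^+ 2 / n%:R ^+ 2 * mean P (fun w => p2 (M w)).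
  rewrite (@eq_mean _ _ _ _ _ (fun w => 2 / s ^+ 2 * (p2 (M w) * W w ^+ 2))); last first.
    by move=> w; rewrite /D; field; rewrite gt_eqF.
  rewrite meanZ; last first.
    by apply: bnd_integ; [apply: measurable_funM => //; exact: measurable_funX|
      apply: bndM => //; exact: bndX].
  rewrite (mean_r_tang_sqr jn pp2 bp2).
  rewrite [X in _ * (_ * X)](_ : _ =
      mean P (fun w => p2 (M w) * drift j w) + j%:R * s2 * mean P (fun w => p2 (M w))).
    by rewrite s_sqr; field; rewrite (gt_eqF n0).
  rewrite -meanZ// -meanD//; last exact: integZ.
  by apply: eq_mean => w; rewrite /drift; ring.
pose rem w := p (M w + D w) - p (M w) - p1 (M w) * D w - p2 (M w) * (D w ^+ 2 / 2).
have irem : integ P rem by apply: integB => //; apply: integB => //; exact: integB.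
have mean_rem : mean P rem = mean P (fun w => p (M w + D w)) - mean P (fun w => p (M w)) -
    mean P (fun w => p2 (M w) * (D w ^+ 2 / 2)).
  rewrite /rem meanB; [|by apply: integB => //; exact: integB|by []].
  by rewrite meanB ?meanB ?mean1 ?subr0//; exact: integB.
(* Three sources of error: the Taylor remainder, the fluctuation of the conditional variance, and
   the mismatch between j s2^2 and j + 1/2. *)
have -> : mean P (fun w => p (M w + D w)) - mean P (fun w => p (M w)) -
    (j%:R + 2^-1) / n%:R ^+ 2 * mean P (fun w => p2 (M w)) =
    mean P rem + s2 / n%:R ^+ 2 * mean P (fun w => p2 (M w) * drift j w) +
    (j%:R * (s2 ^+ 2 - 1) - 2^-1) / n%:R ^+ 2 * mean P (fun w => p2 (M w)).
  by rewrite mean_rem mean2; field; rewrite gt_eqF.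
have s4 : s2 ^+ 2 <= B ^+ 4.
  by rewrite B4 lerXn2r ?nnegrE ?var_ge0 ?var_le// exprn_ge0.
have nV : 0 <= n%:R^-1 :> R by rewrite invr_ge0.
have nV2 : 0 <= (n%:R ^+ 2)^-1 :> R by rewrite invr_ge0 exprn_ge0.
have D2 : mean P (fun w => D w ^+ 2) <= 2 * B ^+ 4 / n%:R.
  rewrite (@eq_mean _ _ _ _ _ (fun w => (2 / s) ^+ 2 * W w ^+ 2)); last first.
    by move=> w; rewrite exprMn.
  rewrite meanZ; last by apply: bnd_integ; [exact: measurable_funX|exact: bndX].
  rewrite mean_r_tang_sqr1 exprMn exprVn s_sqr.
  rewrite [leLHS](_ : _ = 2 * (j%:R / n%:R) * s2 ^+ 2 / n%:R); last by field; rewrite (gt_eqF n0).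
  rewrite ler_wpM2r// -mulrA ler_wpM2l//.
  rewrite -[leRHS]mul1r ler_pM ?sqr_ge0 ?divr_ge0//.
  by rewrite ler_pdivrMr// mul1r.
have D4 : mean P (fun w => D w ^+ 4) <= 4 * B ^+ 8 * (6 / n%:R + d%:R / n%:R ^+ 2) / n%:R.
  rewrite (@eq_mean _ _ _ _ _ (fun w => (2 / s) ^+ 4 * W w ^+ 4)); last first.
    by move=> w; rewrite exprMn.
  rewrite meanZ; last by apply: bnd_integ; [exact: measurable_funX|exact: bndX].
  have s4E : (2 / s) ^+ 4 = 4 * d%:R ^+ 2 / n%:R ^+ 4.
    rewrite (_ : (2 / s) ^+ 4 = 16 / (s ^+ 2) ^+ 2); last by field; rewrite gt_eqF.
    by rewrite s_sqr; field; rewrite (gt_eqF n0).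
  have s4p : 0 <= (2 / s) ^+ 4 by rewrite s4E divr_ge0 ?mulr_ge0 ?exprn_ge0.
  apply: (le_trans (ler_wpM2l s4p (mean_r_tang4 j))).
  apply: (@le_trans _ _ ((2 / s) ^+ 4 * (B ^+ 8 * n%:R * (6 * n%:R / d%:R ^+ 2 + d%:R^-1)))).
    apply: ler_wpM2l => //; apply: ler_pM.
    - by apply: mulr_ge0 => //; exact: exprn_ge0.
    - by rewrite addr_ge0 ?invr_ge0// divr_ge0 ?mulr_ge0 ?exprn_ge0.
    - by apply: ler_wpM2l => //; exact: exprn_ge0.
    - by rewrite lerD2r ler_wpM2r ?invr_ge0 ?exprn_ge0// ler_wpM2l.
  rewrite s4E le_eqVlt; apply/orP; left; apply/eqP; field.
  by rewrite (gt_eqF n0).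
have R1 : `|mean P rem| <= C * (k * (2 * B ^+ 4 / n%:R) +
    4 * B ^+ 8 * (6 / n%:R + d%:R / n%:R ^+ 2) / n%:R / k).
  apply: (@le_trans _ _ (mean P (fun w => C * (k * D w ^+ 2 + k^-1 * D w ^+ 4)))).
    rewrite (le_trans (mean_norm_le irem))//; apply: mean_le; first exact: integ_norm.
      by apply: integZ; apply: integD; exact: integZ.
    move=> w; rewrite (le_trans (t3_taylor tp _ _))// ler_wpM2l//.
    by rewrite (le_trans (norm_cube_le _ k0))// [k^-1 * _]mulrC.
  rewrite meanZ; last by apply: integD; exact: integZ.
  rewrite ler_wpM2l// meanD; [|exact: integZ|exact: integZ].
  rewrite !meanZ// [k^-1 * _]mulrC; apply: lerD; first by apply: ler_wpM2l => //; exact: ltW.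
  by rewrite ler_wpM2r// invr_ge0 ltW.
have R2 : `|s2 / n%:R ^+ 2 * mean P (fun w => p2 (M w) * drift j w)| <=
    C * (k * (B ^+ 2 / 2) / n%:R + k^-1 * (B ^+ 6 * (4 / d%:R + n%:R^-1)) / n%:R).
  have sd := bnd_sqint mdrift (bnd_drift j).
  have id := integ_norm (sqint_integ sd).
  (* The weight k n is matched to the factor 1/n^2 in front: both halves of the resulting bound then
     carry a factor 1/n. *)
  have kn0 : 0 < k * n%:R by rewrite mulr_gt0.
  have h1 : `|mean P (fun w => p2 (M w) * drift j w)| <=
      C * ((k * n%:R + n%:R * (8 * B ^+ 4 * n%:R / d%:R + 2 * B ^+ 4) / (k * n%:R)) / 2).
    apply: (@le_trans _ _ (C * mean P (fun w => `|drift j w|))).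
      rewrite -meanZ// (le_trans (mean_norm_le i2d))//; apply: mean_le; [exact: integ_norm|exact: integZ|].
      by move=> w; rewrite normrM ler_wpM2r// (t3_bnd2 tp).
    rewrite ler_wpM2l// (le_trans (mean_norm_le_sqr kn0 sd))// ler_wpM2r//.
    rewrite lerD2l ler_wpM2r ?invr_ge0 ?(ltW kn0)//.
    apply: (le_trans (mean_drift_sqr j)).
    have b4 : 0 <= B ^+ 4 by rewrite exprn_ge0.
    apply: ler_pM => //; first by rewrite addr_ge0 ?divr_ge0 ?mulr_ge0.
    by rewrite lerD2r ler_wpM2r ?invr_ge0// ler_wpM2l// mulr_ge0.
  rewrite normrM ger0_norm; last by rewrite divr_ge0 ?exprn_ge0// var_ge0.
  have h2 : s2 / n%:R ^+ 2 <= B ^+ 2 / n%:R ^+ 2 by rewrite ler_wpM2r// var_le.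
  have h3 : 0 <= s2 / n%:R ^+ 2 by rewrite divr_ge0 ?exprn_ge0// var_ge0.
  apply: (le_trans (ler_pM h3 (normr_ge0 _) h2 h1)).
  rewrite le_eqVlt; apply/orP; left; apply/eqP; field.
  by rewrite d_neq0 (gt_eqF n0) (gt_eqF k0).
have R3 : `|(j%:R * (s2 ^+ 2 - 1) - 2^-1) / n%:R ^+ 2 * mean P (fun w => p2 (M w))| <=
    C * ((`|s2 ^+ 2 - 1| + (2 * n%:R)^-1) / n%:R).
  rewrite mulrC normrM ler_pM//.
    by apply: mean_norm_le_cst => // w; exact: (t3_bnd2 tp).
  rewrite normrM (ger0_norm nV2).
  rewrite (_ : _ / n%:R = (n%:R * `|s2 ^+ 2 - 1| + 2^-1) / n%:R ^+ 2); last first.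
    by field; rewrite gt_eqF.
  rewrite ler_wpM2r// (le_trans (ler_normB _ _))// lerD//.
    by rewrite normrM ger0_norm// ler_wpM2r.
  by rewrite ger0_norm// invr_ge0.
rewrite (le_trans (ler_normD _ _))//.
apply: (le_trans (lerD (ler_normD _ _) (lexx _))).
apply: (le_trans (lerD (lerD R1 R2) R3)).
by rewrite le_eqVlt; apply/orP; left; apply/eqP; rewrite /lindeberg_error; field; rewrite ?d_neq0 ?(gt_eqF n0) ?(gt_eqF k0).
Qed.

Lemma clt_bound C h h1 h2 (k : R) : taylor3 C h h1 h2 -> 0 < k ->
  `|mean P (fun w => h (cross g n w / s)) - mean (normal_prob 0 1) h| <=
  C * (lindeberg_error k + 2 * k + k^-1 * (4 * normal_m4 R / n%:R)).
Proof.
move=> th k0; have C0 : 0 <= C by rewrite (le_trans _ (t3_bnd th 0)).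
(* Remaining variance and Gaussian increment: a_(j+1)^2 + b_j^2 = a_j^2 with a_0 = 1 and a_n = 0, so
   that [E] below runs from the Gaussian mean at 0 to the mean for the cross term at n. *)
pose a (j : nat) : R := Num.sqrt (1 - j%:R ^+ 2 / n%:R ^+ 2).
pose b (j : nat) : R := Num.sqrt ((2 * j%:R + 1) / n%:R ^+ 2).
have n2 : 0 < n%:R ^+ 2 :> R by rewrite exprn_gt0.
have a_sqr j : (j <= n)%N -> a j ^+ 2 = 1 - j%:R ^+ 2 / n%:R ^+ 2.
  move=> jn; rewrite sqr_sqrtr// subr_ge0 ler_pdivrMr// mul1r.
  by rewrite lerXn2r ?nnegrE// ler_nat.
have b_sqr j : b j ^+ 2 = (2 * j%:R + 1) / n%:R ^+ 2.
  by rewrite sqr_sqrtr// divr_ge0 ?ltW// addr_ge0// mulr_ge0.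
have b_gt0 j : 0 < b j by rewrite sqrtr_gt0 divr_gt0// ltr_wpDl// mulr_ge0.
have aS j : (j < n)%N -> Num.sqrt (a j.+1 ^+ 2 + b j ^+ 2) = a j.
  move=> jn; rewrite /a a_sqr// b_sqr -natr1; congr Num.sqrt; field.
  by rewrite gt_eqF.
pose E j := mean P (fun w => gauss_avg (a j) h (cross g j w / s)).
pose err := C / n%:R * (lindeberg_error k + 2 * k + k^-1 * (4 * normal_m4 R / n%:R)).
have m40 : 0 <= normal_m4 R.
  by apply: mean_ge0 => u; rewrite (_ : 4%N = (2 * 2)%N)// exprM sqr_ge0.
have step j : (j < n)%N -> `|E j.+1 - E j| <= err.
  move=> jn; have tq := taylor3_gauss_avg (a j.+1) th.
  have L := lindeberg_step tq jn k0.
  have mM : measurable_fun [set: T] (fun w => cross g j w / s).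
    by apply: measurable_funM => //; exact: measurable_cross.
  pose q := gauss_avg (a j.+1) h; pose q2 := gauss_avg (a j.+1) h2.
  have cq := lipschitz_continuous_fun (t3_lip tq).
  have cq2 := lipschitz_continuous_fun (t3_lip2 tq).
  have tj := taylor3_gauss_avg (a j) th.
  have cj := lipschitz_continuous_fun (t3_lip tj).
  have iq := integ_comp P cq (t3_bnd tq) mM.
  have iq2 := integ_comp P cq2 (t3_bnd2 tq) mM.
  have ij := integ_comp P cj (t3_bnd tj) mM.
  have bn : b j ^+ 2 <= 2 / n%:R.
    rewrite b_sqr (_ : 2 / n%:R = 2 * n%:R / n%:R ^+ 2); last by field; rewrite gt_eqF.
    rewrite ler_wpM2r ?invr_ge0 ?(ltW n2)//.
    have : j.+1%:R <= n%:R :> R by rewrite ler_nat.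
    by rewrite -natr1; lra.
  have G : `|E j - mean P (fun w => q (cross g j w / s)) -
      (j%:R + 2^-1) / n%:R ^+ 2 * mean P (fun w => q2 (cross g j w / s))| <=
      C / n%:R * (2 * k + k^-1 * (4 * normal_m4 R / n%:R)).
    rewrite /E -meanZ// -meanB// -meanB//; [|exact: integB|exact: integZ].
    apply: mean_norm_le_cst; first by apply: integB; [exact: integB|exact: integZ].
    move=> w; have := gauss_avg_step (cross g j w / s) th k0 (sqrtr_ge0 _ : 0 <= a j.+1) (b_gt0 j).
    rewrite aS// (_ : b j ^+ 2 / 2 = (j%:R + 2^-1) / n%:R ^+ 2); last first.
      by rewrite b_sqr; field; rewrite gt_eqF.
    move=> /le_trans; apply; rewrite -[leRHS]mulrA ler_wpM2l//.
    rewrite (_ : n%:R^-1 * (2 * k + k^-1 * (4 * normal_m4 R / n%:R)) =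
      k * (2 / n%:R) + (2 / n%:R) ^+ 2 * normal_m4 R / k); last first.
      by field; rewrite (gt_eqF n0) (gt_eqF k0).
    apply: lerD; first by rewrite ler_wpM2l// ltW.
    rewrite ler_wpM2r ?invr_ge0 ?(ltW k0)// ler_wpM2r// (_ : b j ^+ 4 = (b j ^+ 2) ^+ 2).
      by rewrite lerXn2r ?nnegrE ?sqr_ge0// divr_ge0.
    by rewrite -exprM.
  (* The walk step and the Gaussian step are expanded around the same value and have the same second
     order term, so only the two remainders are left. *)
  have split_diff (x y z t : R) : x - y = (x - z - t) - (y - z - t) by ring.
  rewrite (split_diff _ _ (mean P (fun w => q (cross g j w / s)))
    ((j%:R + 2^-1) / n%:R ^+ 2 * mean P (fun w => q2 (cross g j w / s)))).
  rewrite (le_trans (ler_normB _ _))// (le_trans (lerD L G))// -mulrDr.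
  by rewrite /err !addrA.
have En : E n = mean P (fun w => h (cross g n w / s)).
  rewrite /E /a divff ?gt_eqF// subrr sqrtr0; apply: eq_mean => w.
  rewrite /gauss_avg (@eq_mean _ _ _ _ _ (fun=> h (cross g n w / s))) ?mean_cst// => u.
  by rewrite mul0r addr0.
have E0 : E 0%N = mean (normal_prob 0 1) h.
  rewrite /E /a expr0n mul0r subr0 sqrtr1 (@eq_mean _ _ _ _ _ (fun=> mean (normal_prob 0 1) h)).
    by rewrite mean_cst.
  by move=> w; rewrite cross0 mul0r; apply: eq_mean => u; rewrite add0r mul1r.
have tele j : (j <= n)%N -> `|E j - E 0%N| <= j%:R * err.
  elim: j => [|j IH] jn; first by rewrite subrr normr0 mul0r.
  rewrite -(subrKA (E j)) (le_trans (ler_normD _ _))// -natr1 mulrDl mul1r addrC lerD//.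
    exact: IH (ltnW jn).
  exact: step.
rewrite -En -E0 (le_trans (tele n (leqnn n)))// le_eqVlt; apply/orP; left; apply/eqP.
by rewrite /err; field; rewrite ?d_neq0 ?(gt_eqF n0) ?(gt_eqF k0).
Qed.

End lindeberg.

End bounded_increments.

End walk_moments.

(** * Growth of the norming sequence *)

Section characteristic_function.
Context (R : realType).

Lemma cos_bound (x : R) : `|cos x| <= 1.
Proof. by rewrite ler_norml cos_geN1 cos_le1. Qed.

Lemma sin_bound (x : R) : `|sin x| <= 1.
Proof. by rewrite ler_norml sin_geN1 sin_le1. Qed.

Lemma cos_lipschitz (x y : R) : `|cos x - cos y| <= `|x - y|.
Proof.
rewrite -[leRHS]mul1r; apply: (@derive_bound _ cos (fun z => - sin z) _ _ _ (@is_derive_cos R)) => t _.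
by rewrite normrN sin_bound.
Qed.

Lemma sin_lipschitz (x y : R) : `|sin x - sin y| <= `|x - y|.
Proof.
rewrite -[leRHS]mul1r; apply: (@derive_bound _ sin cos _ _ _ (@is_derive_sin R)) => t _.
by rewrite cos_bound.
Qed.

Lemma one_sub_cos_le (x : R) : 1 - cos x <= 2 * cap x.
Proof.
have := cos_lipschitz 0 x; have := cos_bound x.
rewrite cos0 sub0r normrN !ler_norml => /andP[h1 h2] /andP[h3 h4].
rewrite /cap; case: (leP 1 `|x|) => hx; last by have := normr_ge0 x; lra.
by lra.
Qed.

Lemma sin_sub_le (x : R) : `|sin x - x| <= `|x| ^+ 2.
Proof.
have sd (z : R) : is_derive z 1 (fun t => sin t - t) (cos z - 1).
  by have ? := is_derive_sin z; apply: is_derive_eq.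
have := @derive_bound _ _ _ 0 x `|x| sd.
rewrite sin0 !subr0 expr2; apply => t.
by rewrite subr0 => tx; rewrite -cos0 (le_trans (cos_lipschitz _ _))// subr0.
Qed.

Context d (T : measurableType d) (P : probability T R).

Implicit Types (X Y : T -> R) (t : R).

(** Squared modulus of the characteristic function, in real terms: it is multiplicative over
    independent sums and never exceeds 1. *)
Definition chf_sqr (X : T -> R) t :=
  mean P (fun w => cos (t * X w)) ^+ 2 + mean P (fun w => sin (t * X w)) ^+ 2.

Lemma integ_cos X t : measurable_fun [set: T] X -> integ P (fun w => cos (t * X w)).
Proof.
move=> mX; apply: (integ_comp P (f := fun x => cos (t * x)) (B := 1)) => //; last first.
  by move=> x; exact: cos_bound.
apply: (@lipschitz_continuous_fun _ `|t|) => x y.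
by rewrite (le_trans (cos_lipschitz _ _))// -mulrBr normrM.
Qed.

Lemma integ_sin X t : measurable_fun [set: T] X -> integ P (fun w => sin (t * X w)).
Proof.
move=> mX; apply: (integ_comp P (f := fun x => sin (t * x)) (B := 1)) => //; last first.
  by move=> x; exact: sin_bound.
apply: (@lipschitz_continuous_fun _ `|t|) => x y.
by rewrite (le_trans (sin_lipschitz _ _))// -mulrBr normrM.
Qed.

Lemma mean_sqr_sub (X : T -> R) : sqint P X ->
  mean P (fun w => (X w - mean P X) ^+ 2) = mean P (fun w => X w ^+ 2) - mean P X ^+ 2.
Proof.
move=> sX; have iX := sqint_integ sX; have [mX iX2] := sX; set m := mean P X.
rewrite (@eq_mean _ _ _ _ _ (fun w => X w ^+ 2 - (2 * m * X w - m ^+ 2))); last first.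
  by move=> w; ring.
have i1 := integZ (2 * m) iX; have i2 : integ P (fun=> m ^+ 2) := integ_cst P (m ^+ 2).
rewrite (meanB iX2 (integB i1 i2)) (meanB i1 i2) (meanZ _ iX) mean_cst -/m.
by ring.
Qed.

Lemma sqint_cos X t : measurable_fun [set: T] X -> sqint P (fun w => cos (t * X w)).
Proof.
move=> mX; apply: (@sqint_bounded _ _ _ _ 1) => [|w]; last exact: cos_bound.
exact: integ_measurable (integ_cos t mX).
Qed.

Lemma sqint_sin X t : measurable_fun [set: T] X -> sqint P (fun w => sin (t * X w)).
Proof.
move=> mX; apply: (@sqint_bounded _ _ _ _ 1) => [|w]; last exact: sin_bound.
exact: integ_measurable (integ_sin t mX).
Qed.

(** As cos^2 + sin^2 = 1, the defect is the sum of the variances of cos(tX) and sin(tX). This gives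
    the bound by 1 and makes both variables constant when it is attained. *)
Lemma chf_sqr_defect X t : measurable_fun [set: T] X ->
  1 - chf_sqr X t =
  mean P (fun w => (cos (t * X w) - mean P (fun w => cos (t * X w))) ^+ 2) +
  mean P (fun w => (sin (t * X w) - mean P (fun w => sin (t * X w))) ^+ 2).
Proof.
move=> mX; have sc := sqint_cos t mX; have ss := sqint_sin t mX.
rewrite (mean_sqr_sub sc) (mean_sqr_sub ss) /chf_sqr.
have : mean P (fun w => cos (t * X w) ^+ 2) + mean P (fun w => sin (t * X w) ^+ 2) = 1.
  rewrite -meanD; [|by case: sc|by case: ss].
  by rewrite -[RHS](mean_cst P); apply: eq_mean => w; rewrite cos2Dsin2.
by move=> <-; ring.
Qed.

Lemma chf_sqr_le1 X t : measurable_fun [set: T] X -> chf_sqr X t <= 1.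
Proof.
move=> mX; rewrite -subr_ge0 chf_sqr_defect//.
by rewrite addr_ge0// mean_ge0// => w; exact: sqr_ge0.
Qed.

Lemma chf_sqr_ge0 X t : 0 <= chf_sqr X t.
Proof. by rewrite addr_ge0 ?sqr_ge0. Qed.

Lemma chf_sqr_indep X Y t : measurable_fun [set: T] X -> measurable_fun [set: T] Y ->
  independent P (sigma_rv X) (sigma_rv Y) ->
  chf_sqr (fun w => X w + Y w) t = chf_sqr X t * chf_sqr Y t.
Proof.
move=> mX mY XY.
have mul (f g : R -> R) : continuous f -> continuous g ->
    integ P (fun w => f (X w)) -> integ P (fun w => g (Y w)) ->
    integ P (fun w => f (X w) * g (Y w)) /\
    mean P (fun w => f (X w) * g (Y w)) = mean P (fun w => f (X w)) * mean P (fun w => g (Y w)).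
  move=> cf cg iX iY; apply: indep_mean_mul => // A B fA gB; apply: XY.
    exact: (sigma_rv_comp (continuous_measurable_fun cf) fA).
  exact: (sigma_rv_comp (continuous_measurable_fun cg) gB).
have cc : continuous (fun x : R => cos (t * x)).
  apply: (@lipschitz_continuous_fun _ `|t|) => x y.
  by rewrite (le_trans (cos_lipschitz _ _))// -mulrBr normrM.
have cs : continuous (fun x : R => sin (t * x)).
  apply: (@lipschitz_continuous_fun _ `|t|) => x y.
  by rewrite (le_trans (sin_lipschitz _ _))// -mulrBr normrM.
have [icc ecc] := mul _ _ cc cc (integ_cos t mX) (integ_cos t mY).
have [ics ecs] := mul _ _ cc cs (integ_cos t mX) (integ_sin t mY).
have [isc esc] := mul _ _ cs cc (integ_sin t mX) (integ_cos t mY).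
have [iss ess] := mul _ _ cs cs (integ_sin t mX) (integ_sin t mY).
rewrite /chf_sqr.
rewrite (@eq_mean _ _ _ _ (fun w => cos (t * (X w + Y w))) (fun w =>
  cos (t * X w) * cos (t * Y w) - sin (t * X w) * sin (t * Y w))); last first.
  by move=> w; rewrite mulrDr cosD.
rewrite (@eq_mean _ _ _ _ (fun w => sin (t * (X w + Y w))) (fun w =>
  sin (t * X w) * cos (t * Y w) + cos (t * X w) * sin (t * Y w))); last first.
  by move=> w; rewrite mulrDr sinD.
rewrite (meanB icc iss) (meanD isc ics) ecc ecs esc ess.
by move: (mean _ _) (mean _ _) (mean _ _) (mean _ _) => a b c e; ring.
Qed.

Lemma mean_sqr_eq0 (X : T -> R) : measurable_fun [set: T] X ->
  integ P (fun w => X w ^+ 2) -> mean P (fun w => X w ^+ 2) = 0 ->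
  \forall w \ae P, X w = 0.
Proof.
move=> mX iX X0.
have : (\int[P]_w `|(X w ^+ 2)%:E| = 0)%E.
  under eq_integral => w _ do rewrite /= ger0_norm ?sqr_ge0//.
  have := congr1 EFin X0; rewrite /mean /Rintegral fineK//.
  exact: integrable_fin_num.
have mX2 : measurable_fun [set: T] (fun w => (X w ^+ 2)%:E).
  by apply/measurable_EFinP; exact: measurable_funX.
move/(ae_eq_integral_abs P measurableT mX2).
by apply: filterS => w /(_ I) /= [] /eqP; rewrite sqrf_eq0 => /eqP.
Qed.

(* If the modulus of the characteristic function is identically 1, then sin(tX) is a.s. constant
   for all t, hence so is X, the limit of (k+1) sin(X/(k+1)). *)
Lemma nondegenerate_chf X : measurable_fun [set: T] X ->
  (forall c, P [set w | X w = c] <> 1%E) -> exists t, chf_sqr X t < 1.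
Proof.
move=> mX ndX; apply: contrapT => nlt.
have one t : chf_sqr X t = 1.
  apply/eqP; rewrite eq_le chf_sqr_le1//= leNgt; apply/negP => lt1.
  by apply: nlt; exists t.
pose s (k : nat) := mean P (fun w => sin (k.+1%:R^-1 * X w)).
have ae_s : \forall w \ae P, forall k : nat, sin (k.+1%:R^-1 * X w) = s k.
  apply/ae_foralln => k.
  have ss := sqint_sin k.+1%:R^-1 mX.
  have sB : sqint P (fun w => sin (k.+1%:R^-1 * X w) - s k).
    by apply: sqintB => //; exact: sqint_cst.
  have s0 : mean P (fun w => (sin (k.+1%:R^-1 * X w) - s k) ^+ 2) = 0.
    have := chf_sqr_defect k.+1%:R^-1 mX; rewrite one subrr -/(s k) => /esym/eqP.
    rewrite paddr_eq0; try (by apply: mean_ge0 => w; exact: sqr_ge0).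
    by move=> /andP[_ /eqP].
  have [mB iB2] := sB.
  by apply: filterS (mean_sqr_eq0 mB iB2 s0) => w /eqP; rewrite subr_eq0 => /eqP.
have X_eq w w' : (forall k : nat, sin (k.+1%:R^-1 * X w) = s k) ->
    (forall k : nat, sin (k.+1%:R^-1 * X w') = s k) -> X w = X w'.
  move=> hw hw'; apply/eqP; rewrite -subr_eq0 -normr_le0; apply/ler_addgt0Pr => e e0.
  rewrite add0r; pose q := X w ^+ 2 + X w' ^+ 2.
  have q0 : 0 <= q by rewrite addr_ge0 ?sqr_ge0.
  (* The quadratic error of the sine at X/(k+1), divided by 1/(k+1), is at most q/(k+1), which is
     below e for this k. *)
  pose k := Num.bound (q / e).
  have qk : q / e < k.+1%:R.
    by rewrite (lt_trans (archi_boundP _))// ?divr_ge0 ?(ltW e0)// ltr_nat.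
  have k0 : 0 < k.+1%:R^-1 :> R by rewrite invr_gt0.
  have h1 := sin_sub_le (k.+1%:R^-1 * X w); have h2 := sin_sub_le (k.+1%:R^-1 * X w').
  rewrite hw normrM (gtr0_norm k0) in h1; rewrite hw' normrM (gtr0_norm k0) in h2.
  have h3 : `|k.+1%:R^-1 * X w - k.+1%:R^-1 * X w'| <= k.+1%:R^-1 ^+ 2 * q.
    rewrite (_ : _ - _ = (s k - k.+1%:R^-1 * X w') - (s k - k.+1%:R^-1 * X w)); last by ring.
    rewrite (le_trans (ler_normB _ _))// (le_trans (lerD h2 h1))// !exprMn !real_normK ?num_real//.
    by rewrite -mulrDr addrC.
  rewrite -mulrBr normrM (gtr0_norm k0) expr2 -mulrA ler_pM2l// in h3.
  rewrite (le_trans h3)// ler_pdivrMl// -ler_pdivrMr//; exact: ltW.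
have [N [mN PN hN]] := ae_s.
have NT : exists w, ~ N w.
  apply: contrapT => /forallNP allN.
  have : P [set: T] = 0%E.
    by rewrite (_ : [set: T] = N)//; apply/seteqP; split => // w _; apply: contrapT; exact: allN.
  by rewrite probability_setT => /eqP; rewrite onee_eq0.
have [w0 Nw0] := NT.
have hw0 : forall k : nat, sin (k.+1%:R^-1 * X w0) = s k.
  by apply: contrapT => h; apply: Nw0; exact: hN.
apply: (ndX (X w0)).
have mE : measurable [set w | X w = X w0].
  rewrite (_ : [set w | _] = X @^-1` [set X w0]); last by [].
  by rewrite -[Y in measurable Y]setTI; exact: mX.
apply/eqP; rewrite eq_le probability_le1//=.
have -> : 1%E = P (~` N).
  by rewrite probability_setC// PN sube0.
apply: le_measure; rewrite ?inE//; first exact: measurableC.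
move=> w Nw; apply: X_eq => //; apply: contrapT => h; apply: Nw; exact: hN.
Qed.

End characteristic_function.

(** * Growth bounds deduced from the limit theorem *)

Section norming.
Context (R : realType) dT (T : measurableType dT) (P : probability T R).
Context (r : nat -> {RV P >-> R}) (r_indep : mutually_independent P (fun i => sigma_rv (r i))).
Context dZ (Z : measurableType dZ) (PZ : probability Z R) (zeta : {RV PZ >-> R}).
Context (zeta_nd : forall c, distribution PZ zeta [set c] != 1%E).
Context (a : nat -> R) (a_gt0 : forall m, (0 < m)%N -> 0 < a m).
Context (a_cvg : cvg_in_law P (fun m w => (\sum_(i < m) r i w ^+ 2 - m%:R) / a m) PZ zeta).

Definition sumsq m w := \sum_(i < m) r i w ^+ 2 - m%:R.

Lemma measurable_sumsq m : measurable_fun [set: T] (sumsq m).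
Proof.
by apply: measurable_funB => //; apply: measurable_sum => i; exact: measurable_funX.
Qed.

Lemma chf_sumsq_anti M m t : (M <= m)%N ->
  chf_sqr P (sumsq m) t <= chf_sqr P (sumsq M) t.
Proof.
move=> Mm.
(* Both sums are padded with zeros up to m, so that they are measurable for complementary blocks
   with the same horizon; the factor coming from [Y] is at most 1. *)
pose X w := \sum_(i < m) (if (i < M)%N then r i w ^+ 2 - 1 else 0).
pose Y w := \sum_(i < m) (if (i < M)%N then 0 else r i w ^+ 2 - 1).
have sumE k w : sumsq k w = \sum_(i < k) (r i w ^+ 2 - 1).
  by rewrite /sumsq big_split/= sumrN sumr_const card_ord.
have -> : sumsq m = fun w => X w + Y w.
  apply/funext => w; rewrite sumE -big_split/=; apply: eq_bigr => i _.
  by case: ifP => _; rewrite ?addr0 ?add0r.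
have -> : sumsq M = X.
  apply/funext => w; rewrite sumE /X -big_mkcond/=.
  by rewrite (big_ord_widen m (fun i => r i w ^+ 2 - 1) Mm).
pose F i := sigma_rv (r i).
have FT i : F i [set: T] by exact: sigma_rv_setT.
have term (J : pred nat) i : (i < m)%N -> J i ->
    measurable_wrt (block F m J) (fun w => r i w ^+ 2 - 1).
  move=> im Ji; apply: (block_measurable_wrt FT im Ji).
  have mf : measurable_fun [set: R] (fun x : R => x ^+ 2 - 1).
    by apply: measurable_funB => //; exact: measurable_funX.
  by move=> A rA; exact: (sigma_rv_comp mf rA).
have pX : measurable_wrt (block F m (fun i => (i < M)%N)) X.
  apply: measurable_sum => i; case iM : (i < M)%N; last exact: measurable_cst.
  exact: term.
have pY : measurable_wrt (block F m (fun i => ~~ (i < M)%N)) Y.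
  apply: measurable_sum => i; case iM : (i < M)%N; first exact: measurable_cst.
  by apply: term => //; rewrite iM.
have mF i : F i `<=` measurable by exact: sigma_rv_measurable.
have mX := measurable_wrt_measurable (@block_measurable _ _ _ mF _ _) pX.
have mY := measurable_wrt_measurable (@block_measurable _ _ _ mF _ _) pY.
rewrite chf_sqr_indep//; last first.
  move=> A B XA YB.
  have FI i : setI_closed (F i) by exact: sigma_rv_setI.
  have bi : independent P <<s block F m (fun i => (i < M)%N) >>
      <<s block F m (fun i => ~~ (i < M)%N) >>.
    by apply: block_independent => // i ->.
  by apply: bi; [exact: (measurable_wrt_sigma_rv pX XA)|exact: (measurable_wrt_sigma_rv pY YB)].
by rewrite ler_piMr ?chf_sqr_ge0// chf_sqr_le1.
Qed.

Let mX m : measurable_fun [set: T] (fun w => (\sum_(i < m) r i w ^+ 2 - m%:R) / a m).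
Proof. by apply: measurable_funM => //; exact: measurable_sumsq. Qed.

Let mzeta : measurable_fun [set: Z] zeta.
Proof. exact: measurable_funPT. Qed.

Lemma chf_scale m t : chf_sqr P (sumsq m) (t / a m) =
  chf_sqr P (fun w => (\sum_(i < m) r i w ^+ 2 - m%:R) / a m) t.
Proof.
by rewrite /chf_sqr; congr (_ ^+ 2 + _ ^+ 2); apply: eq_mean => w;
  rewrite /sumsq mulrAC mulrA.
Qed.

(* Write |phi_X|^2 for [chf_sqr P X]. If a M were much larger than a m for some
   M <= m, then A_m / a M would be small, so |phi_(A_m)(t / a M)| would be close
   to 1; but it is at most |phi_(A_M)(t / a M)|, which stays away from 1. *)
Lemma norming_comparable : exists C : R, 0 < C /\
  exists2 m0, (0 < m0)%N & forall M m, (m0 <= M)%N -> (M <= m)%N -> a M <= C * a m.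
Proof.
have [t chf1] : exists t, chf_sqr PZ zeta t < 1.
  apply: nondegenerate_chf => // c /eqP.
  by have := zeta_nd c => /negP.
(* The limit of the squared modulus at t is 1 - 2 eta. The contradiction will be between a lower
   bound 1 - eta and an upper bound 1 - 3 eta / 2. *)
pose eta := (1 - chf_sqr PZ zeta t) / 2.
have eta0 : 0 < eta by rewrite divr_gt0// subr_gt0.
have cvgf (f : R -> R) (B : R) : continuous f -> (forall x, `|f x| <= B) ->
    mean P (fun w => f ((\sum_(i < m) r i w ^+ 2 - m%:R) / a m)) @[m --> \oo] -->
    mean PZ (fun w => f (zeta w)).
  exact: ((cvg_in_lawP P PZ mX mzeta).1 a_cvg f B).
have chf_cvg : chf_sqr P (fun w => (\sum_(i < m) r i w ^+ 2 - m%:R) / a m) t @[m --> \oo]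
    --> chf_sqr PZ zeta t.
  apply: cvgD.
    rewrite !expr2; apply: cvgM.
    - apply: (cvgf (fun x => cos (t * x)) 1) => [|x]; last exact: cos_bound.
      apply: (@lipschitz_continuous_fun _ `|t|) => x y.
      by rewrite (le_trans (cos_lipschitz _ _))// -mulrBr normrM.
    - apply: (cvgf (fun x => cos (t * x)) 1) => [|x]; last exact: cos_bound.
      apply: (@lipschitz_continuous_fun _ `|t|) => x y.
      by rewrite (le_trans (cos_lipschitz _ _))// -mulrBr normrM.
  rewrite !expr2; apply: cvgM.
  - apply: (cvgf (fun x => sin (t * x)) 1) => [|x]; last exact: sin_bound.
    apply: (@lipschitz_continuous_fun _ `|t|) => x y.
    by rewrite (le_trans (sin_lipschitz _ _))// -mulrBr normrM.
  - apply: (cvgf (fun x => sin (t * x)) 1) => [|x]; last exact: sin_bound.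
    apply: (@lipschitz_continuous_fun _ `|t|) => x y.
    by rewrite (le_trans (sin_lipschitz _ _))// -mulrBr normrM.
have eta8 : 0 < eta / 8 by rewrite divr_gt0.
have [rho rho0 tz] := tight PZ mzeta eta8.
have ccap : continuous (fun x : R => cap (rho * x)).
  apply: (@lipschitz_continuous_fun _ rho) => x y.
  by rewrite (le_trans (cap_lipschitz _ _))// -mulrBr normrM gtr0_norm.
have /cvgrPdist_le /(_ _ eta8) [m1 _ Hm1] := cvgf _ 1 ccap (fun x => norm_cap_le1 (rho * x)).
have eta2 : 0 < eta / 2 by rewrite divr_gt0.
move/cvgrPdist_le/(_ _ eta2): chf_cvg => [m2 _ Hm2].
(* The characteristic function is 1 at 0; a nonzero t makes the constant |t| / rho positive. *)
have t0 : t != 0.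
  apply/eqP => tE; move: chf1; rewrite tE /chf_sqr.
  rewrite (@eq_mean _ _ _ _ _ (fun=> 1)) => [|w]; last by rewrite mul0r cos0.
  rewrite [X in _ + X ^+ 2](@eq_mean _ _ _ _ _ (fun=> 0)) => [|w]; last by rewrite mul0r sin0.
  by rewrite !mean_cst expr1n expr0n addr0 ltxx.
exists (`|t| / rho); split; first by rewrite divr_gt0// normr_gt0.
exists (maxn 1 (maxn m1 m2)); first by rewrite leq_max.
move=> M m; rewrite !geq_max => /andP[M1 /andP[m1M m2M]] Mm.
have m_gt0 : (0 < m)%N by exact: leq_trans Mm.
have aM := a_gt0 M1; have am := a_gt0 m_gt0.
rewrite leNgt; apply/negP => lt_aM.
(* Evaluating the transform of A_m at t / a M amounts to evaluating that of A_m / a m at u, and the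
   assumption on [a M] says that |u| < rho, where the cap has small mean. *)
pose u := t / a M * a m.
have lt_aM' : `|t| * a m < a M * rho by rewrite -ltr_pdivrMr// mulrAC.
have urho : `|u| <= rho.
  rewrite /u !normrM normfV (gtr0_norm aM) (gtr0_norm am) mulrAC ler_pdivrMr// mulrC.
  by rewrite mulrC [leRHS]mulrC ltW.
pose X w := (\sum_(i < m) r i w ^+ 2 - m%:R) / a m.
have cap_m : mean P (fun w => cap (rho * X w)) <= eta / 4.
  have := Hm1 m (leq_trans m1M Mm); rewrite /= ler_norml => /andP[h _].
  by move: h tz; rewrite -/(X _); move: (mean PZ _) (mean P _) => x y; lra.
have iX (f : R -> R) c : continuous f -> (forall x, `|f x| <= c) -> integ P (fun w => f (X w)).
  by move=> cf fc; exact: (integ_comp P cf fc (mX m)).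
have cos_m : 1 - eta / 2 <= mean P (fun w => cos (u * X w)).
  have ic := integ_cos P u (mX m).
  have icap := iX _ _ ccap (fun x => norm_cap_le1 (rho * x)).
  have : mean P (fun w => 1 - cos (u * X w)) <= mean P (fun w => 2 * cap (rho * X w)).
    apply: mean_le; [by apply: integB => //; exact: integ_cst|exact: integZ|].
    move=> w; rewrite (le_trans (one_sub_cos_le _))// ler_wpM2l// le_cap//.
    by rewrite (normrM u) (normrM rho) (gtr0_norm rho0) ler_wpM2r.
  rewrite meanB//; last exact: integ_cst.
  rewrite mean_cst meanZ//; move: cap_m; move: (mean _ _) (mean _ _) => x y; lra.
have eta_le : eta <= 1 / 2.
  by rewrite /eta; have := chf_sqr_ge0 PZ zeta t; move: (chf_sqr _ _ _) => x; lra.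
have low : 1 - eta <= chf_sqr P X u.
  apply: (@le_trans _ _ (mean P (fun w => cos (u * X w)) ^+ 2)); last by rewrite lerDl sqr_ge0.
  apply: (@le_trans _ _ ((1 - eta / 2) ^+ 2)).
    rewrite -subr_ge0 (_ : _ - _ = (eta / 2) ^+ 2) ?sqr_ge0//; by field.
  by rewrite lerXn2r ?nnegrE//; [|apply: le_trans cos_m]; move: eta_le eta0; lra.
have up : chf_sqr P X u <= 1 - 2 * eta + eta / 2.
  have -> : chf_sqr P X u = chf_sqr P (sumsq m) (t / a M).
    by rewrite -(chf_scale m) /u mulfK// gt_eqF.
  apply: (le_trans (chf_sumsq_anti _ Mm)); rewrite chf_scale.
  have := Hm2 M m2M; rewrite /= ler_norml => /andP[h _].
  by move: h; rewrite /eta; move: (chf_sqr _ _ _) (chf_sqr _ _ _) => x y; lra.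
by move: low up eta0; move: (chf_sqr _ _ _) => x; lra.
Qed.

Context (alpha : R) (alpha_gt0 : 0 < alpha) (L : R -> R) (L_sv : slowly_varying L).
Context (aE : forall m, a m = m%:R `^ alpha^-1 * L m%:R).

Let beta_gt0 : 0 < alpha^-1. Proof. by rewrite invr_gt0. Qed.

Lemma norming_doubling (e : R) : 0 < e -> exists2 N, (0 < N)%N &
  forall m, (N <= m)%N -> 2 `^ (alpha^-1 - e) * a m <= a (2 * m)%N <= 2 `^ (alpha^-1 + e) * a m.
Proof.
move=> e0; have [Lpos Lsv] := L_sv.
have two0 : 0 < 2 :> R by [].
have pow2 : 1 < 2 `^ e :> R.
  by have := @gt0_ltr_powR _ _ e0 1 2; rewrite !nnegrE powR1 ltr1n; apply.
have pow1 : 2 `^ (- e) < 1 :> R by rewrite powRN invf_lt1// powR_gt0.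
have cvgL : L (2 * m%:R) / L m%:R @[m --> \oo] --> (1 : R).
  exact: (cvg_comp _ _ cvgr_idn (Lsv 2 two0)).
have [N _ HN] : \forall m \near \oo, 2 `^ (- e) <= L (2 * m%:R) / L m%:R <= 2 `^ e.
  near=> m; apply/andP; split.
    by near: m; apply: (cvgr_ge _ cvgL).
  by near: m; apply: (cvgr_le _ cvgL).
exists (maxn 1 N); first by rewrite leq_max.
move=> m; rewrite geq_max => /andP[m1 mN].
have m0 : 0 < m%:R :> R by rewrite ltr0n.
have Lm := Lpos _ m0.
have -> : a (2 * m)%N = 2 `^ alpha^-1 * (L (2 * m%:R) / L m%:R) * a m.
  by rewrite !aE natrM powRM//; field; rewrite gt_eqF.
have am := a_gt0 m1.
have /andP[h1 h2] := HN m mN.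
rewrite !powRD ?pnatr_eq0 ?implybT//; apply/andP; split.
  by rewrite ler_wpM2r ?(ltW am)// ler_wpM2l ?powR_ge0.
by rewrite ler_wpM2r ?(ltW am)// ler_wpM2l ?powR_ge0.
Unshelve. all: by end_near. Qed.

(** Bounds of Potter type. Doubling is iterated along powers of 2. For m between 2^k and 2^(k+1),
    [norming_comparable], which bounds an earlier term by a later one, gives the upper bound from
    2^(k+1) and the lower bound from 2^k. *)
Lemma norming_growth (e : R) : 0 < e < alpha^-1 -> exists2 K : R, 0 < K &
  exists2 m0, (0 < m0)%N & forall m, (m0 <= m)%N ->
    a m <= K * m%:R `^ (alpha^-1 + e) /\ m%:R `^ (alpha^-1 - e) <= K * a m.
Proof.
move=> /andP[e0 e_lt].
have [N N0 HN] := norming_doubling e0.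
have [C [C0 [m1 m10 Hm1]]] := norming_comparable.
set bp := alpha^-1 + e in HN *; set bm := alpha^-1 - e in HN *.
have bp0 : 0 < bp by rewrite addr_gt0.
have bm0 : 0 < bm by rewrite subr_gt0.
pose k0 := maxn N m1.
have k0_le k : (k0 <= k)%N -> (N <= 2 ^ k)%N /\ (m1 <= 2 ^ k)%N.
  rewrite geq_max => /andP[Nk mk].
  by split; [apply: leq_trans Nk _|apply: leq_trans mk _]; exact: ltnW (ltn_expl _ _).
pose q k : R := (2 ^ k)%N%:R.
have q0 k : 0 < q k by rewrite ltr0n expn_gt0.
have qS k : q k.+1 = 2 * q k by rewrite /q expnS natrM.
have pow2a (k : nat) : 0 < a (2 ^ k)%N by apply: a_gt0; rewrite expn_gt0.
(* Makes both inequalities true at k0; each doubling then preserves them with the same constant. *)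
pose K1 := Num.max (a (2 ^ k0)%N / q k0 `^ bp) (q k0 `^ bm / a (2 ^ k0)%N).
have K1p : 0 < K1 by rewrite lt_max divr_gt0 ?powR_gt0.
have grow k : (k0 <= k)%N -> a (2 ^ k)%N <= K1 * q k `^ bp /\ q k `^ bm <= K1 * a (2 ^ k)%N.
  have base : a (2 ^ k0)%N <= K1 * q k0 `^ bp /\ q k0 `^ bm <= K1 * a (2 ^ k0)%N.
    split; first by rewrite -ler_pdivrMr ?powR_gt0// /K1 le_max lexx.
    by rewrite -ler_pdivrMr ?pow2a// /K1 le_max lexx orbT.
  move=> /subnKC <-; elim: (k - k0)%N => [|j [h1 h2]]; first by rewrite addn0.
  have [Nk _] := k0_le _ (leq_addr j k0); rewrite addnS.
  have /andP[l u] := HN _ Nk; rewrite expnS qS !powRM ?(ltW (q0 _))//; split.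
    by rewrite (le_trans u)// mulrCA ler_wpM2l ?powR_ge0.
  by rewrite (le_trans (ler_wpM2l (powR_ge0 2 bm) h2))// mulrCA ler_wpM2l// ltW.
pose K := Num.max (C * K1 * 2 `^ bp) (2 `^ bm * K1 * C).
have K0 : 0 < K by rewrite lt_max !mulr_gt0 ?powR_gt0.
exists K => //; exists (2 ^ k0)%N; first by rewrite expn_gt0.
move=> m km; have m_gt0 : (0 < m)%N by rewrite (leq_trans _ km)// expn_gt0.
pose k := trunc_log 2 m.
have /andP[km1 km2] : (2 ^ k <= m < 2 ^ k.+1)%N by exact: trunc_log_bounds.
have kk : (k0 <= k)%N by apply: trunc_log_max.
have [_ mk] := k0_le _ kk.
have m0R : 0 < m%:R :> R by rewrite ltr0n.
split.
  have [h1 _] := grow k.+1 (leqW kk).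
  have h2 := Hm1 m (2 ^ k.+1)%N (leq_trans mk km1) (ltnW km2).
  apply: (le_trans h2); apply: (@le_trans _ _ (C * K1 * 2 `^ bp * m%:R `^ bp)); last first.
    by rewrite ler_wpM2r ?powR_ge0// /K le_max lexx.
  rewrite -!mulrA ler_wpM2l ?(ltW C0)// (le_trans h1)// ler_wpM2l ?(ltW K1p)//.
  rewrite qS powRM ?(ltW (q0 _))// ler_wpM2l ?powR_ge0//.
  by apply: ge0_ler_powR; rewrite ?nnegrE ?(ltW bp0) ?(ltW (q0 _))// ler_nat.
have [_ h1] := grow k kk; have h2 := Hm1 _ _ mk km1.
apply: (@le_trans _ _ (2 `^ bm * K1 * C * a m)); last first.
  by rewrite ler_wpM2r ?(ltW (a_gt0 _))// /K le_max lexx orbT.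
apply: (@le_trans _ _ (q k.+1 `^ bm)).
  by apply: ge0_ler_powR; rewrite ?nnegrE ?(ltW bm0) ?(ltW (q0 _))// ler_nat ltnW.
rewrite qS powRM ?(ltW (q0 _))// -!mulrA ler_wpM2l ?powR_ge0//.
by rewrite (le_trans h1)// ler_wpM2l// ltW.
Qed.

End norming.

(** * Truncation and the two regimes *)

Section truncation.
Context d (T : measurableType d) (R : realType) (P : probability T R).

Definition trunc (M x : R) : R := x * \1_`[- M, M] x.

Lemma measurable_trunc M : measurable_fun [set: R] (trunc M).
Proof. by apply: measurable_funM => //; exact: measurable_indic. Qed.

Lemma trunc_bound M x : 0 <= M -> `|trunc M x| <= M.
Proof.
move=> M0; rewrite /trunc indicE; case: (boolP (x \in _)) => [|_]; last by rewrite mulr0 normr0.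
by rewrite inE /= in_itv/= -ler_norml mulr1.
Qed.

Lemma trunc_idem M x : trunc M x * (x - trunc M x) = 0.
Proof.
by rewrite /trunc indicE; case: (_ \in _); rewrite ?mulr1 ?subrr ?mulr0 ?mul0r.
Qed.

Lemma sub_trunc_sqr_le M x : (x - trunc M x) ^+ 2 <= x ^+ 2.
Proof.
rewrite /trunc indicE; case: (_ \in _); first by rewrite mulr1 subrr expr0n sqr_ge0.
by rewrite mulr0 subr0.
Qed.

Lemma trunc_id M x : `|x| <= M -> trunc M x = x.
Proof.
move=> xM; rewrite /trunc indicE (_ : x \in _) ?mulr1//.
by rewrite inE /= in_itv/= -ler_norml.
Qed.

Lemma trunc_cvg (X : T -> R) (e : R) : sqint P X -> 0 < e ->
  exists2 M, 0 <= M & mean P (fun w => (X w - trunc M (X w)) ^+ 2) <= e.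
Proof.
move=> [mX iX] e0.
pose F (n : nat) w : \bar R := ((X w - trunc n%:R (X w)) ^+ 2)%:E.
have mtX n : measurable_fun [set: T] (fun w => (X w - trunc n%:R (X w)) ^+ 2).
  apply: measurable_funX; apply: measurable_funB => //.
  exact: (measurableT_comp (measurable_trunc n%:R)).
have mF n : measurable_fun [set: T] (F n) by exact/measurable_EFinP.
have F0 : \forall w \ae P, [set: T] w -> F n w @[n --> \oo] --> 0%E.
  apply: aeW => w _ /=.
  apply: (cvg_trans _ (cvg_cst 0%E)).
  apply: near_eq_cvg; exists (Num.bound `|X w|) => //= n /= hn.
  rewrite /F trunc_id ?subrr ?expr0n//.
  by rewrite (le_trans (ltW (archi_boundP (normr_ge0 (X w)))))// ler_nat.
  exact: eventually_filter.
have F1 : \forall w \ae P, forall n, [set: T] w -> (`|F n w| <= (X w ^+ 2)%:E)%E.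
  apply: aeW => x k _; rewrite /F /= lee_fin ger0_norm ?sqr_ge0//.
  exact: sub_trunc_sqr_le.
have [_ _] := @dominated_convergence _ _ _ P [set: T] measurableT F (cst 0%E)
  (fun w => (X w ^+ 2)%:E) mF (measurable_cst _) F0 iX F1.
rewrite integral0 => /fine_cvgP [_] /cvgrPdist_le /(_ e e0) [N _ /(_ N (leqnn _))] /=.
rewrite sub0r normrN => h; exists N%:R => //.
by rewrite (le_trans _ h)// ler_norm.
Qed.

(* The last quantity is the factor of 2n(n-1)/d in the second moment of the
   difference of the cross terms of the walks with steps r_i v_i and g(r_i) v_i. *)
Lemma bounded_truncation (X : T -> R) (e : R) : sqint P X -> mean P X = 0 ->
  mean P (fun w => X w ^+ 2) = 1 -> 0 < e ->
  exists (g : R -> R) (B : R), [/\ measurable_fun [set: R] g, forall x, `|g x| <= B,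
    mean P (fun w => g (X w)) = 0,
    `|mean P (fun w => g (X w) ^+ 2) ^+ 2 - 1| <= e &
    1 - 2 * mean P (fun w => X w * g (X w)) ^+ 2 +
      mean P (fun w => g (X w) ^+ 2) ^+ 2 <= e].
Proof.
move=> sX X0 X1 e0; have [mX iX2] := sX; have iX := sqint_integ sX.
(* With q the discarded second moment and m the mean of the truncation, E[X g(X)] = 1 - q and the
   variance of g(X) is 1 - q - m^2 with m^2 <= q; both errors are then at most 4 q. *)
pose e' := Num.min 1 (e / 4).
have e'0 : 0 < e' by rewrite lt_min ltr01 divr_gt0.
have [M M0] := trunc_cvg sX e'0; set q := mean P _ => qe.
have mtX : measurable_fun [set: T] (fun w => trunc M (X w)).
  exact: (measurableT_comp (measurable_trunc M)).
have stX : sqint P (fun w => trunc M (X w)).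
  by apply: (sqint_bounded P mtX) => w; exact: trunc_bound.
have itX := sqint_integ stX; have [_ itX2] := stX.
pose m := mean P (fun w => trunc M (X w)).
have sD := sqintB sX stX; have [_ iD2] := sD.
have q0 : 0 <= q by apply: mean_ge0 => w; exact: sqr_ge0.
(* [X] is centred, so m is minus the mean of the discarded part, and m^2 is at most its second
   moment. *)
have m2 : m ^+ 2 <= q.
  have : 0 <= mean P (fun w => (X w - trunc M (X w) -
      mean P (fun w => X w - trunc M (X w))) ^+ 2).
    by apply: mean_ge0 => w; exact: sqr_ge0.
  by rewrite mean_sqr_sub// subr_ge0 meanB// X0 sub0r sqrrN.
have t1 : mean P (fun w => trunc M (X w) ^+ 2) = 1 - q.
  rewrite -X1 -meanB//; apply: eq_mean => w.
  have := trunc_idem M (X w); set x := X w; set y := trunc M x => h.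
  have : y ^+ 2 = x * y by apply/eqP; rewrite -subr_eq0 -oppr_eq0 opprB -[X in _ == X]h; apply/eqP; ring.
  by move=> yy; rewrite sqrrB yy; ring.
exists (fun x => trunc M x - m), (M + `|m|).
have iXt := sqint_mul sX stX.
have c1 : mean P (fun w => X w * (trunc M (X w) - m)) = 1 - q.
  rewrite (@eq_mean _ _ _ _ _ (fun w => trunc M (X w) ^+ 2 - m * X w)).
    by rewrite meanB ?meanZ// ?X0 ?mulr0 ?subr0//; exact: integZ.
  move=> w; have := trunc_idem M (X w); set x := X w; set y := trunc M x => h.
  apply/eqP; rewrite -subr_eq0 -[X in _ == X]h; apply/eqP; ring.
have s1 : mean P (fun w => (trunc M (X w) - m) ^+ 2) = 1 - q - m ^+ 2.
  by rewrite mean_sqr_sub// t1.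
have qe1 : q <= 1 by rewrite (le_trans qe)// ge_min lexx.
have qe4 : q <= e / 4 by rewrite (le_trans qe)// ge_min lexx orbT.
have m20 := sqr_ge0 m.
split.
- by apply: measurable_funB => //; exact: measurable_trunc.
- by move=> x; rewrite (le_trans (ler_normB _ _))// lerD2r trunc_bound.
- by rewrite meanB// ?mean_cst ?subrr//; exact: integ_cst.
- rewrite s1; set z := m ^+ 2 in m2 m20 *.
  rewrite (_ : (1 - q - z) ^+ 2 - 1 = - ((q + z) * (2 - (q + z)))); last by ring.
  rewrite normrN ger0_norm; last by rewrite mulr_ge0//; lra.
  apply: (@le_trans _ _ ((q + z) * 2)); last by lra.
  by rewrite ler_wpM2l; lra.
- rewrite c1 s1; set z := m ^+ 2 in m2 m20 *.
  have : 0 <= 2 * q ^+ 2 by rewrite mulr_ge0 ?sqr_ge0.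
  have h : (1 - q - z) ^+ 2 <= 1.
    rewrite (_ : (1 - q - z) ^+ 2 = 1 - (q + z) * (2 - (q + z))); last by ring.
    by rewrite gerBl mulr_ge0//; lra.
  rewrite (_ : (1 - q) ^+ 2 = 1 - 2 * q + q ^+ 2); last by ring.
  by move: h; move: ((1 - q - z) ^+ 2) (q ^+ 2) => A B0 h h'; lra.
Qed.

End truncation.

(** * Almost sure decomposition of the squared norm *)

Section walk_identity.
Context (R : realType) dT (T : measurableType dT) (P : probability T R) (d : nat).
Context (r : nat -> {RV P >-> R}) (v : nat -> {RV P >-> borel_rV R d}).
Context (d_gt0 : (0 < d)%N).
Context (v_law : forall i (a : 'I_d), P [set w | v i w = delta_mx 0 a] = (d%:R^-1)%:E).

Local Notation indv := (@ind R _ _ _ v).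
Local Notation cross := (@cross R _ _ _ r v).
Local Notation partial := (@partial R _ _ _ r v).

Lemma measurable_coord (j : 'I_d) :
  measurable_fun [set: borel_rV R d] (fun u : borel_rV R d => (u : 'rV[R]_d) 0 j).
Proof.
apply: (measurability _ (RGenOpens.measurableE R)) => _ [_ [x [y ->]] <-].
rewrite setTI; apply: sub_sigma_algebra.
apply: open_comp; last exact: interval_open.
by move=> u _; exact: coord_continuous.
Qed.

Lemma walk_norm_sqrE n w :
  euclid_norm (walk r v n w) ^+ 2 = \sum_(j < d) (\sum_(i < n) r i w * (v i w : 'rV[R]_d) 0 j) ^+ 2.
Proof.
rewrite /euclid_norm sqr_sqrtr; last by apply: sumr_ge0 => j _; exact: sqr_ge0.
apply: eq_bigr => j _; congr (_ ^+ 2); rewrite /walk summxE.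
by apply: eq_bigr => i _; rewrite mxE.
Qed.

Lemma measurable_walk_norm n :
  measurable_fun [set: T] (fun w => euclid_norm (walk r v n w) ^+ 2).
Proof.
under eq_fun do rewrite walk_norm_sqrE.
apply: measurable_sum => j; apply: measurable_funX; apply: measurable_sum => i.
apply: measurable_funM => //.
exact: (measurableT_comp (measurable_coord j)).
Qed.

(** The d point masses 1/d exhaust the total mass: one minus the sum of the indicators lies in
    [0, 1] and has mean 0, hence so does its square. *)
Lemma ae_sum_ind i : \forall w \ae P, \sum_(a < d) indv i a w = 1.
Proof.
have mJ : measurable_fun [set: T] (fun w => \sum_(a < d) indv i a w).
  by apply: measurable_sum => a; exact: measurable_ind.
have J01 w : 0 <= 1 - \sum_(a < d) indv i a w <= 1.
  by have /andP[h0 h1] := sum_ind_le1 v i w; rewrite subr_ge0 h1 lerBlDr lerDl.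
have mY : measurable_fun [set: T] (fun w => 1 - \sum_(a < d) indv i a w).
  by apply: measurable_funB.
have Y_le w : `|1 - \sum_(a < d) indv i a w| <= 1.
  by have /andP[h0 h1] := J01 w; rewrite ger0_norm.
have iY := integ_bounded P mY Y_le.
have [_ iY2] := sqint_bounded P mY Y_le.
have iind a : integ P (indv i a).
  apply: (@integ_bounded _ _ _ _ 1); first exact: measurable_ind.
  by move=> w; have /andP[i0 i1] := ind_bound v i a w; rewrite ger0_norm.
have Y0 : mean P (fun w => 1 - \sum_(a < d) indv i a w) = 0.
  rewrite meanB; [|exact: integ_cst|exact: integ_sum].
  rewrite mean_cst mean_sum//; under eq_bigr do rewrite mean_ind//.
  by rewrite sumr_const card_ord -[_ *+ d]mulr_natl divff ?subrr// pnatr_eq0 -lt0n.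
have Y20 : mean P (fun w => (1 - \sum_(a < d) indv i a w) ^+ 2) = 0.
  apply/eqP; rewrite eq_le mean_ge0 ?andbT; last by move=> w; exact: sqr_ge0.
  rewrite -[leRHS]Y0; apply: mean_le => // w; have /andP[h0 h1] := J01 w.
  by rewrite expr2 ler_piMr.
by apply: filterS (mean_sqr_eq0 mY iY2 Y20) => w /eqP; rewrite subr_eq0 => /eqP.
Qed.

Lemma ae_walk_norm n :
  \forall w \ae P, euclid_norm (walk r v n w) ^+ 2 - n%:R = sumsq r n w + cross id n w.
Proof.
have /ae_foralln := ae_sum_ind; apply: filterS => w one.
have coordE i j : (v i w : 'rV[R]_d) 0 j = indv i j w.
  have [[a va]|none] := pselect (exists a : 'I_d, v i w = delta_mx 0 a).
    rewrite /ind va mxE eqxx/=; congr (_%:R); congr nat_of_bool.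
    by apply/eqP/eqP => [->//|/delta_row_inj].
  have := one i; rewrite big1 => [/eqP|a _]; first by rewrite eq_sym oner_eq0.
  by rewrite /ind; case: eqP => // va; case: none; exists a.
have -> : euclid_norm (walk r v n w) ^+ 2 = \sum_(a < d) partial id n a w ^+ 2.
  rewrite walk_norm_sqrE; apply: eq_bigr => j _; congr (_ ^+ 2).
  by apply: eq_bigr => i _; rewrite coordE.
rewrite (@walk_norm_sqr R _ T d r v id n w (fun i _ => one i)) /sumsq.
by rewrite addrAC.
Qed.

End walk_identity.

(** * Rates in the two regimes *)

Section rates.
Context (R : realType).

Lemma powR_natN_small (k e : R) : 0 < k -> 0 < e ->
  exists N : nat, forall m : nat, (N <= m)%N -> (0 < m)%N -> m%:R `^ (- k) <= e.
Proof.
move=> k0 e0; exists (Num.bound (e^-1 `^ k^-1)) => m hm m0.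
have m0R : 0 < m%:R :> R by rewrite ltr0n.
have le_m : e^-1 `^ k^-1 <= m%:R.
  by rewrite (le_trans (ltW (archi_boundP (powR_ge0 _ _))))// ler_nat.
rewrite powRN -[leRHS]invrK lef_pV2 ?posrE ?powR_gt0 ?invr_gt0//.
have -> : e^-1 = (e^-1 `^ k^-1) `^ k.
  by rewrite -powRrM mulVf ?gt_eqF// powRr1// invr_ge0 ltW.
by apply: ge0_ler_powR => //; rewrite ?nnegrE ?powR_ge0// ltW.
Qed.

Context (alpha : R) (alpha_gt1 : 1 < alpha) (alpha_lt2 : alpha < 2).
Context (a : nat -> R) (a_gt0 : forall m, (0 < m)%N -> 0 < a m).
Context (growth : forall e : R, 0 < e < alpha^-1 -> exists2 K : R, 0 < K &
  exists2 m0, (0 < m0)%N & forall m, (m0 <= m)%N ->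
    a m <= K * m%:R `^ (alpha^-1 + e) /\ m%:R `^ (alpha^-1 - e) <= K * a m).
Context (n : nat -> nat) (n_gt0 : forall d, (0 < n d)%N).
Context (n_cvg : n d @[d --> \oo] --> \oo).

Let alpha_gt0 : 0 < alpha. Proof. exact: lt_trans ltr01 alpha_gt1. Qed.

Let crit := alpha / (2 * alpha - 2).

Let crit_gt0 : 0 < crit.
Proof. by rewrite divr_gt0// subr_gt0 -[ltLHS]mulr1 ltr_pM2l. Qed.

(** Origin of the threshold: n^2/d and n^(2/alpha), the squares of the two scales, balance at d =
    n^(2 - 2/alpha). *)
Let critV : crit^-1 = 2 - 2 * alpha^-1.
Proof.
have a0 : alpha != 0 by rewrite gt_eqF.
have h : 2 * alpha - 2 != 0 by rewrite gt_eqF// subr_gt0 -[ltLHS]mulr1 ltr_pM2l.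
by rewrite /crit; field; rewrite a0 h.
Qed.

Lemma near_n_ge (N : nat) : \forall d \near \oo, (N <= n d)%N.
Proof. by have := n_cvg (t := [set k | (N <= k)%N]); apply; exists N. Qed.

(** Inverts the hypothesis: the norming sequence is known in powers of n, so d is bounded by such a
    power too, with a definite gain k. *)
Lemma supercritical_dimension (dlt : R) : 0 < dlt ->
  (\forall d \near \oo, d%:R `^ (crit + dlt) < (n d)%:R) ->
  exists2 k : R, 0 < k & \forall d \near \oo, (d%:R : R) <= (n d)%:R `^ (crit^-1 - k).
Proof.
move=> d0 Hn; pose b := crit + dlt.
have b0 : 0 < b by rewrite addr_gt0.
exists (crit^-1 - b^-1).
  by rewrite subr_gt0 ltf_pV2 ?posrE// /b ltrDl.
near=> d; rewrite subKr.
have Hd : d%:R `^ b < (n d)%:R by near: d.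
have -> : (d%:R : R) = (d%:R `^ b) `^ b^-1.
  by rewrite -powRrM mulfV ?gt_eqF// powRr1.
by apply: ge0_ler_powR; rewrite ?nnegrE ?powR_ge0 ?invr_ge0 ?(ltW b0)// ltW.
Unshelve. all: by end_near. Qed.

Lemma supercritical_norming (dlt : R) : 0 < dlt ->
  (\forall d \near \oo, d%:R `^ (crit + dlt) < (n d)%:R) ->
  forall eta : R, 0 < eta -> \forall d \near \oo,
    a (n d) ^+ 2 * d%:R <= eta * (n d)%:R ^+ 2 /\ d%:R <= eta * (n d)%:R ^+ 2.
Proof.
move=> d0 Hn eta eta0; have [k k0 Hd] := supercritical_dimension d0 Hn.
have aV0 : 0 < alpha^-1 by rewrite invr_gt0.
have aV1 : alpha^-1 < 1 by rewrite invf_lt1.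
(* The loss 2 e in the square of the norming sequence then uses up at most half of the gain k; e <
   1/alpha is the range in which [growth] applies. *)
pose e := Num.min (k / 4) (alpha^-1 / 2).
have e0 : 0 < e by rewrite lt_min !divr_gt0.
have e_k : e <= k / 4 by rewrite ge_min lexx.
have e_a : e < alpha^-1.
  by rewrite (@le_lt_trans _ _ (alpha^-1 / 2))// ?ge_min ?lexx ?orbT// ltr_pdivrMr// ltr_pMr// ltr1n.
have [|K K0 [m0 m00 HK]] := growth (e := e); first by rewrite e0.
have k2 : 0 < k / 2 by rewrite divr_gt0.
have [|N1 HN1] := powR_natN_small k2 (e := eta / K ^+ 2); first by rewrite divr_gt0// exprn_gt0.
have [N2 HN2] := powR_natN_small k0 eta0.
near=> d.
have nm0 : (m0 <= n d)%N by near: d; exact: near_n_ge.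
have nN1 : (N1 <= n d)%N by near: d; exact: near_n_ge.
have nN2 : (N2 <= n d)%N by near: d; exact: near_n_ge.
have Hdd : (d%:R : R) <= (n d)%:R `^ (crit^-1 - k) by near: d.
have n0 : 0 < (n d)%:R :> R by rewrite ltr0n.
have n1 : 1 <= (n d)%:R :> R by rewrite ler1n.
have powD x y : (n d)%:R `^ (x + y) = (n d)%:R `^ x * (n d)%:R `^ y :> R.
  by rewrite powRD// (gt_eqF n0) implybT.
have n2 : (n d)%:R ^+ 2 = (n d)%:R `^ 2 :> R by rewrite powR_mulrn.
split.
  have [au _] := HK _ nm0.
  have a2 : a (n d) ^+ 2 <= K ^+ 2 * (n d)%:R `^ (2 * alpha^-1 + 2 * e).
    rewrite (_ : 2 * alpha^-1 + 2 * e = (alpha^-1 + e) + (alpha^-1 + e)); last by ring.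
    rewrite powD -expr2 -exprMn lerXn2r ?nnegrE ?(ltW (a_gt0 _))//.
    by rewrite mulr_ge0 ?powR_ge0// ltW.
  apply: (le_trans (ler_pM (sqr_ge0 _) (ler0n _ _) a2 Hdd)).
  rewrite -mulrA -powD n2.
  have -> : 2 * alpha^-1 + 2 * e + (crit^-1 - k) = 2 + (2 * e - k) by rewrite critV; ring.
  rewrite powD mulrCA mulrC; rewrite ler_wpM2r ?powR_ge0//.
  rewrite mulrC -ler_pdivlMr ?exprn_gt0//; apply: le_trans (HN1 _ nN1 (n_gt0 d)).
  by apply: ler_powR => //; lra.
apply: (le_trans Hdd); rewrite critV n2.
have -> : 2 - 2 * alpha^-1 - k = (- k) + (2 - 2 * alpha^-1) by ring.
rewrite powD ler_pM ?powR_ge0//; first exact: HN2.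
by apply: ler_powR => //; lra.
Unshelve. all: by end_near. Qed.

Lemma subcritical_norming (dlt : R) : 0 < dlt ->
  (\forall d \near \oo, (n d)%:R < d%:R `^ (crit - dlt)) ->
  forall eta : R, 0 < eta -> \forall d \near \oo,
    (n d)%:R ^+ 2 <= eta * (d%:R * a (n d) ^+ 2).
Proof.
move=> d0 Hn eta eta0; pose b := crit - dlt.
have b0 : 0 < b.
  (* With b <= 0 the hypothesis would give n(d) < d^b <= 1 for some d >= 1, against n(d) >= 1. *)
  rewrite ltNge; apply/negP => b_le.
  have [N _ HN] := Hn.
  have := HN (maxn N 1) (leq_maxl _ _) => /=.
  rewrite ltNge => /negP; apply; apply: (@le_trans _ _ 1); last by rewrite ler1n.
  rewrite -[leRHS](powRr0 (maxn N 1)%:R); apply: ler_powR => //.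
  by rewrite ler1n leq_maxr.
pose k := b^-1 - crit^-1.
have k0 : 0 < k by rewrite subr_gt0 ltf_pV2 ?posrE// /b ltrBlDr ltrDl.
have aV0 : 0 < alpha^-1 by rewrite invr_gt0.
pose e := Num.min (k / 4) (alpha^-1 / 2).
have e0 : 0 < e by rewrite lt_min !divr_gt0.
have e_k : e <= k / 4 by rewrite ge_min lexx.
have e_a : e < alpha^-1.
  by rewrite (@le_lt_trans _ _ (alpha^-1 / 2))// ?ge_min ?lexx ?orbT// ltr_pdivrMr// ltr_pMr// ltr1n.
have [|K K0 [m0 m00 HK]] := growth (e := e); first by rewrite e0.
have k2 : 0 < k / 2 by rewrite divr_gt0.
have [|N1 HN1] := powR_natN_small k2 (e := eta / K ^+ 2); first by rewrite divr_gt0// exprn_gt0.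
near=> d.
have nm0 : (m0 <= n d)%N by near: d; exact: near_n_ge.
have nN1 : (N1 <= n d)%N by near: d; exact: near_n_ge.
have n0 : 0 < (n d)%:R :> R by rewrite ltr0n.
have n1 : 1 <= (n d)%:R :> R by rewrite ler1n.
have Hnd : (n d)%:R < d%:R `^ b by near: d.
have dn : (n d)%:R `^ b^-1 <= (d%:R : R).
  have -> : (d%:R : R) = (d%:R `^ b) `^ b^-1.
    by rewrite -powRrM mulfV ?gt_eqF// powRr1.
  by apply: ge0_ler_powR; rewrite ?nnegrE ?powR_ge0 ?invr_ge0 ?(ltW b0)// ltW.
have powD x y : (n d)%:R `^ (x + y) = (n d)%:R `^ x * (n d)%:R `^ y :> R.
  by rewrite powRD// (gt_eqF n0) implybT.
have n2 : (n d)%:R ^+ 2 = (n d)%:R `^ 2 :> R by rewrite powR_mulrn.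
have [_ al] := HK _ nm0.
have a2 : (n d)%:R `^ (2 * alpha^-1 - 2 * e) <= K ^+ 2 * a (n d) ^+ 2.
  rewrite (_ : 2 * alpha^-1 - 2 * e = (alpha^-1 - e) + (alpha^-1 - e)); last by ring.
  rewrite powD -expr2 -exprMn lerXn2r ?nnegrE ?powR_ge0//.
  by rewrite mulr_ge0 ?(ltW K0)// ltW// a_gt0.
have h := ler_pM (powR_ge0 _ _) (powR_ge0 _ _) dn a2.
have expo : (n d)%:R ^+ 2 = (n d)%:R `^ (2 * e - k) * ((n d)%:R `^ b^-1 * (n d)%:R `^ (2 * alpha^-1 - 2 * e)).
  rewrite -!powD n2; congr (_ `^ _); rewrite /k critV; ring.
rewrite expo.
apply: (le_trans (ler_wpM2l (powR_ge0 _ _) h)).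
have hk : (n d)%:R `^ (2 * e - k) <= eta / K ^+ 2.
  by apply: le_trans (HN1 _ nN1 (n_gt0 d)); apply: ler_powR => //; lra.
have rest0 : 0 <= d%:R * (K ^+ 2 * a (n d) ^+ 2) by apply: mulr_ge0 => //; apply: mulr_ge0; exact: sqr_ge0.
apply: (le_trans (ler_wpM2r rest0 hk)).
rewrite le_eqVlt; apply/orP; left; apply/eqP; field.
by rewrite gt_eqF.
Unshelve. all: by end_near. Qed.

End rates.

Lemma taylor3_cap (R : realType) (C : R) p p1 p2 x y : taylor3 C p p1 p2 ->
  `|p x - p y| <= 2 * C * cap (x - y).
Proof.
move=> tp; have C0 : 0 <= C by rewrite (le_trans _ (t3_bnd tp 0)).
have [h|h] := leP 1 `|x - y|.
  rewrite cap_ge1// mulr1 (le_trans (ler_normB _ _))//.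
  by have := t3_bnd tp x; have := t3_bnd tp y; lra.
rewrite (le_trans (t3_lip tp _ _))// /cap min_r ?(ltW h)//.
by rewrite ler_wpM2r// ler_peMl// ler1n.
Qed.

Lemma cap_add (R : realType) (x y : R) : cap (x + y) <= cap x + cap y.
Proof.
have := ler_normD x y; have := normr_ge0 x; have := normr_ge0 y.
rewrite /cap; case: (leP 1 `|x + y|); case: (leP 1 `|x|); case: (leP 1 `|y|); lra.
Qed.

(** Collects the errors of the Gaussian comparison: x, y, z stand for 1/d, 1/n, d/n^2, t for the
    variance defect and m for the Gaussian fourth moment. Given B, first [k] makes the terms with
    factor k sum to E, then [th] makes those with factor 1/k at most E. *)
Lemma lindeberg_terms_le (R : realType) (B m k E th x y z t : R) : 0 <= B -> 0 <= m -> 0 < k ->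
  0 <= th -> th <= E -> k * (B ^+ 2 / 2 + 2 * B ^+ 4 + 2) = E ->
  (5 * B ^+ 6 + 28 * B ^+ 8 + 4 * m + 1) * th <= k * E ->
  x <= th -> y <= th -> z <= th -> t <= E ->
  k * (B ^+ 2 / 2 + 2 * B ^+ 4) + k^-1 * (B ^+ 6 * (4 * x + y) + 4 * B ^+ 8 * (6 * y + z)) +
    t + 2^-1 * y + 2 * k + k^-1 * (4 * m * y) <= 4 * E.
Proof.
move=> B0 m0 k0 th0 thE kE thD xth yth zth tE.
have b6 : 0 <= B ^+ 6 by rewrite exprn_ge0.
have b8 : 0 <= 4 * B ^+ 8 by rewrite mulr_ge0 ?exprn_ge0.
have h1 : B ^+ 6 * (4 * x + y) <= B ^+ 6 * (5 * th) by rewrite ler_wpM2l//; lra.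
have h2 : 4 * B ^+ 8 * (6 * y + z) <= 4 * B ^+ 8 * (7 * th) by rewrite ler_wpM2l//; lra.
have h3 : 4 * m * y <= 4 * m * th by rewrite ler_wpM2l ?mulr_ge0.
have big : B ^+ 6 * (4 * x + y) + 4 * B ^+ 8 * (6 * y + z) + 4 * m * y <= k * E by lra.
have ki : 0 <= k^-1 by rewrite invr_ge0 ltW.
have := ler_wpM2l ki big; rewrite mulKf ?gt_eqF// mulrDr.
by move: (k^-1 * _) (k^-1 * _) => u v; lra.
Qed.

Lemma mean_norm_le_root (R : realType) (d : measure_display) (T : measurableType d)
    (P : probability T R) (k : R) (X : T -> R) : 0 < k -> sqint P X ->
  mean P (fun w => X w ^+ 2) <= k ^+ 2 -> mean P (fun w => `|X w|) <= k.
Proof.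
move=> k0 sX h; rewrite (le_trans (mean_norm_le_sqr k0 sX))//.
have : mean P (fun w => X w ^+ 2) / k <= k by rewrite ler_pdivrMr// -expr2.
by move: (_ / k) => x; lra.
Qed.

(** * Convergence in the two regimes *)

Section main.
Context (R : realType) (dT : measure_display) (T : measurableType dT) (P : probability T R).
Context (r : nat -> {RV P >-> R}) (V : forall d : nat, nat -> {RV P >-> borel_rV R d}).
Context (r_same : forall i, same_law (r i) (r 0%N)).
Context (r_sqint : sqint P (r 0%N)) (r_mean : mean P (r 0%N) = 0).
Context (r_var : mean P (fun w => r 0%N w ^+ 2) = 1).
Context (r_indep : mutually_independent P (fun i => sigma_rv (r i))).
Context (V_law : forall d i (j : 'I_d),
  P [set w | V d i w = delta_mx 0 j] = (d%:R^-1)%:E).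
Context (V_indep : forall d, (0 < d)%N ->
  mutually_independent P (fun i => sigma_rv (V d i))).
Context (rV_indep : forall d, (0 < d)%N ->
  independent P (sigma_seq r) (sigma_seq (V d))).
Context (dZ : measure_display) (Z : measurableType dZ) (PZ : probability Z R).
Context (zeta : {RV PZ >-> R}) (a : nat -> R) (a_gt0 : forall m, (0 < m)%N -> 0 < a m).
Context (a_cvg : cvg_in_law P (fun m w => (\sum_(i < m) r i w ^+ 2 - m%:R) / a m) PZ zeta).
Context (n : nat -> nat) (n_gt0 : forall d, (0 < n d)%N).
Context (n_cvg : n d @[d --> \oo] --> \oo).

Local Notation cross d := (@cross R _ _ _ r (V d)).
Local Notation ssq := (sumsq r).

Let mX m : measurable_fun [set: T] (fun w => (\sum_(i < m) r i w ^+ 2 - m%:R) / a m).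
Proof. by apply: measurable_funM => //; exact: measurable_sumsq. Qed.

Let mzeta : measurable_fun [set: Z] zeta.
Proof. exact: measurable_funPT. Qed.

Let mW (s : nat -> R) d : measurable_fun [set: T]
  (fun w => (euclid_norm (walk r (V d) (n d) w) ^+ 2 - (n d)%:R) / s d).
Proof.
apply: measurable_funM => //; apply: measurable_funB => //.
exact: measurable_walk_norm.
Qed.

Let mid : measurable_fun [set: R] (@id R). Proof. exact: measurable_id. Qed.

Lemma measurable_cross_id d k : (0 < d)%N -> measurable_fun [set: T] (cross d id k).
Proof. by move=> d0; apply: measurable_cross. Qed.

Lemma sqint_cross_id d k : (0 < d)%N -> sqint P (cross d id k).
Proof.
move=> d0; exact: (sqint_cross r_same r_indep (V_law (d := d)) (V_indep d0) (rV_indep d0) k mid).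
Qed.

Lemma mean_walk_norm (f : R -> R) c (s : nat -> R) d : continuous f -> (forall x, `|f x| <= c) ->
  (0 < d)%N ->
  mean P (fun w => f ((euclid_norm (walk r (V d) (n d) w) ^+ 2 - (n d)%:R) / s d)) =
  mean P (fun w => f (ssq (n d) w / s d + cross d id (n d) w / s d)).
Proof.
move=> cf fc d0; apply: ae_eq_mean.
- exact: (integ_measurable (integ_comp P cf fc (mW s d))).
- apply: (integ_measurable (integ_comp P cf fc _)); apply: measurable_funD.
    by apply: measurable_funM => //; exact: measurable_sumsq.
  by apply: measurable_funM => //; exact: measurable_cross_id.
apply: filterS (ae_walk_norm r d0 (V_law (d := d)) (n d)) => w ->.
by rewrite mulrDl.
Qed.

Lemma mean_cross_sqr d k : (0 < d)%N -> (0 < k)%N ->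
  mean P (fun w => cross d id k w ^+ 2) <= 2 * k%:R ^+ 2 / d%:R.
Proof.
move=> d0 k0; under eq_mean do rewrite expr2.
rewrite (mean_cross_mul d0 r_same r_indep (V_law (d := d)) (V_indep d0) (rV_indep d0) k mid mid)//.
have -> : mean P (fun w => id (r 0%N w) * id (r 0%N w)) = 1.
  by rewrite -r_var; apply: eq_mean => w; rewrite expr2.
rewrite expr1n mulr1 ler_wpM2r ?invr_ge0// expr2 mulrA ler_wpM2l ?mulr_ge0//.
by rewrite gerBl.
Qed.

Lemma subcritical_cvg :
  (forall eta : R, 0 < eta -> \forall d \near \oo,
    (n d)%:R ^+ 2 <= eta * (d%:R * a (n d) ^+ 2)) ->
  cvg_in_law P
    (fun d w => (euclid_norm (walk r (V d) (n d) w) ^+ 2 - (n d)%:R) / a (n d)) PZ zeta.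
Proof.
move=> rate.
apply: (cvg_in_law_smooth (mW (fun d => a (n d))) mzeta) => C p p1 p2 tp.
have cp := lipschitz_continuous_fun (t3_lip tp).
have C0 : 0 <= C by rewrite (le_trans _ (t3_bnd tp 0)).
have lim : mean P (fun w => p (ssq (n d) w / a (n d))) @[d --> \oo] -->
    mean PZ (fun w => p (zeta w)).
  exact: (cvg_comp _ _ n_cvg ((cvg_in_lawP P PZ mX mzeta).1 a_cvg p C cp (t3_bnd tp))).
apply/cvgrPdist_le => /= e e0.
pose k := e / (2 * (C + 1)).
have C1 : 0 < C + 1 by rewrite ltr_wpDl.
have k0 : 0 < k by rewrite divr_gt0// mulr_gt0.
have e2 : 0 < e / 2 by rewrite divr_gt0.
move/cvgrPdist_le/(_ _ e2): lim => lim.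
(* Half of k^2, because the second moment of [cross] is at most 2 n^2 / d. *)
have k2 : 0 < k ^+ 2 / 2 by rewrite divr_gt0// exprn_gt0.
near=> d.
have d0 : (0 < d)%N by near: d; exists 1%N.
have d0R : 0 < d%:R :> R by rewrite ltr0n.
have hr : (n d)%:R ^+ 2 <= k ^+ 2 / 2 * (d%:R * a (n d) ^+ 2) by near: d; exact: rate.
have hl : `|mean PZ (fun w => p (zeta w)) - mean P (fun w => p (ssq (n d) w / a (n d)))| <= e / 2.
  by near: d.
have ad := a_gt0 (n_gt0 d).
rewrite (mean_walk_norm (fun d => a (n d)) cp (t3_bnd tp) d0).
have sc := sqintZ (a (n d))^-1 (sqint_cross_id (n d) d0).
have ic := sqint_integ sc.
have cross_le : mean P (fun w => `|(a (n d))^-1 * cross d id (n d) w|) <= k.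
  apply: (mean_norm_le_root k0 sc).
  under eq_mean do rewrite exprMn.
  rewrite meanZ; last by case: (sqint_cross_id (n d) d0).
  rewrite exprVn mulrC ler_pdivrMr ?exprn_gt0//.
  rewrite (le_trans (mean_cross_sqr d0 (n_gt0 d)))// ler_pdivrMr//.
  rewrite (_ : k ^+ 2 * _ * _ = 2 * (k ^+ 2 / 2 * (d%:R * a (n d) ^+ 2))); last by field.
  by move: hr; move: ((n d)%:R ^+ 2) (_ * (_ * _)) => x y; lra.
have mA : measurable_fun [set: T] (fun w => ssq (n d) w / a (n d)) := mX (n d).
have mB : measurable_fun [set: T]
    (fun w => ssq (n d) w / a (n d) + cross d id (n d) w / a (n d)).
  by apply: measurable_funD => //; apply: measurable_funM => //; exact: measurable_cross_id.
have iA := integ_comp P cp (t3_bnd tp) mA.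
have iB := integ_comp P cp (t3_bnd tp) mB.
have diff : `|mean P (fun w => p (ssq (n d) w / a (n d))) -
    mean P (fun w => p (ssq (n d) w / a (n d) + cross d id (n d) w / a (n d)))| <= C * k.
  rewrite -meanB// (le_trans (mean_norm_le (integB iA iB)))//.
  apply: (@le_trans _ _ (mean P (fun w => C * `|(a (n d))^-1 * cross d id (n d) w|))).
    apply: mean_le; [exact/integ_norm/integB|by apply: integZ; exact: integ_norm|].
    move=> w; rewrite (le_trans (t3_lip tp _ _))//.
    by rewrite opprD addrA subrr add0r normrN mulrC [X in `|X|]mulrC mulrC.
  by rewrite meanZ; [rewrite ler_wpM2l|exact: integ_norm].
rewrite -(subrKA (mean P (fun w => p (ssq (n d) w / a (n d))))).
rewrite (le_trans (ler_normD _ _))// [leRHS](splitr e) lerD//.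
rewrite (le_trans diff)// /k mulrA ler_pdivrMr ?mulr_gt0//.
rewrite (_ : e / 2 * (2 * (C + 1)) = C * e + e); last by field.
by rewrite lerDl ltW.
Unshelve. all: by end_near. Qed.

Lemma supercritical_cvg :
  (forall eta : R, 0 < eta -> \forall d \near \oo,
    a (n d) ^+ 2 * d%:R <= eta * (n d)%:R ^+ 2 /\ d%:R <= eta * (n d)%:R ^+ 2) ->
  cvg_in_law P
    (fun d w => (euclid_norm (walk r (V d) (n d) w) ^+ 2 - (n d)%:R)
                / Num.sqrt (2 * (n d)%:R ^+ 2 / d%:R)) (normal_prob 0 1) idfun.
Proof.
move=> rate; pose s d : R := Num.sqrt (2 * (n d)%:R ^+ 2 / d%:R).
have mid0 : measurable_fun [set: R] (idfun : R -> R) by exact: measurable_id.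
apply: (cvg_in_law_smooth (Q := normal_prob 0 1) (Y := idfun) (mW s) mid0) => C p p1 p2 tp.
have cp := lipschitz_continuous_fun (t3_lip tp).
have C0 : 0 <= C by rewrite (le_trans _ (t3_bnd tp 0)).
apply/cvgrPdist_le => /= e e0.
have C1 : 0 < C + 1 by rewrite ltr_wpDl.
(* Errors at the end: 4 C E from the Gaussian comparison and 2 C (E + E) from dropping A_n and from
   truncating, hence 8 C E <= e. *)
pose E := e / (10 * (C + 1)).
have E0 : 0 < E by rewrite divr_gt0// mulr_gt0.
have CE : 8 * (C * E) <= e.
  rewrite (_ : e = 10 * (C * E) + 10 * E); last by rewrite /E; field; rewrite gt_eqF.
  have : 0 <= C * E by rewrite mulr_ge0 ?(ltW E0).
  by lra.
(* E is meant for the variance defect, E^2 for a second moment whose root is taken. *)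
have E2 : 0 < Num.min E (E ^+ 2) by rewrite lt_min E0 exprn_gt0.
have [g [B [mg gB g0]]] := bounded_truncation r_sqint r_mean r_var E2.
set s2 := mean P (fun w => g (r 0%N w) ^+ 2); set c := mean P (fun w => _ * _).
rewrite !le_min => /andP[s2E _] /andP[_ cE].
have B0 : 0 <= B by rewrite (le_trans _ (gB 0)).
have sg : sqint P (fun w => g (r 0%N w)).
  by apply: (sqint_bounded P _ (c := B)) => //; exact: (measurableT_comp mg).
have E_2 : 0 < E / 2 by rewrite divr_gt0.
(* A_n has no second moment to work with. Instead A_n / a_n is tight, and A_n / s is at most rho A_n
   / a_n in size once a_n <= rho s. *)
have [rho rho0 tz] := tight PZ mzeta E_2.
have ccap : continuous (fun x : R => cap (rho * x)).
  apply: (@lipschitz_continuous_fun _ rho) => x y.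
  by rewrite (le_trans (cap_lipschitz _ _))// -mulrBr normrM gtr0_norm.
have := (cvg_in_lawP P PZ mX mzeta).1 a_cvg _ 1 ccap (fun x => norm_cap_le1 (rho * x)).
move=> /(cvg_comp _ _ n_cvg)/cvgrPdist_le /(_ _ E_2) cap_near.
have m40 : 0 <= normal_m4 R.
  by apply: mean_ge0 => u; rewrite (_ : 4%N = (2 * 2)%N)// exprM sqr_ge0.
pose k := E / (B ^+ 2 / 2 + 2 * B ^+ 4 + 2).
have Bk : 0 < B ^+ 2 / 2 + 2 * B ^+ 4 + 2.
  by rewrite ltr_wpDl// addr_ge0 ?mulr_ge0 ?exprn_ge0.
have k0 : 0 < k by rewrite divr_gt0.
pose D := 5 * B ^+ 6 + 28 * B ^+ 8 + 4 * normal_m4 R + 1.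
have D0 : 0 < D by rewrite ltr_wpDl// !addr_ge0 ?mulr_ge0 ?exprn_ge0.
pose th := Num.min E (k * E / D).
have th0 : 0 < th by rewrite lt_min E0 divr_gt0// mulr_gt0.
(* The rate with eta = 2 rho^2 amounts to a_n <= rho s, since s^2 = 2 n^2 / d. *)
have rho2 : 0 < 2 * rho ^+ 2 by rewrite mulr_gt0// exprn_gt0.
have inv_near : \forall m \near \oo, (m%:R^-1 : R) <= th.
  exists (Num.bound th^-1).+1 => //= m /= hm.
  rewrite -[leRHS]invrK lef_pV2 ?posrE ?invr_gt0 ?ltr0n//; last exact: leq_ltn_trans hm.
  rewrite (le_trans (ltW (archi_boundP _)))// ?invr_ge0 ?(ltW th0)//.
  by rewrite ler_nat ltnW.
near=> d.
have d0 : (0 < d)%N by near: d; exists 1%N.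
have d0R : 0 < d%:R :> R by rewrite ltr0n.
have n0R : 0 < (n d)%:R :> R by rewrite ltr0n.
have d_th : d%:R^-1 <= th by near: d.
have n_th : (n d)%:R^-1 <= th by near: d; exact: (n_cvg inv_near).
have [ra _] : a (n d) ^+ 2 * d%:R <= 2 * rho ^+ 2 * (n d)%:R ^+ 2 /\
    d%:R <= 2 * rho ^+ 2 * (n d)%:R ^+ 2 by near: d; exact: rate.
have [_ rd] : a (n d) ^+ 2 * d%:R <= th * (n d)%:R ^+ 2 /\ d%:R <= th * (n d)%:R ^+ 2.
  by near: d; exact: rate.
have hcap : `|mean PZ (fun w => cap (rho * zeta w)) -
    mean P (fun w => cap (rho * ((\sum_(i < n d) r i w ^+ 2 - (n d)%:R) / a (n d))))| <= E / 2.
  by near: d.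
have ad := a_gt0 (n_gt0 d).
have s_sqr : s d ^+ 2 = 2 * (n d)%:R ^+ 2 / d%:R.
  by rewrite sqr_sqrtr// divr_ge0// mulr_ge0// exprn_ge0.
have s0 : 0 < s d by rewrite sqrtr_gt0 divr_gt0// mulr_gt0// exprn_gt0.
rewrite (mean_walk_norm s cp (t3_bnd tp) d0).
have scg : sqint P (cross d g (n d)).
  exact: (sqint_cross r_same r_indep (V_law (d := d)) (V_indep d0) (rV_indep d0) _ mg sg).
have sci := sqint_cross_id (n d) d0.
have sD := sqintZ (s d)^-1 (sqintB sci scg).
have iD := sqint_integ sD.
have cross_le : mean P (fun w => `|(s d)^-1 * (cross d id (n d) w - cross d g (n d) w)|) <= E.
  apply: (mean_norm_le_root E0 sD).
  have mul := mean_cross_mul d0 r_same r_indep (V_law (d := d)) (V_indep d0) (rV_indep d0) (n d).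
  rewrite (@eq_mean _ _ _ _ _ (fun w => (s d) ^- 2 * (cross d id (n d) w * cross d id (n d) w -
      2 * (cross d id (n d) w * cross d g (n d) w) +
      cross d g (n d) w * cross d g (n d) w))); last by move=> w; rewrite exprMn exprVn; ring.
  have i1 := sqint_mul sci sci; have i2 := sqint_mul sci scg; have i3 := sqint_mul scg scg.
  rewrite meanZ; last by apply: integD => //; apply: integB => //; exact: integZ.
  rewrite (meanD (integB i1 (integZ 2 i2)) i3) (meanB i1 (integZ 2 i2)) (meanZ 2 i2).
  rewrite (mul _ _ mid mid r_sqint r_sqint r_mean r_mean).
  rewrite (mul _ _ mid mg r_sqint sg r_mean g0) (mul _ _ mg mg sg sg g0 g0).
  have -> : mean P (fun w => id (r 0%N w) * id (r 0%N w)) = 1.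
    by rewrite -r_var; apply: eq_mean => w; rewrite expr2.
  have -> : mean P (fun w => g (r 0%N w) * g (r 0%N w)) = s2.
    by apply: eq_mean => w; rewrite expr2.
  rewrite -/c s_sqr.
  rewrite [leLHS](_ : _ = (1 - 2 * c ^+ 2 + s2 ^+ 2) * (1 - (n d)%:R^-1)); last first.
    by field; rewrite (gt_eqF n0R) (gt_eqF d0R).
  have n1 : 0 <= 1 - (n d)%:R^-1 :> R by rewrite subr_ge0 invf_le1// ler1n.
  by rewrite (le_trans (ler_wpM2r n1 cE))// ler_piMr ?sqr_ge0// gerBl.
have mA : measurable_fun [set: T] (ssq (n d)) := measurable_sumsq r (n d).
have [mci _] := sci; have [mcg _] := scg.
have mB : measurable_fun [set: T] (fun w => ssq (n d) w / s d + cross d id (n d) w / s d).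
  by apply: measurable_funD => //; exact: measurable_funM.
have mC : measurable_fun [set: T] (fun w => cross d g (n d) w / s d) by exact: measurable_funM.
have iB := integ_comp P cp (t3_bnd tp) mB.
have iC := integ_comp P cp (t3_bnd tp) mC.
have icA : integ P (fun w => cap (rho * ((\sum_(i < n d) r i w ^+ 2 - (n d)%:R) / a (n d)))).
  by apply: integ_cap; exact: measurable_funM.
have a_s : a (n d) / s d <= rho.
  have a0 := ltW ad; have rs0 : 0 <= rho * s d by rewrite ltW// mulr_gt0.
  rewrite ler_pdivrMr// -(ler_pXn2r (n := 2)) ?nnegrE//.
  rewrite exprMn s_sqr mulrA ler_pdivlMr// (le_trans ra)//.
  by rewrite [leRHS]mulrCA [leRHS]mulrA.
have diff : `|mean P (fun w => p (ssq (n d) w / s d + cross d id (n d) w / s d)) -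
    mean P (fun w => p (cross d g (n d) w / s d))| <= 2 * C * (E + E).
  rewrite -meanB// (le_trans (mean_norm_le (integB iB iC)))//.
  apply: (@le_trans _ _ (mean P (fun w => 2 * C *
     (cap (rho * ((\sum_(i < n d) r i w ^+ 2 - (n d)%:R) / a (n d))) +
      `|(s d)^-1 * (cross d id (n d) w - cross d g (n d) w)|)))).
    apply: mean_le; [exact/integ_norm/integB|
      by apply: integZ; apply: integD => //; exact: integ_norm|].
    move=> w; rewrite (le_trans (taylor3_cap _ _ tp))// ler_wpM2l ?mulr_ge0//.
    rewrite -addrA (le_trans (cap_add _ _))// lerD//.
      rewrite /sumsq; apply: le_cap; set x := _ - _.
      rewrite (_ : x / s d = a (n d) / s d * (x / a (n d))); last by field; rewrite !gt_eqF.
      rewrite normrM (normrM rho) ler_wpM2r//.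
      by rewrite ger0_norm ?divr_ge0 ?(ltW ad) ?(ltW s0)// (gtr0_norm rho0).
    rewrite (le_trans (cap_le_norm _))//.
    by rewrite -mulrBl mulrC.
  rewrite meanZ; last by apply: integD => //; exact: integ_norm.
  rewrite ler_wpM2l ?mulr_ge0// meanD//; last exact: integ_norm.
  rewrite lerD//.
  by rewrite (le_trans (ler_distlCDr hcap))// [leRHS]splitr lerD2r.
have clt := clt_bound d0 r_same r_indep (V_law (d := d)) (V_indep d0) (rV_indep d0) mg gB g0 (n_gt0 d) tp k0.
have err : lindeberg_error d r g B (n d) k + 2 * k + k^-1 * (4 * normal_m4 R / (n d)%:R) <= 4 * E.
  rewrite /lindeberg_error -/s2 (invfM 2 (n d)%:R); apply: (lindeberg_terms_le B0 m40 k0 (ltW th0)) => //.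
  - by rewrite ge_min lexx.
  - by rewrite /k divfK// gt_eqF.
  - by rewrite -/D mulrC -ler_pdivlMr// ge_min lexx orbT.
  - by rewrite ler_pdivrMr// exprn_gt0.
rewrite -(subrKA (mean P (fun w => p (cross d g (n d) w / s d)))).
rewrite (le_trans (ler_normD _ _))//.
rewrite (@le_trans _ _ (C * (4 * E) + 2 * C * (E + E)))//.
  rewrite lerD//; last by rewrite distrC.
  by rewrite distrC (le_trans clt)// ler_wpM2l.
by rewrite (_ : _ + _ = 8 * (C * E)) //; ring.
Unshelve. all: by end_near. Qed.

End main.

Theorem theorem3p8
  (R : realType)
  (* the random walks *)
  (dT : measure_display) (T : measurableType dT) (P : probability T R)
  (r : nat -> {RV P >-> R})
  (V : forall d : nat, nat -> {RV P >-> borel_rV R d})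
  (* the generic random variable of which the r i are copies *)
  (dT0 : measure_display) (T0 : measurableType dT0) (P0 : probability T0 R)
  (r0 : {RV P0 >-> R})
  (r0_mean : ('E_P0[r0] = 0)%E)
  (r0_var : ('E_P0[(fun w => r0 w ^+ 2)%R] = 1)%E)
  (r_law : forall i, same_law (r i) r0)
  (r_indep : mutually_independent P (fun i => sigma_rv (r i)))
  (V_law : forall d i (j : 'I_d),
    P [set w | V d i w = delta_mx 0 j] = (d%:R^-1)%:E)
  (V_indep : forall d, (0 < d)%N ->
    mutually_independent P (fun i => sigma_rv (V d i)))
  (rV_indep : forall d, (0 < d)%N ->
    independent P (sigma_seq r) (sigma_seq (V d)))
  (* the stable limit of the sums of squares *)
  (alpha : R) (alpha_gt1 : 1 < alpha) (alpha_lt2 : alpha < 2)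
  (L : R -> R) (L_sv : slowly_varying L)
  (dZ : measure_display) (Z : measurableType dZ) (PZ : probability Z R)
  (zeta : {RV PZ >-> R})
  (zeta_mean : ('E_PZ[zeta] = 0)%E)
  (zeta_stable : spectrally_positive_stable alpha (distribution PZ zeta))
  (sum_sqr_cvg : cvg_in_law P
    (fun m w => (\sum_(i < m) r i w ^+ 2 - m%:R)
                / (m%:R `^ alpha^-1 * L m%:R))
    PZ zeta)
  (* the number of steps *)
  (n : nat -> nat) (n_gt0 : forall d, (0 < n d)%N)
  (n_cvg : n d @[d --> \oo] --> \oo) :
  (forall delta : R, 0 < delta ->
    (\forall d \near \oo,
      d%:R `^ (alpha / (2 * alpha - 2) + delta) < (n d)%:R) ->
    cvg_in_law P
      (fun d w => (euclid_norm (walk r (V d) (n d) w) ^+ 2 - (n d)%:R)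
                  / Num.sqrt (2 * (n d)%:R ^+ 2 / d%:R))
      (normal_prob 0 1) idfun)
  /\
  (forall delta : R, 0 < delta ->
    (\forall d \near \oo,
      (n d)%:R < d%:R `^ (alpha / (2 * alpha - 2) - delta)) ->
    cvg_in_law P
      (fun d w => (euclid_norm (walk r (V d) (n d) w) ^+ 2 - (n d)%:R)
                  / ((n d)%:R `^ alpha^-1 * L (n d)%:R))
      PZ zeta).
Proof.
have r_same i : same_law (r i) (r 0%N) by move=> A mA; rewrite !r_law.
have i2 : integ P0 (fun w => r0 w ^+ 2).
  apply/integrableP; split; first by apply/measurable_EFinP; exact: measurable_funX.
  rewrite (_ : integral _ _ _ = 1%E) ?ltry// -r0_var unlock.
  by apply: eq_integral => w _ /=; rewrite ger0_norm// sqr_ge0.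
have s0 : sqint P0 r0 by split => //; exact: measurable_funPT.
have i1 := sqint_integ s0.
have mid : measurable_fun [set: R] (@id R) by exact: measurable_id.
have msqr : measurable_fun [set: R] (fun x : R => x ^+ 2) by exact: measurable_funX.
have [_ mean_r] := same_law_integ_mean (r_law 0%N) mid i1.
have [isqr mean_r2] := same_law_integ_mean (r_law 0%N) msqr i2.
have r_sqint : sqint P (r 0%N) by split => //; exact: measurable_funPT.
have r_mean : mean P (r 0%N) = 0.
  by rewrite [LHS]mean_r; apply: EFin_inj; rewrite -expectation_mean.
have r_var : mean P (fun w => r 0%N w ^+ 2) = 1.
  by rewrite [LHS]mean_r2; apply: EFin_inj; rewrite -expectation_mean.
pose a m : R := m%:R `^ alpha^-1 * L m%:R.
have a_gt0 m : (0 < m)%N -> 0 < a m.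
  by move=> m0; rewrite mulr_gt0 ?powR_gt0 ?L_sv.1// ltr0n.
have [zeta_nd _ _] := zeta_stable.
have alpha_gt0 : 0 < alpha by rewrite (lt_trans _ alpha_gt1).
have growth := norming_growth r_indep zeta_nd a_gt0 sum_sqr_cvg alpha_gt0 L_sv (fun=> erefl).
split=> delta delta0 rate.
  apply: (supercritical_cvg r_same r_sqint r_mean r_var r_indep V_law V_indep rV_indep
    a_gt0 sum_sqr_cvg n_gt0 n_cvg) => eta eta0.
  exact: (supercritical_norming alpha_gt1 a_gt0 growth n_gt0 n_cvg delta0 rate eta0).
apply: (subcritical_cvg r_same r_sqint r_mean r_var r_indep V_law V_indep rV_indep
  a_gt0 sum_sqr_cvg n_gt0 n_cvg) => eta eta0.
exact: (subcritical_norming alpha_gt1 a_gt0 growth n_gt0 n_cvg delta0 rate eta0).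
Qed.
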